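(* Let the coefficients $f,u,b,\sigma$ satisfy the conditions listed in the context and let the step size $h=T/M$ satisfy $h\in(0,\min\{1,1/\zeta\})$. Let $m\ge2$ and let the i.i.d. initial conditions satisfy $X^i_0\in L^m_0(\mathbb R^d)$ for all $i\in\{1,\dots,N\}$. Let $\hat X^{i,N}$ be the continuous-time extension of the split-step method (SSM) defined in the context, and let $2p\in[2,m]$. Then there exists a constant $C>0$ independent of $h,N,M$ (but depending on $T$ and $m$) such that $$\sup_{i\in\{1,\dots,N\}}\ \sup_{0\le t\le T}\ \mathbb E\big[|\hat X^{i,N}_t|^{2p}\big]\le C\big(1+\mathbb E\big[|\hat X^{\cdot}_0|^{2p}\big]\big)<\infty,$$ where $\mathbb E[|\hat X^\cdot_0|^{2p}]$ denotes the common value of $\mathbb E[|\hat X^{i,N}_0|^{2p}]=\mathbb E[|X^i_0|^{2p}]$.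
   Context: Fix integers $d,l\ge1$ and $T\in(0,\infty)$, and a complete filtered probability space $(\Omega,\mathcal F,(\mathcal F_t)_{t\ge0},\mathbb P)$ carrying independent $\mathbb R^l$-valued Brownian motions $W^1,W^2,\dots$, independent of a sufficiently rich $\sigma$-algebra $\mathcal F_0$. $L^m_0(\mathbb R^d)$ is the space of $\mathcal F_0$-measurable $\mathbb R^d$-valued random variables with finite $m$-th absolute moment. $|\cdot|$ is the Euclidean norm for vectors and the Frobenius norm for matrices. $\mathcal P_2(\mathbb R^d)$ is the set of probability measures on $\mathbb R^d$ with finite second moment, $W^{(2)}$ the 2-Wasserstein distance on it, $\delta_x$ the Dirac measure at $x$. The initial conditions $X^1_0,X^2_0,\dots$ are independent and identically distributed. The maps $f:\mathbb R^d\to\mathbb R^d$, $u:\mathbb R^d\times\mathcal P_2(\mathbb R^d)\to\mathbb R^d$, $b:[0,T]\times\mathbb R^d\times\mathcal P_2(\mathbb R^d)\to\mathbb R^d$, $\sigma:[0,T]\times\mathbb R^d\times\mathcal P_2(\mathbb R^d)\to\mathbb R^{d\times l}$ are measurable and $v(x,\mu)=\int_{\mathbb R^d}f(x-y)\,\mu(\mathrm dy)+u(x,\mu)$. Conditions on the coefficients: - $b,\sigma$ are $1/2$-Hölder continuous in time, uniformly in $(x,\mu)$, and there are $L_b,L_\sigma\ge0$ such that for all $t\in[0,T]$, $x,x'\in\mathbb R^d$, $\mu,\mu'\in\mathcal P_2(\mathbb R^d)$: $|b(t,x,\mu)-b(t,x',\mu')|^2\le L_b(|x-x'|^2+W^{(2)}(\mu,\mu')^2)$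 and $|\sigma(t,x,\mu)-\sigma(t,x',\mu')|^2\le L_\sigma(|x-x'|^2+W^{(2)}(\mu,\mu')^2)$. - There are $L_u\in\mathbb R$, $L_{\hat u}>0$, $L_{\tilde u}\ge0$, $q_1>0$ such that for all $x,x',\mu,\mu'$: $\langle x-x',u(x,\mu)-u(x',\mu)\rangle\le L_u|x-x'|^2$; $|u(x,\mu)-u(x',\mu)|\le L_{\hat u}(1+|x|^{q_1}+|x'|^{q_1})|x-x'|$; $|u(x,\mu)-u(x,\mu')|^2\le L_{\tilde u}W^{(2)}(\mu,\mu')^2$. - There are $L_f\in\mathbb R$, $L_{\hat f}>0$, $q_2>0$ such that for all $x,x'$: $\langle x-x',f(x)-f(x')\rangle\le L_f|x-x'|^2$; $|f(x)-f(x')|\le L_{\hat f}(1+|x|^{q_2}+|x'|^{q_2})|x-x'|$; $f(x)=-f(-x)$; and $f(\mathbf 0)=\mathbf 0$. SSM: for $N,M\ge1$ let $h=T/M$, $t_n=nh$, $n\in\{0,\dots,M\}$. Set $\hat X^{i,N}_0=X^i_0$ and, for $n\in\{0,\dots,M-1\}$ and all $i\in\{1,\dots,N\}$, let $(Y^{1,\star,N}_n,\dots,Y^{N,\star,N}_n)\in\mathbb R^{Nd}$ be the unique solution of the coupled implicit system $$Y^{i,\star,N}_n=\hat X^{i,N}_n+h\,v(Y^{i,\star,N}_n,\hat\mu^{Y,N}_n),\qquad \hat\mu^{Y,N}_n=\frac1N\sum_{j=1}^N\delta_{Y^{j,\star,N}_n},\qquad i=1,\dots,N,$$ and set $$\hat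 X^{i,N}_{n+1}=Y^{i,\star,N}_n+b(t_n,Y^{i,\star,N}_n,\hat\mu^{Y,N}_n)h+\sigma(t_n,Y^{i,\star,N}_n,\hat\mu^{Y,N}_n)(W^i_{t_{n+1}}-W^i_{t_n}).$$ The step size is constrained through $$\zeta=\max\{2(L_f+L_u),\ 4L_f^++2L_u+2L_{\tilde u}+1,\ 0\},\qquad L_f^+=\max\{0,L_f\},$$ with $1/\zeta:=\infty$ if $\zeta=0$; under $h<\min\{1,1/\zeta\}$ the implicit system has a unique solution. Continuous extension: $\hat X^{i,N}_0=X^i_0$ and for $t\in[0,T]$ $$\mathrm d\hat X^{i,N}_t=\big(v(Y^{i,\star,N}_{\kappa(t)},\hat\mu^{Y,N}_{\kappa(t)})+b(\kappa(t),Y^{i,\star,N}_{\kappa(t)},\hat\mu^{Y,N}_{\kappa(t)})\big)\mathrm dt+\sigma(\kappa(t),Y^{i,\star,N}_{\kappa(t)},\hat\mu^{Y,N}_{\kappa(t)})\,\mathrm dW^i_t,$$ with $\kappa(t)=\sup\{t_n:t_n\le t,\ n\in\{0,\dots,M-1\}\}$ and $Y^{i,\star,N}_{t_n}:=Y^{i,\star,N}_n$, $\hat\mu^{Y,N}_{t_n}:=\hat\mu^{Y,N}_n$. Constants $C$ may depend on the fixed problem data (dimensions, coefficient functions and their constants, $T$, $m$, $p$, the law of the initial condition) but not on $h,N,M$. *)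

(* Defs.v *)
From HB Require Import structures.
From mathcomp Require Import all_boot all_order all_algebra.
From mathcomp Require Import all_classical all_reals all_analysis.
From mathcomp Require Import measurable_realfun.

Set Implicit Arguments.
Unset Strict Implicit.
Unset Printing Implicit Defensive.

Import Order.TTheory GRing.Theory Num.Theory.
Import numFieldNormedType.Exports.

Local Open Scope classical_set_scope.
Local Open Scope ring_scope.

(* Vectors of R^d are column matrices. The norm of the library on matrices is
   the sup norm, hence the separate definition of the Euclidean norm, which is
   the Frobenius norm on rectangular matrices. *)
Definition enorm {R : realType} {m n : nat} (A : 'M[R]_(m, n)) : R :=
  Num.sqrt (\sum_(i < m) \sum_(j < n) A i j ^+ 2).

Definition inner {R : realType} {d : nat} (x y : 'cV[R]_d) : R :=
  \sum_(i < d) x i 0 * y i 0.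

Definition borel_mx (R : realType) (m n : nat) :=
  g_sigma_algebraType (@open 'M[R]_(m, n)).

Notation borel R d := (borel_mx R d 1).

Section enorm_measurable.
Variables (R : realType).

Lemma measurable_entry m n (i : 'I_m) (j : 'I_n) :
  measurable_fun setT (fun A : borel_mx R m n => (A : 'M[R]_(m, n)) i j).
Proof.
apply: (measurability _ (RGenOInfty.measurableE R)).
move=> _ [_ [a ->] <-]; rewrite setTI.
apply: sub_sigma_algebra.
apply: (@open_comp _ _ (fun A : 'M[R]_(m, n) => A i j)).
  by move=> A _; exact: coord_continuous.
exact: interval_open.
Qed.

Lemma measurable_enorm m n :
  measurable_fun setT (fun A : borel_mx R m n => enorm (A : 'M[R]_(m, n))).
Proof.
apply: (@measurableT_comp _ _ _ _ _ _ (@Num.sqrt R)).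
  by apply: continuous_measurable_fun; exact: sqrt_continuous.
apply: measurable_sum => i; apply: measurable_sum => j.
by apply: measurable_funX; exact: measurable_entry.
Qed.

End enorm_measurable.

Record P2 (R : realType) (d : nat) := MkP2 {
  p2_prob :> probability (borel R d) R ;
  p2_moment : (\int[p2_prob]_x ((enorm (x : 'cV[R]_d)) ^+ 2)%:E < +oo)%E }.

(* (1/N) sum_(j < N) delta_(y j); only the first N values of y matter. *)
Section empirical_measure.
Variables (R : realType) (d N : nat).
Hypothesis N_gt0 : (0 < N)%N.
Variable y : nat -> 'cV[R]_d.

Definition empirical_measure (_ : (0 < N)%N) : set (borel R d) -> \bar R :=
  mscale (N%:R^-1)%:nng (msum (fun j => @dirac _ (borel R d) (y j) R) N).

HB.instance Definition _ := Measure.on (empirical_measure N_gt0).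

Let empirical_setT : empirical_measure N_gt0 setT = 1%E.
Proof.
rewrite /empirical_measure /mscale /=.
have -> : msum (fun j => @dirac _ (borel R d) (y j) R) N setT = N%:R%:E.
  transitivity (\sum_(j < N) 1%:E : \bar R)%E.
    by apply: eq_bigr => j _; exact: diracT.
  by rewrite sumEFin sumr_const card_ord.
rewrite -EFinM mulVf//.
by rewrite pnatr_eq0 -lt0n.
Qed.

HB.instance Definition _ :=
  Measure_isProbability.Build _ _ _ (empirical_measure N_gt0) empirical_setT.

Let empirical_moment :
  (\int[empirical_measure N_gt0]_x
     ((enorm (x : 'cV[R]_d)) ^+ 2)%:E < +oo)%E.
Proof.
have mf : measurable_fun [set: borel R d]
    (fun x : borel R d => ((enorm (x : 'cV[R]_d)) ^+ 2)%:E).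
  by apply/measurable_EFinP; apply: measurable_funX; exact: measurable_enorm.
have f0 (x : borel R d) :
  [set: borel R d] x -> (0 <= ((enorm (x : 'cV[R]_d)) ^+ 2)%:E)%E.
  by move=> _; rewrite lee_fin sqr_ge0.
rewrite /empirical_measure ge0_integral_mscale//.
rewrite ge0_integral_measure_sum//.
under eq_bigr do rewrite integral_dirac// diracT mul1e.
by rewrite sumEFin -EFinM ltry.
Qed.

Definition empirical : P2 R d :=
  @MkP2 R d (empirical_measure N_gt0) empirical_moment.

End empirical_measure.

Section wasserstein.
Variables (R : realType) (d : nat).

Definition coupling (mu nu : P2 R d)
    (pi : probability (borel R d * borel R d)%type R) : Prop :=
  (forall A : set (borel R d), measurable A -> pi (fst @^-1` A) = mu A) /\
  (forall A : set (borel R d), measurable A -> pi (snd @^-1` A) = nu A).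

Definition W2 (mu nu : P2 R d) : R :=
  Num.sqrt (fine (ereal_inf
    [set (\int[pi]_z ((enorm ((z.1 : 'cV[R]_d) - z.2)) ^+ 2)%:E)%E |
     pi in coupling mu nu])).

Definition W2_open : set (set (P2 R d)) :=
  [set A | forall mu, A mu ->
    exists2 e : R, 0 < e & forall nu, W2 mu nu < e -> A nu].

End wasserstein.

HB.instance Definition _ (R : realType) (d : nat) := gen_eqMixin (P2 R d).
HB.instance Definition _ (R : realType) (d : nat) := gen_choiceMixin (P2 R d).
HB.instance Definition _ (R : realType) (d : nat) :=
  isPointed.Build (P2 R d) (empirical (ltn0Sn 0) (fun=> 0)).

Definition borelP2 (R : realType) (d : nat) :=
  g_sigma_algebraType (@W2_open R d).

Section probability_notions.
Context (disp : measure_display) (Omega : measurableType disp) (R : realType).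
Variable P : probability Omega R.

(* sigma(X) *)
Definition sigma_rv (disp' : measure_display) (S : measurableType disp')
    (X : Omega -> S) : set (set Omega) :=
  [set X @^-1` B | B in measurable].

(* sigma(W_t : t >= 0) *)
Definition sigma_process l (W : R -> Omega -> 'cV[R]_l) : set (set Omega) :=
  <<s \bigcup_(t in `[0, +oo[) sigma_rv (W t : Omega -> borel R l) >>.

Definition independent2 (G H : set (set Omega)) : Prop :=
  forall A B, G A -> H B -> P (A `&` B) = (P A * P B)%E.

Definition mutually_independent (I : choiceType) (G : I -> set (set Omega)) :
  Prop :=
  forall (s : seq I) (A : I -> set Omega), uniq s ->
    (forall i, i \in s -> G i (A i)) ->
    P (\big[setI/setT]_(i <- s) A i) = (\prod_(i <- s) fine (P (A i)))%:E.

Record complete_filtration (F : R -> set (set Omega)) : Prop := {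
  cf_complete : measure_is_complete P ;
  cf_sigma : forall t, 0 <= t -> sigma_algebra setT (F t) ;
  cf_sub : forall t, 0 <= t -> F t `<=` measurable ;
  cf_mono : forall s t, 0 <= s -> s <= t -> F s `<=` F t ;
  cf_null : P.-negligible `<=` F 0 }.

Record brownian_motion l (F : R -> set (set Omega))
    (W : R -> Omega -> 'cV[R]_l) : Prop := {
  bm_adapted : forall t, 0 <= t -> sigma_rv (W t : Omega -> borel R l) `<=` F t ;
  bm_start : {ae P, forall w, W 0 w = 0} ;
  bm_indep : forall s t, 0 <= s -> s < t ->
    independent2 (F s) (sigma_rv (fun w => W t w - W s w : borel R l)) ;
  (* W_t - W_s ~ N(0, (t - s) I_l); the second parameter of [normal_prob]
     is the standard deviation *)
  bm_coord_indep : forall s t, 0 <= s -> s < t ->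
    mutually_independent (fun k : 'I_l =>
      sigma_rv (fun w => (W t w - W s w) k 0)) ;
  bm_coord_law : forall s t, 0 <= s -> s < t -> forall (k : 'I_l) (B : set R),
    measurable B ->
    P ((fun w => (W t w - W s w) k 0) @^-1` B)
      = normal_prob 0 (Num.sqrt (t - s)) B ;
  bm_continuous : {ae P, forall w,
    {within `[0, +oo[, continuous (fun t => W t w)}} }.

(* W^1, W^2, ... are independent Brownian motions, jointly independent of F_0 *)
Definition independent_brownian_motions l (F : R -> set (set Omega))
    (W : nat -> R -> Omega -> 'cV[R]_l) : Prop :=
  (forall i, brownian_motion F (W i)) /\
  mutually_independent (fun o : option nat =>
    if o is Some i then sigma_process (W i) else F 0).

Definition iid d (X : nat -> Omega -> 'cV[R]_d) : Prop :=
  mutually_independent (fun i => sigma_rv (X i : Omega -> borel R d)) /\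
  (forall i j (B : set (borel R d)), measurable B ->
     P (X i @^-1` B) = P (X j @^-1` B)).

Definition in_L0 d (F : R -> set (set Omega)) (m : R)
    (X : Omega -> 'cV[R]_d) : Prop :=
  sigma_rv (X : Omega -> borel R d) `<=` F 0 /\ ('E_P[(fun w => enorm (X w) `^ m)%R] < +oo)%E.

End probability_notions.

Section coefficients.
Variables (R : realType) (d : nat).

Definition time_coef_cond (m n : nat) (T L : R)
    (g : R -> 'cV[R]_d -> P2 R d -> 'M[R]_(m, n)) : Prop :=
  [/\ measurable_fun [set z : R * (borel R d * borelP2 R d) | z.1 \in `[0, T]]
        (fun z : R * (borel R d * borelP2 R d) =>
          g z.1 z.2.1 z.2.2 : borel_mx R m n),
      exists K : R, forall s t x mu, s \in `[0, T] -> t \in `[0, T] ->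
        enorm (g t x mu - g s x mu) <= K * `|t - s| `^ 2^-1,
      0 <= L
    & forall t x x' mu mu', t \in `[0, T] ->
        enorm (g t x mu - g t x' mu') ^+ 2
          <= L * (enorm (x - x') ^+ 2 + W2 mu mu' ^+ 2) ].

Record u_cond (Lu Luhat Lutilde q1 : R)
    (u : 'cV[R]_d -> P2 R d -> 'cV[R]_d) : Prop := {
  u_measurable : measurable_fun setT
    (fun z : borel R d * borelP2 R d => u z.1 z.2 : borel R d) ;
  u_Luhat : 0 < Luhat ;
  u_Lutilde : 0 <= Lutilde ;
  u_q1 : 0 < q1 ;
  u_onesided : forall x x' mu,
    inner (x - x') (u x mu - u x' mu) <= Lu * enorm (x - x') ^+ 2 ;
  u_growth : forall x x' mu,
    enorm (u x mu - u x' mu)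
      <= Luhat * (1 + enorm x `^ q1 + enorm x' `^ q1) * enorm (x - x') ;
  u_measure : forall x mu mu',
    enorm (u x mu - u x mu') ^+ 2 <= Lutilde * W2 mu mu' ^+ 2 }.

Record f_cond (Lf Lfhat q2 : R) (f : 'cV[R]_d -> 'cV[R]_d) : Prop := {
  f_measurable : measurable_fun setT (f : borel R d -> borel R d) ;
  f_Lfhat : 0 < Lfhat ;
  f_q2 : 0 < q2 ;
  f_onesided : forall x x',
    inner (x - x') (f x - f x') <= Lf * enorm (x - x') ^+ 2 ;
  f_growth : forall x x',
    enorm (f x - f x')
      <= Lfhat * (1 + enorm x `^ q2 + enorm x' `^ q2) * enorm (x - x') ;
  f_odd : forall x, f x = - f (- x) ;
  f_zero : f 0 = 0 }.

Definition v_coef (f : 'cV[R]_d -> 'cV[R]_d)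
    (u : 'cV[R]_d -> P2 R d -> 'cV[R]_d) (x : 'cV[R]_d) (mu : P2 R d) :
    'cV[R]_d :=
  \col_k (\int[mu]_y (f (x - y)) k 0) + u x mu.

Definition zeta (Lf Lu Lutilde : R) : R :=
  Num.max (Num.max (2 * (Lf + Lu))
                   (4 * Num.max 0 Lf + 2 * Lu + 2 * Lutilde + 1)) 0.

End coefficients.

Section split_step_method.
Context (disp : measure_display) (Omega : measurableType disp) (R : realType).
Variables (d l : nat) (T : R).
Variables (f : 'cV[R]_d -> 'cV[R]_d) (u : 'cV[R]_d -> P2 R d -> 'cV[R]_d).
Variables (b : R -> 'cV[R]_d -> P2 R d -> 'cV[R]_d).
Variables (sigma : R -> 'cV[R]_d -> P2 R d -> 'M[R]_(d, l)).
Variables (W : nat -> R -> Omega -> 'cV[R]_l) (X0 : nat -> Omega -> 'cV[R]_d).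
Variables (N : nat) (hN : (0 < N)%N) (M : nat).

Definition step : R := T / M%:R.

Definition grid (n : nat) : R := n%:R * step.

(* Particles are numbered from 0. The implicit system is solved pointwise in
   omega; X i n and Y i n are constrained only for i < N and n <= M (resp.
   n < M). *)
Record is_SSM (X Y : nat -> nat -> Omega -> 'cV[R]_d) : Prop := {
  ssm_init : forall i w, (i < N)%N -> X i 0%N w = X0 i w ;
  ssm_implicit : forall n w, (n < M)%N -> forall i, (i < N)%N ->
    Y i n w = X i n w
      + step *: v_coef f u (Y i n w) (empirical hN (fun j => Y j n w)) ;
  ssm_explicit : forall n w, (n < M)%N -> forall i, (i < N)%N ->
    X i n.+1 w = Y i n w
      + step *: b (grid n) (Y i n w) (empirical hN (fun j => Y j n w))
      + sigma (grid n) (Y i n w) (empirical hN (fun j => Y j n w))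
          *m (W i (grid n.+1) w - W i (grid n) w) }.

(* the index n with kappa t = t_n *)
Definition kappa_idx (t : R) : nat :=
  (\max_(n < M | (grid n <= t)%R) n)%N.

(* The stochastic integral has an integrand that is constant on each
   [t_n, t_(n+1)), so that it is the Ito integral of an elementary process. *)
Definition SSM_extension (Y : nat -> nat -> Omega -> 'cV[R]_d)
    (i : nat) (t : R) (w : Omega) : 'cV[R]_d :=
  let mu n := empirical hN (fun j => Y j n w) in
  let drift n := v_coef f u (Y i n w) (mu n) + b (grid n) (Y i n w) (mu n) in
  X0 i w
  + \col_k (\int[lebesgue_measure]_(s in `[0, t]) (drift (kappa_idx s)) k 0)
  + \sum_(n < M) sigma (grid n) (Y i n w) (mu n)
      *m (W i (Num.min (grid n.+1) t) w - W i (Num.min (grid n) t) w).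

End split_step_method.

(* Main.v *)
(* For one particle the implicit drift is not dissipative: |x_i|^(2p-2) x_i tested
   against f(x_i - x_j) has no sign. Two quantities are nevertheless controlled
   pathwise, up to a factor 1 + C h, by the implicit step: the distances
   |Y_i - Y_k|, because both particles see the same measure, and the mean square
   of all particles, because f is odd. Their combination
     Q_i(x) = avg_k (|x_i - x_k|^2 + |x_k|^2)
   dominates |x_i|^2 / 2, and it is the square of a Euclidean norm. A second order
   Taylor bound of its p-th power, in which the term linear in the Brownian
   increment has mean zero, shows that a common bound K of all E[Q_i(X_n)^p] at
   time t_n becomes K + C h (1 + K) at time t_(n+1), and Gronwall's argument
   concludes on the grid. The integrability and independence used there need Y_n
   to be F_(t_n)-measurable, which holds since Y_n is a Lipschitz function of X_n.
   Between t_n and t_(n+1) the extension is a convex combination of X_n and Y_n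
   plus terms of linear growth. *)

Require Import Defs.
From HB Require Import structures.
From mathcomp Require Import all_boot all_order all_algebra.
From mathcomp Require Import all_classical all_reals all_analysis.
From mathcomp Require Import measurable_realfun.
From mathcomp Require Import ring lra.

Set Implicit Arguments.
Unset Strict Implicit.
Unset Printing Implicit Defensive.

Import Order.TTheory GRing.Theory Num.Theory.
Import numFieldNormedType.Exports.

Local Open Scope classical_set_scope.
Local Open Scope ring_scope.

(** * Real powers *)

(** The estimate must be uniform in h, so a step may cost only a factor 1 + C h: an error of order
    sqrt h per step would accumulate over the T / h steps. Hence the noise is expanded to second
    order instead of being bounded by a norm inequality. Its linear term is of order sqrt h but
    centred, and the remainder involves only |dW|^2 and |dW|^(2p), whose means are O(h). The
    estimate must also be uniform in N. Q_i feels the noise of all particles, but only through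
    averages over k, for which Jensen's inequality involves no N; this is why a bound K common to
    all particles is propagated. Bounds depending on N occur only where nothing but measurability or
    integrability is extracted from them. The superlinear v is never bounded by its growth: the
    one-sided conditions control it inside the implicit equation, and between grid points it is
    eliminated through h v = Y_n - X_n. Finiteness of the moments is part of the induction, so no
    stopping times appear. *)

Section power_inequalities.
Variables (R : realType) (p : R).
Hypothesis p1 : 1 <= p.

Let p_gt0 : 0 < p. Proof. exact: lt_le_trans p1. Qed.

(** Bernoulli's inequality for real exponents: Young's inequality y * 1 <= y^p / p + 1 / q with q =
    p / (p - 1), multiplied by p. The case p = 1 is separate because q is then infinite. *)
Lemma powR_ge_tangent (y : R) : 0 <= y -> 1 + p * (y - 1) <= y `^ p.
Proof.
move=> y0; have [<-|p_neq1] := eqVneq 1 p; first by rewrite powRr1// mul1r subrKC.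
have {p_neq1} lt1p : 1 < p by rewrite lt_neqAle p_neq1.
have q0 : 0 < p / (p - 1) by rewrite divr_gt0// subr_gt0.
have := @conjugate_powR _ y 1 p (p / (p - 1)) y0 ler01 p_gt0 q0.
rewrite powR1 mulr1 invf_div.
have -> : p^-1 + (p - 1) / p = 1 by field; rewrite gt_eqF.
move=> /(_ erefl); rewrite -(ler_pM2l p_gt0) => h.
have -> : y `^ p = p * (y `^ p / p + 1 * ((p - 1) / p)) - (p - 1).
  by field; rewrite gt_eqF.
by apply: le_trans (lerB h (lexx (p - 1))); lra.
Qed.

(** Young's inequality for y^p * 1 with the exponents n / p and n / (n - p). It carries over to real
    p a Taylor bound proved by induction for natural exponents. *)
Lemma powR_le_natpow (n : nat) (y : R) : (0 < n)%N -> p <= n%:R -> 0 <= y ->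
  y `^ p <= 1 + p / n%:R * (y ^+ n - 1).
Proof.
move=> n0 pn y0; have n0' : 0 < n%:R :> R by rewrite ltr0n.
have := conjugate_powR (powR_ge0 y p) ler01 (divr_gt0 n0' p_gt0).
have [->|pneqn] := eqVneq p n%:R.
  by move=> _; rewrite divff ?gt_eqF// mul1r subrKC powR_mulrn.
have {}pn : p < n%:R by rewrite lt_neqAle pneqn.
have q0 : 0 < n%:R / (n%:R - p) by rewrite divr_gt0// subr_gt0.
move=> /(_ _ q0); rewrite powR1 mulr1 -powRrM.
have -> : p * (n%:R / p) = n%:R by field; rewrite gt_eqF.
rewrite powR_mulrn// => /(_ _) h; apply: le_trans (h _) _.
  by field; rewrite !gt_eqF ?subr_gt0.
by rewrite le_eqVlt; apply/orP; left; apply/eqP; field; rewrite !gt_eqF ?subr_gt0.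
Qed.

(** Averaging the tangent inequality at the mean s cancels the linear terms. Homogeneity, t^p = s^p
    (t / s)^p, moves the point of tangency to 1, which requires s <> 0. *)
Lemma powR_jensen (I : finType) (w t : I -> R) :
  (forall i, 0 <= w i) -> \sum_i w i = 1 -> (forall i, 0 <= t i) ->
  (\sum_i w i * t i) `^ p <= \sum_i w i * t i `^ p.
Proof.
move=> w0 w1 t0; set s := \sum_i w i * t i.
have : 0 <= s by apply: sumr_ge0 => i _; rewrite mulr_ge0.
rewrite le_eqVlt => /predU1P[<-|s0].
  rewrite powR0 ?gt_eqF//.
  by apply: sumr_ge0 => i _; rewrite mulr_ge0// powR_ge0.
have sp : 0 <= s `^ p by rewrite powR_ge0.
apply: (@le_trans _ _ (\sum_i w i * (s `^ p * (1 + p * (t i / s - 1))))).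
  rewrite -[leLHS]mulr1.
  have -> : \sum_i w i * (s `^ p * (1 + p * (t i / s - 1))) =
      s `^ p * (\sum_i w i + p * (s^-1 * s - \sum_i w i)).
    rewrite /s !mulr_sumr -sumrB mulr_sumr -big_split/= mulr_sumr.
    by apply: eq_bigr => i _; ring.
  by rewrite w1 mulVf ?gt_eqF// subrr mulr0 addr0.
apply: ler_sum => i _; rewrite ler_wpM2l//.
have -> : t i `^ p = s `^ p * (t i / s) `^ p.
  by rewrite -powRM ?(ltW s0) ?divr_ge0 ?(ltW s0)// mulrCA divff ?gt_eqF// mulr1.
by rewrite ler_wpM2l// powR_ge_tangent// divr_ge0// ltW.
Qed.

Lemma powR_avg (n : nat) (t : 'I_n -> R) : (0 < n)%N -> (forall i, 0 <= t i) ->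
  (n%:R^-1 * \sum_i t i) `^ p <= n%:R^-1 * \sum_i t i `^ p.
Proof.
move=> n0 t0; rewrite !mulr_sumr; apply: powR_jensen => //.
by rewrite sumr_const card_ord -[_ *+ n]mulr_natr mulVf// pnatr_eq0 -lt0n.
Qed.

Lemma powR_sum_le (n : nat) (t : 'I_n -> R) : (forall i, 0 <= t i) ->
  (\sum_i t i) `^ p <= n%:R `^ p * \sum_i t i `^ p.
Proof.
case: n t => [|n] t t0.
  by rewrite big_ord0 powR0 ?gt_eqF// mul0r.
have n0 : 0 < n.+1%:R :> R by rewrite ltr0n.
have S0 : 0 <= n.+1%:R^-1 * \sum_i t i.
  by apply: mulr_ge0; [rewrite invr_ge0 ltW|exact: sumr_ge0].
have -> : \sum_i t i = n.+1%:R * (n.+1%:R^-1 * \sum_i t i).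
  by rewrite mulrA divff ?mul1r// gt_eqF.
rewrite powRM// ?(ltW n0)// ler_wpM2l ?powR_ge0//.
apply: le_trans (powR_avg _ _) _ => //.
rewrite ler_piMl ?invf_le1 ?ler1n//.
by apply: sumr_ge0 => i _; exact: powR_ge0.
Qed.

Lemma powRD_le (x y : R) : 0 <= x -> 0 <= y ->
  (x + y) `^ p <= 2 `^ p * (x `^ p + y `^ p).
Proof.
move=> x0 y0.
have := @powR_sum_le 2 (fun i => if i == 0 then x else y).
by rewrite !big_ord_recl !big_ord0 /= !addr0; apply => i; case: ifP.
Qed.

Lemma powR_young (a b : R) : 0 <= a -> 0 <= b ->
  a `^ (p - 1) * b <= a `^ p + b `^ p.
Proof.
move=> a0 b0; have q0 : 0 <= p - 1 by rewrite subr_ge0.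
have [ab|ba] := lerP a b.
  apply: (@le_trans _ _ (b `^ p)); last by rewrite ler_wpDl// powR_ge0.
  rewrite -[b `^ p]mulr_powRB1// mulrC ler_wpM2l//.
  by rewrite ge0_ler_powR ?nnegrE.
apply: (@le_trans _ _ (a `^ p)); last by rewrite ler_wpDr// powR_ge0.
by rewrite -[a `^ p]mulr_powRB1// mulrC ler_wpM2r ?powR_ge0// ltW.
Qed.

(** A quadratic bound of y^n can hold only on a bounded range, hence the dependence of C on M; the
    inductive step multiplies by y <= M. *)
Lemma natpow_taylor2 (n : nat) (M : R) : 0 <= M -> exists2 C : R, 0 <= C &
  forall y, 0 <= y <= M -> y ^+ n <= 1 + n%:R * (y - 1) + C * (y - 1) ^+ 2.
Proof.
move=> M0; elim: n => [|n [C C0 IH]].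
  by exists 0 => // y _; rewrite expr0 !mul0r !addr0.
exists (n%:R + M * C) => [|y /andP[y0 yM]]; first by rewrite addr_ge0// mulr_ge0.
have {}IH := IH y; rewrite exprS.
apply: le_trans (ler_wpM2l y0 (IH _)) _; first by rewrite y0.
rewrite -natr1; have : y * C * (y - 1) ^+ 2 <= M * C * (y - 1) ^+ 2.
  by rewrite ler_wpM2r ?sqr_ge0// ler_wpM2r.
by set z : R := y * C * _; rewrite (_ : y * _ = 1 + (n%:R + 1) * (y - 1) +
  n%:R * (y - 1) ^+ 2 + z); [rewrite /z; lra|rewrite /z; ring].
Qed.

(** It places a + 2c + b between 0 and 2 (a + b), as for the number |z + g|^2 that it stands for. *)
Lemma cross_le (a b c : R) : 0 <= a -> 0 <= b -> c ^+ 2 <= a * b ->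
  `|c *+ 2| <= a + b.
Proof.
move=> a0 b0 cab; rewrite -[leRHS]ger0_norm ?addr_ge0// -ler_sqr ?nnegrE//.
rewrite !real_normK ?num_real//; have := sqr_ge0 (a - b); nra.
Qed.

(* With a = |z|^2, b = |g|^2 and c = <z, g>, this is the second order Taylor
   bound of |z + g|^(2p) around z. *)
Lemma powR_taylor2 : exists2 C : R, 0 < C &
  forall a b c : R, 0 <= a -> 0 <= b -> c ^+ 2 <= a * b ->
  (a + c *+ 2 + b) `^ p
    <= a `^ p + 2 * p * (a `^ (p - 1) * c) + C * (a `^ (p - 1) * b + b `^ p).
Proof.
pose n := (Num.truncn p).+1.
have pn : p <= n%:R.
  by apply: ltW; apply: truncnS_gt.
(* The range 4 comes from (a + 2c + b) / a <= 2 (a + b) / a <= 4 when b <= a. *)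
have [C C0 HC] := @natpow_taylor2 n 4 (ler0n _ 4).
have n0 : 0 < n%:R :> R by rewrite ltr0n.
pose D := p / n%:R * C.
have D0 : 0 <= D by rewrite mulr_ge0// divr_ge0// ltW.
exists (4 `^ p + 2 * p + p + 10 * D).
  apply: ltr_wpDr; first by rewrite mulr_ge0.
  by rewrite !addr_gt0 ?mulr_gt0 ?powR_gt0.
move=> a b c a0 b0 cab; have := cross_le a0 b0 cab; rewrite ler_norml => /andP[h1 h2].
have q0 : 0 <= p - 1 by rewrite subr_ge0.
have E4 : 0 <= 4 `^ p :> R := powR_ge0 _ _.
have A0 : 0 <= a `^ (p - 1) := powR_ge0 _ _.
have B0 : 0 <= b `^ p := powR_ge0 _ _.
have AB0 : 0 <= a `^ (p - 1) * b by rewrite mulr_ge0.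
have AB0' := mulr_ge0 (ltW p_gt0) AB0.
have B0' := mulr_ge0 (ltW p_gt0) B0.
have EB := mulr_ge0 E4 B0; have EAB := mulr_ge0 E4 AB0.
have DB := mulr_ge0 D0 B0; have DAB := mulr_ge0 D0 AB0.
have [ba|ab] := lerP b a; last first.
  have cb : - b <= c <= b.
    rewrite -ler_norml -ler_sqr ?nnegrE// real_normK ?num_real//.
    by apply: le_trans cab _; rewrite expr2 ler_wpM2r// ltW.
  have h4 : (a + c *+ 2 + b) `^ p <= 4 `^ p * b `^ p.
    rewrite -powRM//; apply: ge0_ler_powR; rewrite ?nnegrE ?(ltW p_gt0)//; last 2 first.
    - by rewrite mulr_ge0.
    - by move: ab cb; lra.
    by move: h1; lra.
  have h5 : - (b `^ p) <= a `^ (p - 1) * c.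
    apply: (@le_trans _ _ (- (a `^ (p - 1) * b))).
      rewrite lerN2 -(mulr_powRB1 b0 p_gt0) mulrC ler_wpM2l//.
      by apply: ge0_ler_powR; rewrite ?nnegrE// ltW.
    by rewrite -mulrN ler_wpM2l//; move: cb; lra.
  have h6 : 0 <= p * (a `^ (p - 1) * c + b `^ p).
    by rewrite mulr_ge0 ?(ltW p_gt0)//; move: h5; lra.
  have h7 := powR_ge0 a p.
  move: h4 h6 h7 AB0' B0' EB EAB DB DAB.
  rewrite !mulrDl !mulrDr; lra.
have [a00|a_gt0] := eqVneq a 0.
  have b00 : b = 0 by apply/eqP; rewrite eq_le b0 -a00 ba.
  have c00 : c = 0.
    by apply/eqP; rewrite -sqrf_eq0 eq_le sqr_ge0 andbT (le_trans cab)// a00 mul0r.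
  by rewrite a00 b00 c00 !mulr0 mul0rn !addr0 powR0 ?gt_eqF// !addr0 mulr0.
have {}a_gt0 : 0 < a by rewrite lt_neqAle eq_sym a_gt0.
pose y := (a + c *+ 2 + b) / a.
have yE : y - 1 = (c *+ 2 + b) / a by rewrite /y; field; rewrite gt_eqF.
have y0 : 0 <= y by rewrite divr_ge0//; move: h1; lra.
have y4 : y <= 4 by rewrite ler_pdivrMr//; move: h2; lra.
have -> : (a + c *+ 2 + b) `^ p = a `^ p * y `^ p.
  by rewrite -powRM// mulrC /y divfK// gt_eqF.
have h3 : y `^ p <= 1 + p * (y - 1) + D * (y - 1) ^+ 2.
  apply: le_trans (powR_le_natpow _ pn y0) _ => //.
  have -> : 1 + p * (y - 1) + D * (y - 1) ^+ 2 =
      1 + p / n%:R * (1 + n%:R * (y - 1) + C * (y - 1) ^+ 2 - 1).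
    by rewrite /D; field; rewrite gt_eqF.
  by rewrite lerD2l ler_wpM2l ?divr_ge0 ?(ltW p_gt0)// lerD2r HC// y0.
apply: le_trans (ler_wpM2l (powR_ge0 _ _) h3) _.
have aE : a `^ p = a `^ (p - 1) * a by rewrite mulrC mulr_powRB1.
(* (2c + b)^2 <= 8 c^2 + 2 b^2 <= 10 a b, by c^2 <= a b and b <= a. *)
have h8 : (y - 1) ^+ 2 * a <= 10 * b.
  have -> : (y - 1) ^+ 2 * a = (c *+ 2 + b) ^+ 2 / a.
    by rewrite yE; field; rewrite gt_eqF.
  rewrite ler_pdivrMr//.
  have : b ^+ 2 <= a * b by rewrite expr2 ler_wpM2r.
  have := sqr_ge0 (c *+ 2 - b); move: cab; nra.
have h9 := ler_wpM2l (mulr_ge0 D0 A0) h8.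
have -> : a `^ p * (1 + p * (y - 1) + D * (y - 1) ^+ 2) =
   a `^ p + p * (a `^ (p - 1) * (c *+ 2 + b)) + D * a `^ (p - 1) * ((y - 1) ^+ 2 * a).
  have -> : c *+ 2 + b = (y - 1) * a by rewrite yE divfK// gt_eqF.
  by rewrite aE; ring.
move: h9 AB0' B0' EB EAB DB DAB; lra.
Qed.

(** The perturbed value is the convex combination, with weight h, of a + c (1 + a) and a. Jensen's
    inequality therefore leaves the factor h outside the power. *)
Lemma powR_perturb (c : R) : 0 <= c -> exists2 C : R, 0 <= C &
  forall a h, 0 <= a -> 0 <= h <= 1 ->
    (a + h * (c * (1 + a))) `^ p <= a `^ p + h * (C * (1 + a `^ p)).
Proof.
move=> c0; exists ((1 + c) `^ p * 2 `^ p + c `^ p * 2 `^ p).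
  by rewrite addr_ge0// mulr_ge0// powR_ge0.
move=> a h a0 /andP[h0 h1]; have A0 := powR_ge0 a p.
have := @powR_jensen bool (fun b => if b then h else 1 - h)
  (fun b => if b then a + c * (1 + a) else a).
rewrite !big_bool /= => /(_ _ _ _) H.
have -> : a + h * (c * (1 + a)) = h * (a + c * (1 + a)) + (1 - h) * a by ring.
apply: le_trans (H _ _ _) _.
- by case; rewrite ?subr_ge0.
- by rewrite subrKC.
- by case=> //; rewrite addr_ge0// mulr_ge0// addr_ge0.
rewrite addrC lerD//; first by rewrite ler_piMl// gerBl.
rewrite ler_wpM2l//.
have -> : a + c * (1 + a) = (1 + c) * a + c * 1 by ring.
apply: le_trans (powRD_le _ _) _; rewrite ?mulr_ge0 ?addr_ge0//.
rewrite !powRM ?addr_ge0// powR1.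
have E2 : 0 <= 2 `^ p :> R := powR_ge0 _ _.
have F0 : 0 <= (1 + c) `^ p := powR_ge0 _ _.
have G0 : 0 <= c `^ p := powR_ge0 _ _.
have := mulr_ge0 (mulr_ge0 F0 E2) A0; have := mulr_ge0 F0 E2.
have := mulr_ge0 (mulr_ge0 G0 E2) A0; lra.
Qed.

(** |x|^(2p) <= 1 + |x|^n for a natural n >= 2p, and |x|^n / n! is one term of the exponential
    series. Gaussian moments of real order thus reduce to one exponential moment, which is
    explicit. *)
Lemma powR_le_expR : exists2 C : R, 0 < C &
  forall x : R, (x ^+ 2) `^ p <= C * (expR x + expR (- x)).
Proof.
pose n := (Num.truncn (2 * p)).+1.
have pn : 2 * p <= n%:R by apply: ltW; exact: truncnS_gt.
have n0 : 0 < (n`!)%:R :> R by rewrite ltr0n fact_gt0.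
exists (1 + n`!%:R); first by rewrite addr_gt0.
move=> x.
have -> : (x ^+ 2) `^ p = `|x| `^ (2 * p).
  by rewrite -real_normK ?num_real// powRrM powR_mulrn.
have h1 : `|x| `^ (2 * p) <= 1 + `|x| ^+ n.
  have [x1|x1] := lerP `|x| 1.
    apply: (@le_trans _ _ 1); last by rewrite lerDl exprn_ge0.
    have [->|x0] := eqVneq `|x| 0.
      by rewrite powR0// mulf_neq0// gt_eqF.
    apply: (@le_trans _ _ (1 `^ (2 * p))); last by rewrite powR1.
    apply: ge0_ler_powR; rewrite ?nnegrE//.
    by rewrite mulr_ge0// ltW.
  apply: (@le_trans _ _ (`|x| ^+ n)); last by rewrite lerDr.
  by rewrite -powR_mulrn// ler_powR// ltW.
have h2 : 1 + `|x| ^+ n / n`!%:R <= expR `|x| by apply: expR_ge1Dxn.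
have h3 : expR `|x| <= expR x + expR (- x).
  by case: (ger0P x) => _; [rewrite lerDl expR_ge0|rewrite lerDr expR_ge0].
have h4 : `|x| ^+ n <= n`!%:R * expR `|x|.
  rewrite -ler_pdivrMl// mulrC; apply: le_trans h2; by rewrite lerDr.
have h5 : 1 <= expR `|x|.
  by apply: le_trans h2; rewrite lerDl divr_ge0 ?exprn_ge0// ltW.
apply: le_trans h1 _; apply: (@le_trans _ _ ((1 + n`!%:R) * expR `|x|)).
  by rewrite mulrDl mul1r lerD.
by rewrite ler_wpM2l// addr_ge0// ltW.
Qed.

End power_inequalities.

(** * Gaussian variables and independence *)

Section integral_density.
Local Open Scope ereal_scope.
Context d (T : measurableType d) (R : realType).
Variables (mu nu : {measure set T -> \bar R}) (g : T -> R).
Hypothesis mg : measurable_fun setT g.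
Hypothesis g0 : forall x, (0 <= g x)%R.
Hypothesis nuE : forall A, measurable A -> nu A = \int[mu]_(x in A) (g x)%:E.

Import HBNNSimple.

Let meg (h : T -> R) : measurable_fun setT h ->
  measurable_fun setT (fun x => (h x)%:E * (g x)%:E).
Proof.
by move=> mh; under eq_fun do rewrite -EFinM; exact/measurable_EFinP/measurable_funM.
Qed.

Let integral_density_indic E : measurable E ->
  \int[nu]_x (\1_E x)%:E = \int[mu]_x ((\1_E x)%:E * (g x)%:E).
Proof.
move=> mE; rewrite integral_indic//= setIT nuE// [LHS]integral_mkcond.
apply: eq_integral => x _; rewrite patchE indicE.
by case: ifPn => xE; rewrite ?mul1e ?mul0e.
Qed.

Let integral_density_nnsfun (f : {nnsfun T >-> R}) :
  \int[nu]_x (f x)%:E = \int[mu]_x ((f x)%:E * (g x)%:E).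
Proof.
under [LHS]eq_integral do rewrite fimfunE -fsumEFin//.
rewrite [LHS]ge0_integral_fsum//; last 2 first.
  - by move=> r; exact/measurable_EFinP/measurableT_comp.
  - by move=> n x _; rewrite EFinM nnfun_muleindic_ge0.
under [RHS]eq_integral.
  move=> x xD; rewrite fimfunE -fsumEFin// ge0_mule_fsuml; last first.
    by move=> r; rewrite EFinM nnfun_muleindic_ge0.
  over.
rewrite [RHS]ge0_integral_fsum//; last 2 first.
  - by move=> r; apply: meg; exact: measurable_funM.
  - move=> n x _; rewrite mule_ge0//; last by rewrite lee_fin.
    by rewrite EFinM nnfun_muleindic_ge0.
apply: eq_fsbigr => r _; rewrite integralZl_indic_nnsfun//.
rewrite integral_density_indic//.
have [r0|r0] := ltP r 0%R.
  rewrite preimage_nnfun0// indic0 integral0_eq ?mule0; last first.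
    by move=> x _; rewrite mul0e.
  by apply/esym/integral0_eq => x _; rewrite mulr0 mul0e.
rewrite -ge0_integralZl//=; last 2 first.
- by apply: meg.
- by move=> x _; rewrite mule_ge0 ?lee_fin.
by apply: eq_integral => x _; rewrite EFinM muleA.
Qed.

(** The density is known through the measure of sets only; indicators, simple functions and monotone
    convergence extend it to integrals. *)
Lemma ge0_integral_density (f : T -> \bar R) :
  measurable_fun setT f -> (forall x, 0 <= f x) ->
  \int[nu]_x f x = \int[mu]_x (f x * (g x)%:E).
Proof.
move=> mf f0; pose f_ := nnsfun_approx measurableT mf.
transitivity (lim (\int[nu]_x (f_ n x)%:E @[n --> \oo])).
  rewrite -monotone_convergence//=.
  - apply: eq_integral => ? /[!inE] xD; apply/esym/cvg_lim => //=.
    exact: cvg_nnsfun_approx.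
  - by move=> n; exact/measurable_EFinP/measurable_funTS.
  - by move=> n ? _; rewrite lee_fin.
  - by move=> ? _ ? ? mn; rewrite lee_fin; exact/lefP/nd_nnsfun_approx.
transitivity (lim (\int[mu]_x ((f_ n x)%:E * (g x)%:E) @[n --> \oo])).
  by apply: congr_lim; apply/funext => n /=; exact: integral_density_nnsfun.
rewrite -monotone_convergence//=.
- apply: eq_integral => x /[!inE] xD; apply/cvg_lim => //=.
  by apply: cvgeZr => //; exact: cvg_nnsfun_approx.
- by move=> n; exact: meg.
- by move=> n x _; rewrite mule_ge0 ?lee_fin.
- move=> x _ ? ? mn; rewrite lee_wpmul2r ?lee_fin//; exact/lefP/nd_nnsfun_approx.
Qed.

End integral_density.

Section normal_moments.
Context (R : realType) (s : R).
Hypothesis s0 : 0 < s.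
Let mu := @lebesgue_measure R.

Let s_neq0 : s != 0. Proof. by rewrite gt_eqF. Qed.

Lemma ge0_integral_normal (f : R -> \bar R) :
  measurable_fun setT f -> (forall x, (0 <= f x)%E) ->
  (\int[normal_prob 0 s]_x f x = \int[mu]_x (f x * (normal_pdf 0 s x)%:E))%E.
Proof.
move=> mf f0; apply: ge0_integral_density => //.
- exact: measurable_normal_pdf.
- by move=> x; exact: normal_pdf_ge0.
Qed.

Lemma normal_pdfN x : normal_pdf 0 s (- x) = normal_pdf 0 s x.
Proof. by rewrite !normal_pdfE// /normal_fun !subr0 sqrrN. Qed.

(** Completing the square: [expR (c * x)] times the centred density is e^(1/2) times the density
    with mean c s^2. The hypothesis on c covers both signs c = 1 / s and c = - 1 / s. *)
Lemma normal_expR (c : R) : c ^+ 2 = s ^- 2 ->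
  (\int[normal_prob 0 s]_x (expR (c * x))%:E = (expR 2^-1)%:E)%E.
Proof.
move=> cs.
have mexp : measurable_fun setT (fun x : R => expR (c * x)).
  by apply: measurableT_comp => //; exact: measurable_funM.
rewrite ge0_integral_normal; last 2 first.
- exact/measurable_EFinP.
- by move=> x; rewrite lee_fin expR_ge0.
transitivity (\int[mu]_x ((expR 2^-1)%:E * (normal_pdf (c * s ^+ 2) s x)%:E))%E.
  apply: eq_integral => x _; rewrite -!EFinM; congr (_%:E).
  rewrite !normal_pdfE// !(mulrCA _ (normal_peak s)); congr (_ * _).
  rewrite /normal_fun -!expRD; congr expR.
  have -> : 2^-1 = c ^+ 2 * s ^+ 2 / 2 :> R by rewrite cs; field.
  by field.
rewrite ge0_integralZl//; last 2 first.
- by apply/measurable_EFinP; exact: measurable_normal_pdf.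
- by move=> x _; rewrite lee_fin normal_pdf_ge0.
by rewrite integral_normal_pdf mule1.
Qed.

(** Lebesgue measure is invariant under reflection and the density is even. Stated for nonnegative
    f, the symmetry is meaningful without any integrability. *)
Lemma normal_symmetric (f : R -> R) : measurable_fun setT f ->
  (forall x, 0 <= f x) ->
  (\int[normal_prob 0 s]_x (f (- x))%:E = \int[normal_prob 0 s]_x (f x)%:E)%E.
Proof.
move=> mf f0.
have mN : measurable_fun setT (-%R : measurableTypeR R -> measurableTypeR R).
  exact: oppr_measurable.
rewrite !ge0_integral_normal//; last 3 first.
- exact/measurable_EFinP.
- apply/measurable_EFinP; apply: (measurableT_comp mf); exact: oppr_measurable.
- by move=> x; rewrite lee_fin.
rewrite [RHS](_ : _ = \int[pushforward mu (-%R : R -> measurableTypeR R)]_x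
   ((f x)%:E * (normal_pdf 0 s x)%:E))%E; last first.
  by apply: eq_measure_integral => A mA _; exact/esym/lebesgue_measureN.
rewrite ge0_integral_pushforward; [|exact: mN|exact: measurableT| |].
- rewrite preimage_setT; apply: eq_integral => x _ /=; by rewrite normal_pdfN.
- under eq_fun do rewrite -EFinM.
  by apply/measurable_EFinP/measurable_funM => //; exact: measurable_normal_pdf.
- by move=> x _; rewrite -EFinM lee_fin mulr_ge0// normal_pdf_ge0.
Qed.

End normal_moments.

Section independence.
Context (disp : measure_display) (Omega : measurableType disp) (R : realType).
Variable P : probability Omega R.

Definition indep_rv (xi eta : Omega -> R) := forall A B : set R,
  measurable A -> measurable B ->
  P (xi @^-1` A `&` eta @^-1` B) = (P (xi @^-1` A) * P (eta @^-1` B))%E.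

Lemma indep_rv_comp (xi eta g h : _) : indep_rv xi eta ->
  measurable_fun setT (g : R -> R) -> measurable_fun setT (h : R -> R) ->
  indep_rv (g \o xi) (h \o eta).
Proof.
move=> ind mg mh A B mA mB; apply: (ind (g @^-1` A) (h @^-1` B)).
  by rewrite -[_ @^-1` _]setTI; exact: mg.
by rewrite -[_ @^-1` _]setTI; exact: mh.
Qed.

Section product.
Variables (xi eta : Omega -> R).
Hypotheses (mxi : measurable_fun setT xi) (meta : measurable_fun setT eta).
Hypothesis ind : indep_rv xi eta.

Let X : {RV P >-> R} := HB.pack xi (isMeasurableFun.Build _ _ _ _ xi mxi).
Let Y : {RV P >-> R} := HB.pack eta (isMeasurableFun.Build _ _ _ _ eta meta).
Let XY : {RV P >-> (R * R)%type} :=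
  HB.pack (fun w => (xi w, eta w))
    (isMeasurableFun.Build _ _ _ _ _ (measurable_fun_pair mxi meta)).

Let lawE : forall A, measurable A ->
  (distribution P X \x distribution P Y)%E A = distribution P XY A.
Proof. by apply: product_measure_unique => A B mA mB; exact: ind. Qed.

Lemma ge0_expectation_indep : (forall w, 0 <= xi w) -> (forall w, 0 <= eta w) ->
  (\int[P]_w (xi w * eta w)%:E =
   (\int[P]_w (xi w)%:E) * (\int[P]_w (eta w)%:E))%E.
Proof.
move=> xi0 eta0.
have mn : measurable_fun setT (fun x : R => `|x|%:E).
  by apply/measurable_EFinP; exact: normr_measurable.
have m2 : measurable_fun setT (fun z : R * R => (`|z.1| * `|z.2|)%:E).
  by apply/measurable_EFinP/measurable_funM; apply: measurableT_comp.
(* The absolute values make the integrand nonnegative on the whole plane, as Tonelli's theorem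
   requires; along (xi, eta) they change nothing. *)
transitivity (\int[distribution P XY]_z (`|z.1| * `|z.2|)%:E)%E.
  rewrite ge0_integral_distribution//=.
  by apply: eq_integral => w _ /=; rewrite !ger0_norm.
rewrite -(eq_measure_integral _ (fun A mA _ => lawE mA)).
rewrite fubini_tonelli1//=.
rewrite /fubini_F /=.
under eq_integral => x _.
  under eq_integral do rewrite EFinM.
  rewrite ge0_integralZl//; over.
rewrite ge0_integralZr//; last exact: integral_ge0.
by rewrite !ge0_integral_distribution//=; congr (_ * _)%E;
  apply: eq_integral => w _ /=; rewrite ger0_norm.
Qed.

End product.


(* The last hypothesis says that eta has mean zero. *)
Lemma expectation_indep_centered (xi eta : Omega -> R) :
  measurable_fun setT xi -> measurable_fun setT eta -> indep_rv xi eta ->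
  P.-integrable setT (EFin \o xi) -> P.-integrable setT (EFin \o eta) ->
  (\int[P]_w (Num.max (eta w) 0)%:E = \int[P]_w (Num.max (- eta w) 0)%:E)%E ->
  P.-integrable setT (fun w => (xi w * eta w)%:E) /\
  (\int[P]_w (xi w * eta w)%:E = 0)%E.
Proof.
move=> mxi meta ind ixi ieta eta0.
pose pos (x : R) := Num.max x 0; pose neg (x : R) := Num.max (- x) 0.
have mpos : measurable_fun setT pos by exact: measurable_maxr.
have mneg : measurable_fun setT neg by apply: measurable_maxr => //; exact: oppr_measurable.
have pos0 x : 0 <= pos x by rewrite /pos le_max lexx orbT.
have neg0 x : 0 <= neg x by rewrite /neg le_max lexx orbT.
have mc (g : R -> R) (z : Omega -> R) : measurable_fun setT g -> measurable_fun setT z ->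
  measurable_fun setT (g \o z) by move=> *; exact: measurableT_comp.
have prodE (g h : R -> R) : measurable_fun setT g -> measurable_fun setT h ->
    (forall x, 0 <= g x) -> (forall x, 0 <= h x) ->
    (\int[P]_w ((g \o xi) w * (h \o eta) w)%:E =
     (\int[P]_w (g (xi w))%:E) * (\int[P]_w (h (eta w))%:E))%E.
  move=> mg mh g0 h0; apply: ge0_expectation_indep.
  - exact: mc.
  - exact: mc.
  - exact: indep_rv_comp.
  - by move=> w; exact: g0.
  - by move=> w; exact: h0.
have fin (g : R -> R) (z : Omega -> R) : measurable_fun setT g -> measurable_fun setT z ->
    P.-integrable setT (EFin \o z) -> (forall x, 0 <= g x <= `|x|) ->
    exists2 c : R, 0 <= c & (\int[P]_w (g (z w))%:E = c%:E)%E.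
  move=> mg mz iz gz.
  have ig : P.-integrable setT (EFin \o (g \o z)).
    apply: (le_integrable _ _ _ iz) => //; first by apply/measurable_EFinP; exact: mc.
    move=> w _ /=; rewrite lee_fin.
    by have /andP[h1 h2] := gz (z w); rewrite ger0_norm.
  have h0 : (0 <= \int[P]_w (g (z w))%:E)%E.
    by apply: integral_ge0 => w _; rewrite lee_fin; have /andP[] := gz (z w).
  exists (fine (\int[P]_w (g (z w))%:E)); first exact: fine_ge0.
  by rewrite fineK//; exact: integrable_fin_num ig.
have posb x : 0 <= pos x <= `|x| by rewrite pos0 /pos ge_max ler_norm normr_ge0.
have negb x : 0 <= neg x <= `|x| by rewrite neg0 /neg ge_max -normrN ler_norm normr_ge0.
have [a a0 Ea] := fin pos xi mpos mxi ixi posb.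
have [b b0 Eb] := fin neg xi mneg mxi ixi negb.
have [c c0 Ec] := fin pos eta mpos meta ieta posb.
have Ec' : (\int[P]_w (neg (eta w))%:E = c%:E)%E by rewrite -eta0.
have intg (g h : R -> R) (x y : R) : measurable_fun setT g -> measurable_fun setT h ->
    (forall x, 0 <= g x) -> (forall x, 0 <= h x) ->
    (\int[P]_w (g (xi w))%:E = x%:E)%E -> (\int[P]_w (h (eta w))%:E = y%:E)%E ->
    P.-integrable setT (EFin \o (fun w => (g \o xi) w * (h \o eta) w)) /\
    (\int[P]_w ((g \o xi) w * (h \o eta) w)%:E = (x * y)%:E)%E.
  move=> mg mh g0 h0 Ex Ey; have E := prodE g h mg mh g0 h0.
  rewrite Ex Ey -EFinM in E; split=> //; apply/integrableP; split.
    by apply/measurable_EFinP/measurable_funM; exact: mc.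
  rewrite (_ : (fun _ => _) = (fun w => ((g \o xi) w * (h \o eta) w)%:E)).
    by rewrite E ltry.
  by apply/funext => w /=; rewrite ger0_norm// mulr_ge0.
(* Both parts of eta have the same mean c, so the four products of parts have means a c, b c, a c
   and b c, which cancel when recombined with signs. *)
have [i1 E1] := intg pos pos _ _ mpos mpos pos0 pos0 Ea Ec.
have [i2 E2] := intg neg neg _ _ mneg mneg neg0 neg0 Eb Ec'.
have [i3 E3] := intg pos neg _ _ mpos mneg pos0 neg0 Ea Ec'.
have [i4 E4] := intg neg pos _ _ mneg mpos neg0 pos0 Eb Ec.
have splitE w : xi w * eta w =
   (pos (xi w) * pos (eta w) + neg (xi w) * neg (eta w)) -
   (pos (xi w) * neg (eta w) + neg (xi w) * pos (eta w)).
  have pn x : x = pos x - neg x.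
    rewrite /pos /neg; case: (ler0P x) => x0.
      by rewrite max_l ?oppr_ge0// opprK add0r.
    by rewrite max_r ?oppr_le0 ?ltW// subr0.
  by rewrite {1}(pn (xi w)) {1}(pn (eta w)); ring.
have iA := integrableD measurableT i1 i2.
have iB := integrableD measurableT i3 i4.
pose fpp w := pos (xi w) * pos (eta w); pose fnn w := neg (xi w) * neg (eta w).
pose fpn w := pos (xi w) * neg (eta w); pose fnp w := neg (xi w) * pos (eta w).
have eqf : (fun w => (xi w * eta w)%:E) = (fun w =>
   (((EFin \o fpp) \+ (EFin \o fnn)) w - ((EFin \o fpn) \+ (EFin \o fnp)) w)%E).
  by apply/funext => w; rewrite splitE.
rewrite eqf; split; first exact: integrableB.
rewrite integralB// integralD// integralD//.
move: E1 E2 E3 E4 => /= -> -> -> ->.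
by rewrite -!EFinD subrr.
Qed.

End independence.

(** * Measurability and Brownian increments *)

Section lipschitz_measurable.
Context d (Om : measurableType d) (R : realType) (I : finType).

(* xi is the restriction along X of its McShane extension, an infimum of cones,
   whose sublevel sets are unions of balls with rational centre and radius. *)
Lemma lipschitz_measurable (X : I -> Om -> R) (xi : Om -> R) (L : R) :
  (forall i, measurable_fun setT (X i)) ->
  (forall w w', `|xi w - xi w'| <= L * \sum_i `|X i w - X i w'|) ->
  measurable_fun setT xi.
Proof.
move=> mX; wlog L0 : L / 0 <= L.
  move=> H Lip; apply: (H `|L|) => // w w'; apply: le_trans (Lip w w') _.
  by rewrite ler_wpM2r ?sumr_ge0// ler_norm.
move=> Lip; apply: (measurability _ (RGenInftyO.measurableE R)).
move=> _ [_ [a ->] <-]; rewrite setTI.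
pose ball (q : {ffun I -> rat}) (r : rat) : set Om :=
  [set w | \sum_i `|X i w - ratr (q i)| < ratr r].
(* On such a ball the cone with apex w0 lies below a: by the triangle inequality the distance from w
   to w0 is less than the quantity multiplied by L. *)
pose good (q : {ffun I -> rat}) (r : rat) := exists w0,
  xi w0 + L * (\sum_i `|ratr (q i) - X i w0| + ratr r) < a.
have mball q r : measurable (ball q r).
  rewrite (_ : ball q r = (fun w => \sum_i `|X i w - ratr (q i)|) @^-1` `]-oo, ratr r[).
    rewrite -[_ @^-1` _]setTI.
    apply: measurable_sum => // i.
    apply: measurableT_comp; first exact: normr_measurable.
    exact: measurable_funB.
  by apply/seteqP; split => w /=; rewrite in_itv.
have -> : xi @^-1` `]-oo, a[ =
    \bigcup_(n in [set: nat]) (if unpickle n is Some (q, r) then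
       if `[< good q r >] then ball q r else set0 else set0).
  apply/seteqP; split => [w /=|w [n _]].
    rewrite in_itv /= => xia.
    (* A radius r with r K < a - xi w makes the ball good with apex w0 = w, since both distances in
       the cone are at most r. The summand 1 keeps K positive when L = 0. *)
    pose K := L * 2 + 1.
    have c0 : 0 <= #|I|%:R :> R by [].
    have K0 : 0 < K by rewrite /K ltr_wpDl// mulr_ge0.
    have e0 : 0 < (a - xi w) / K by rewrite divr_gt0// subr_gt0.
    have [r] := rat_in_itvoo e0; rewrite in_itv /= => /andP[r0 re].
    (* A rational centre this close in each of the #|I| coordinates has total distance below r; the
       added 1 makes the inequality strict and covers empty I. *)
    pose eps := ratr r / (#|I|%:R + 1) : R.
    have eps0 : 0 < eps by rewrite divr_gt0// ltr_wpDl.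
    have qex i : exists q : rat, `|X i w - ratr q| < eps.
      have [q] := rat_in_itvoo (ltr_pwDr eps0 (lexx (X i w))).
      rewrite in_itv /= => /andP[q1 q2]; exists q.
      rewrite ltr_norml; apply/andP; split; lra.
    pose q := [ffun i => xchoose (qex i)].
    have qP i : `|X i w - ratr (q i)| < eps.
      by rewrite ffunE; exact: (xchooseP (qex i)).
    have Sq : \sum_i `|X i w - ratr (q i)| < ratr r.
      apply: (@le_lt_trans _ _ (\sum_(i : I) eps)); first by apply: ler_sum => i _; exact/ltW.
      rewrite sumr_const -[_ *+ _]mulr_natr /eps -mulrA gtr_pMr// mulrC.
      by rewrite ltr_pdivrMr ?ltr_wpDl// mul1r ltrDl.
    exists (pickle (q, r)) => //; rewrite pickleK.
    case: asboolP => // -[]; exists w.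
    have -> : \sum_i `|ratr (q i) - X i w| = \sum_i `|X i w - ratr (q i)|.
      by apply: eq_bigr => i _; rewrite distrC.
    have : ratr r * K < a - xi w by rewrite -ltr_pdivlMr.
    have : L * (\sum_i `|X i w - ratr (q i)| + ratr r) <= L * (ratr r + ratr r).
      by rewrite ler_wpM2l// lerD2r ltW.
    rewrite /K; lra.
  case: (unpickle n) => // -[q r]; case: asboolP => // -[w0 gw0] /= Bw.
  rewrite in_itv /=; apply: le_lt_trans gw0.
  have := le_trans (ler_norm _) (Lip w w0).
  rewrite lerBlDl => /le_trans; apply; rewrite lerD2l ler_wpM2l//.
  apply: (@le_trans _ _ (\sum_i (`|X i w - ratr (q i)| + `|ratr (q i) - X i w0|))).
    by apply: ler_sum => i _; exact: ler_distD.
  by rewrite big_split /= addrC lerD2l ltW.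
apply: bigcup_measurable => n _; case: (unpickle n) => // -[q r].
by case: ifP.
Qed.

End lipschitz_measurable.

Section sub_sigma_algebra.
Context (disp : measure_display) (Omega : measurableType disp) (R : realType).

(** Changing the sigma-algebra of the source type, rather than speaking of preimages, makes the
    general results on sums, products and compositions apply to G-measurability as they are. *)
Definition measurable_wrt (G : set (set Omega)) (xi : Omega -> R) : Prop :=
  measurable_fun setT (xi : g_sigma_algebraType G -> R).

Lemma measurable_wrtP (G : set (set Omega)) (xi : Omega -> R) :
  sigma_algebra setT G ->
  measurable_wrt G xi <-> (forall B, measurable B -> G (xi @^-1` B)).
Proof.
move=> sG; split => [m B mB|m _ B mB].
  have := m measurableT B mB; rewrite setTI.
  by rewrite /measurable/= sigma_algebra_id.
by rewrite setTI; apply: sub_sigma_algebra; exact: m.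
Qed.

Lemma measurable_wrtS (G G' : set (set Omega)) (xi : Omega -> R) : G `<=` G' ->
  measurable_wrt G xi -> measurable_wrt G' xi.
Proof.
move=> GG' m mT B mB; have := m measurableT B mB.
exact: sub_sigma_algebra2.
Qed.

Lemma measurable_wrt_fun (G : set (set Omega)) (xi : Omega -> R) :
  G `<=` measurable -> measurable_wrt G xi -> measurable_fun setT xi.
Proof.
move=> Gm m mT B mB; have := m measurableT B mB.
by apply: smallest_sub => //; exact: sigma_algebra_measurable.
Qed.

End sub_sigma_algebra.

Section gaussian.
Context (disp : measure_display) (Omega : measurableType disp) (R : realType).
Variables (P : probability Omega R) (X : Omega -> R) (s : R).
Hypotheses (s0 : 0 < s) (mX : measurable_fun setT X).
Hypothesis lawX : forall B : set R, measurable B ->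
  P (X @^-1` B) = normal_prob 0 s B.

Lemma ge0_expectation_gaussian (g : R -> R) : measurable_fun setT g ->
  (forall x, 0 <= g x) ->
  (\int[P]_w (g (X w))%:E = \int[normal_prob 0 s]_x (g x)%:E)%E.
Proof.
move=> mg g0.
have mX' : measurable_fun setT (X : Omega -> measurableTypeR R) by exact: mX.
pose Z : {RV P >-> measurableTypeR R} :=
  HB.pack (X : Omega -> measurableTypeR R) (isMeasurableFun.Build _ _ _ _ _ mX').
transitivity (\int[distribution P Z]_x (g x)%:E)%E.
  rewrite ge0_integral_distribution//; first exact/measurable_EFinP.
apply: eq_measure_integral => A mA _; exact: lawX.
Qed.

Lemma gaussian_expR :
  (\int[P]_w (expR (X w / s) + expR (- (X w / s)))%:E = (2 * expR 2^-1)%:E)%E.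
Proof.
have mexp (c : R) : measurable_fun setT (fun x : R => expR (c * x)).
  by apply: measurableT_comp => //; exact: measurable_funM.
rewrite (eq_integral (fun w => (expR (s^-1 * X w))%:E + (expR (- s^-1 * X w))%:E)%E).
  have mE c : measurable_fun setT (fun w => (expR (c * X w))%:E).
    by apply/measurable_EFinP; exact: (measurableT_comp (mexp _) mX).
  have E0 c w : setT w -> (0 <= (expR (c * X w))%:E)%E by rewrite lee_fin expR_ge0.
  rewrite (ge0_integralD P measurableT (E0 s^-1) (mE s^-1) (E0 (- s^-1)) (mE (- s^-1))).
  rewrite (ge0_expectation_gaussian (mexp _)) ?(ge0_expectation_gaussian (mexp _));
    last 2 first.
  - by move=> x; exact: expR_ge0.
  - by move=> x; exact: expR_ge0.
  rewrite !normal_expR// ?sqrrN ?exprVn//.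
  by rewrite -EFinD -mulr2n mulr_natl.
by move=> w _; rewrite -EFinD mulNr mulrC.
Qed.

(** |x| <= e^x + e^(-x), applied to the normalised variable X / s. *)
Lemma gaussian_integrable : P.-integrable setT (EFin \o X).
Proof.
apply/integrableP; split; first exact/measurable_EFinP.
have mh : measurable_fun setT (fun w => (expR (X w / s) + expR (- (X w / s)))%:E).
  have mXs : measurable_fun setT (fun w => X w / s) by exact: measurable_funM.
  apply/measurable_EFinP/measurable_funD; apply: measurableT_comp => //.
  by apply: measurableT_comp => //; exact: oppr_measurable.
have h0 w : setT w -> (0 <= (expR (X w / s) + expR (- (X w / s)))%:E)%E.
  by rewrite lee_fin addr_ge0 ?expR_ge0.
apply: (@le_lt_trans _ _ (\int[P]_w (s%:E * (expR (X w / s) + expR (- (X w / s)))%:E))%E).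
  apply: ge0_le_integral => //.
  - by apply: measurableT_comp => //; exact/measurable_EFinP.
  - under eq_fun do rewrite -EFinM.
    by apply/measurable_EFinP/measurable_funM => //; exact/measurable_EFinP.
  - move=> w _; rewrite -EFinM lee_fin.
    have -> : `|X w| = s * `|X w / s|.
      by rewrite -{1}(gtr0_norm s0) -normrM mulrCA divff ?mulr1// gt_eqF.
    rewrite (ler_wpM2l (ltW s0))//.
    have h (x : R) : `|x| <= expR x + expR (- x).
      have [x0|x0] := ger0P x.
        by have := expR_ge1Dx x; have := expR_ge0 (- x); lra.
      by have := expR_ge1Dx (- x); have := expR_ge0 x; lra.
    exact: h.
rewrite (ge0_integralZl P measurableT mh h0) ?lee_fin ?ltW//.
by rewrite gaussian_expR -EFinM ltry.
Qed.

Lemma gaussian_centered :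
  (\int[P]_w (Num.max (X w) 0)%:E = \int[P]_w (Num.max (- X w) 0)%:E)%E.
Proof.
have mpos : measurable_fun setT (fun x : R => Num.max x 0) by exact: measurable_maxr.
have mneg : measurable_fun setT (fun x : R => Num.max (- x) 0).
  by apply: measurable_maxr => //; exact: oppr_measurable.
rewrite (ge0_expectation_gaussian mpos); last by move=> x; rewrite le_max lexx orbT.
rewrite (ge0_expectation_gaussian mneg); last by move=> x; rewrite le_max lexx orbT.
rewrite -(normal_symmetric s0 mpos)//.
by move=> x; rewrite le_max lexx orbT.
Qed.

End gaussian.

Section brownian.
Context (disp : measure_display) (Omega : measurableType disp) (R : realType).
Variables (P : probability Omega R) (F : R -> set (set Omega)).
Hypothesis hF : complete_filtration P F.
Variables (l : nat) (W : R -> Omega -> 'cV[R]_l).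
Hypothesis hW : brownian_motion P F W.

Lemma brownian_entry_measurable_wrt s t k : 0 <= s -> s <= t ->
  measurable_wrt (F t) (fun w => W s w k 0).
Proof.
move=> s0 st; apply/measurable_wrtP; first exact: (cf_sigma hF (le_trans s0 st)).
move=> B mB; apply: (cf_mono hF s0 st); apply: (bm_adapted hW s0).
exists ((fun x : borel R l => (x : 'cV[R]_l) k 0) @^-1` B) => //.
by rewrite -[_ @^-1` _]setTI; exact: measurable_entry.
Qed.

Lemma measurable_brownian_entry s k : 0 <= s ->
  measurable_fun setT (fun w => W s w k 0).
Proof.
move=> s0; apply: (@measurable_wrt_fun _ _ _ (F s)); first exact: (cf_sub hF s0).
exact: brownian_entry_measurable_wrt.
Qed.

Lemma brownian_indep_rv s t (xi : Omega -> R) (g : borel R l -> R) :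
  0 <= s -> s < t -> measurable_wrt (F s) xi -> measurable_fun setT g ->
  indep_rv P xi (fun w => g (W t w - W s w)).
Proof.
move=> s0 st mxi mg A B mA mB; apply: (bm_indep hW s0 st).
  by move/measurable_wrtP: mxi; apply => //; exact: (cf_sigma hF s0).
exists (g @^-1` B) => //.
by rewrite -[_ @^-1` _]setTI; exact: mg.
Qed.

Lemma brownian_incr_expR s t k : 0 <= s -> s < t ->
  (\int[P]_w (expR ((W t w - W s w) k 0 / Num.sqrt (t - s)) +
     expR (- ((W t w - W s w) k 0 / Num.sqrt (t - s))))%:E = (2 * expR 2^-1)%:E)%E.
Proof.
move=> s0 st; apply: gaussian_expR.
- by rewrite sqrtr_gt0 subr_gt0.
- under eq_fun do rewrite !mxE.
  apply: measurable_funB; apply: measurable_brownian_entry => //.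
  exact: ltW (le_lt_trans s0 st).
- by move=> B mB; exact: (bm_coord_law hW s0 st k mB).
Qed.

Lemma brownian_incr_centered s t k (xi : Omega -> R) : 0 <= s -> s < t ->
  measurable_wrt (F s) xi -> P.-integrable setT (EFin \o xi) ->
  P.-integrable setT (fun w => (xi w * (W t w - W s w) k 0)%:E) /\
  (\int[P]_w (xi w * (W t w - W s w) k 0)%:E = 0)%E.
Proof.
move=> s0 st mxi ixi.
have t0 := ltW (le_lt_trans s0 st).
have mX : measurable_fun setT (fun w => (W t w - W s w) k 0).
  under eq_fun do rewrite !mxE.
  by apply: measurable_funB; apply: measurable_brownian_entry.
have d0 : 0 < Num.sqrt (t - s) by rewrite sqrtr_gt0 subr_gt0.
have law := fun B (mB : measurable B) => bm_coord_law hW s0 st k mB.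
apply: expectation_indep_centered => //.
- by apply: (@measurable_wrt_fun _ _ _ (F s)) mxi; exact: (cf_sub hF s0).
- exact: (brownian_indep_rv s0 st mxi (@measurable_entry R l 1 k 0)).
- exact: (gaussian_integrable d0 mX law).
- exact: (gaussian_centered d0 mX law).
Qed.

End brownian.

Lemma enorm_sqr (R : realType) m n (A : 'M[R]_(m, n)) :
  enorm A ^+ 2 = \sum_i \sum_j A i j ^+ 2.
Proof.
by rewrite sqr_sqrtr// sumr_ge0// => i _; rewrite sumr_ge0// => j _; rewrite sqr_ge0.
Qed.

Lemma enorm_ge0 (R : realType) m n (A : 'M[R]_(m, n)) : 0 <= enorm A.
Proof. exact: sqrtr_ge0. Qed.

Section brownian_moment.
Context (disp : measure_display) (Omega : measurableType disp) (R : realType).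
Variables (P : probability Omega R) (F : R -> set (set Omega)).
Hypothesis hF : complete_filtration P F.

(** The two powers are those of the second order remainder. The higher moment is of order (t - s)^p,
    which is at most t - s because the increment is over a time at most 1. *)
Lemma brownian_incr_moment (l : nat) (p : R) : 1 <= p ->
  exists2 C : R, 0 <= C & forall W : R -> Omega -> 'cV[R]_l,
    brownian_motion P F W -> forall s t, 0 <= s -> s <= t <= s + 1 ->
    (\int[P]_w (enorm (W t w - W s w) ^+ 2 + (enorm (W t w - W s w) ^+ 2) `^ p)%:E
      <= (C * (t - s))%:E)%E.
Proof.
move=> p1; have p0 : 0 < p by exact: lt_le_trans p1.
have [C1 C10 H1] := @powR_le_expR R 1 (lexx 1).
have [Cp Cp0 Hp] := powR_le_expR p1.
pose D := C1 + l%:R `^ p * Cp.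
have D0 : 0 <= D by rewrite addr_ge0 ?mulr_ge0 ?powR_ge0 ?ltW.
exists (D * (l%:R * (2 * expR 2^-1))).
  by rewrite !mulr_ge0// expR_ge0.
move=> W hW s t s0 /andP[st ts1].
move: st; rewrite le_eqVlt => /predU1P[<-|st].
  rewrite subrr mulr0 integral0_eq// => w _.
  rewrite subrr; have -> : enorm (0 : 'cV[R]_l) ^+ 2 = 0.
    by rewrite enorm_sqr big1// => i _; rewrite big1// => j _; rewrite mxE expr0n.
  by rewrite powR0 ?gt_eqF// addr0.
set h := t - s; have h0 : 0 < h by rewrite subr_gt0.
have h1 : h <= 1 by rewrite lerBlDl.
set dl := Num.sqrt h; have dl0 : 0 < dl by rewrite sqrtr_gt0.
have dl2 : dl ^+ 2 = h by rewrite sqr_sqrtr// ltW.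
pose E k w := expR ((W t w - W s w) k 0 / dl) + expR (- ((W t w - W s w) k 0 / dl)).
have t0 := ltW (le_lt_trans s0 st).
have mW k : measurable_fun setT (fun w => (W t w - W s w) k 0).
  under eq_fun do rewrite !mxE.
  by apply: measurable_funB; apply: (measurable_brownian_entry hF hW).
have mE k : measurable_fun setT (fun w => (E k w)%:E).
  have mWd : measurable_fun setT (fun w => (W t w - W s w) k 0 / dl) by exact: measurable_funM.
  apply/measurable_EFinP/measurable_funD; apply: measurableT_comp => //.
  by apply: measurableT_comp => //; exact: oppr_measurable.
have E0 k w : 0 <= E k w by rewrite addr_ge0 ?expR_ge0.
have pw w : enorm (W t w - W s w) ^+ 2 + (enorm (W t w - W s w) ^+ 2) `^ p
    <= (h * D) * \sum_k E k w.
  have sq k : (W t w - W s w) k 0 ^+ 2 = h * (((W t w - W s w) k 0 / dl) ^+ 2).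
    by rewrite expr_div_n dl2 mulrCA divff ?mulr1// gt_eqF.
  have -> : enorm (W t w - W s w) ^+ 2 = \sum_k (W t w - W s w) k 0 ^+ 2.
    by rewrite enorm_sqr; apply: eq_bigr => i _; rewrite big_ord1.
  rewrite /D mulrDr mulrDl lerD//.
    rewrite mulr_sumr; apply: ler_sum => k _; rewrite sq -mulrA ler_wpM2l ?(ltW h0)//.
    by have := H1 ((W t w - W s w) k 0 / dl); rewrite powRr1 ?sqr_ge0.
  apply: le_trans (powR_sum_le p1 _) _; first by move=> i; exact: sqr_ge0.
  rewrite [leRHS](_ : _ = l%:R `^ p * \sum_k (h * (Cp * E k w))); last first.
    by rewrite -!mulr_sumr; ring.
  rewrite ler_wpM2l ?powR_ge0//; apply: ler_sum => k _; rewrite sq powRM ?sqr_ge0 ?(ltW h0)//.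
  apply: ler_pM; rewrite ?powR_ge0//.
  by apply: ge1r_powR => //; rewrite h0.
apply: (@le_trans _ _ (\int[P]_w ((h * D)%:E * (\sum_k (E k w)%:E)))%E).
  apply: ge0_le_integral => //.
  - by move=> w _; rewrite lee_fin addr_ge0 ?sqr_ge0 ?powR_ge0.
  - have me : measurable_fun setT (fun w => enorm (W t w - W s w) ^+ 2).
      under eq_fun => w do rewrite enorm_sqr.
      apply: measurable_sum => i; apply: measurable_sum => j; apply: measurable_funX.
      by rewrite (ord1 j).
    apply/measurable_EFinP/measurable_funD => //.
    by apply: (measurableT_comp (measurable_powR p) me).
  - apply: emeasurable_funM => //; exact: emeasurable_sum.
  - by move=> w _; rewrite sumEFin -EFinM lee_fin.
rewrite ge0_integralZl//; last 3 first.
- exact: emeasurable_sum.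
- by move=> w _; rewrite sume_ge0// => k _; rewrite lee_fin.
- by rewrite lee_fin mulr_ge0// ltW.
rewrite ge0_integral_sum//; last by move=> k w _; rewrite lee_fin.
under eq_bigr do rewrite (brownian_incr_expR hF hW)//.
rewrite sumEFin sumr_const card_ord -EFinM lee_fin -[_ *+ l]mulr_natl.
by rewrite le_eqVlt; apply/orP; left; apply/eqP; ring.
Qed.

End brownian_moment.

(** * Euclidean norms and empirical measures *)

Section euclidean.
Context (R : realType).

(** Lagrange's identity: the double sum of the squares (a_i b_j - a_j b_i)^2 is twice the difference
    of the two sides. *)
Lemma sum_cauchy_schwarz (I : finType) (a b : I -> R) :
  (\sum_i a i * b i) ^+ 2 <= (\sum_i a i ^+ 2) * (\sum_i b i ^+ 2).
Proof.
have : 0 <= \sum_i \sum_j (a i * b j - a j * b i) ^+ 2.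
  by apply: sumr_ge0 => i _; apply: sumr_ge0 => j _; exact: sqr_ge0.
have -> : \sum_i \sum_j (a i * b j - a j * b i) ^+ 2 =
    \sum_i \sum_j (a i ^+ 2 * b j ^+ 2) + \sum_i \sum_j (b i ^+ 2 * a j ^+ 2)
    - (\sum_i \sum_j (a i * b i) * (a j * b j)) *+ 2.
  rewrite -sumrMnl -big_split -sumrB /=; apply: eq_bigr => i _.
  rewrite -sumrMnl -big_split -sumrB /=; apply: eq_bigr => j _; ring.
have prodE (x y : I -> R) : \sum_i \sum_j x i * y j = (\sum_i x i) * (\sum_j y j).
  by rewrite mulr_suml; apply: eq_bigr => i _; rewrite mulr_sumr.
rewrite (prodE (fun i => a i ^+ 2) (fun i => b i ^+ 2)).
rewrite (prodE (fun i => b i ^+ 2) (fun i => a i ^+ 2)).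
rewrite (prodE (fun i => a i * b i) (fun i => a i * b i)) expr2; lra.
Qed.

Lemma sum_sqr_le (I : finType) (a : I -> R) :
  \sum_i a i ^+ 2 <= (\sum_i `|a i|) ^+ 2.
Proof.
rewrite expr2 mulr_suml; apply: ler_sum => i _.
rewrite -real_normK ?num_real// expr2 ler_wpM2l//.
by rewrite (bigD1 i)//= lerDl sumr_ge0.
Qed.

Section matrix.
Context (m n : nat).
Implicit Types A B : 'M[R]_(m, n).

Lemma enorm_sqr_pair A : enorm A ^+ 2 = \sum_(q : 'I_m * 'I_n) A q.1 q.2 ^+ 2.
Proof. by rewrite enorm_sqr pair_bigA. Qed.

Lemma enorm_entry A i j : `|A i j| <= enorm A.
Proof.
rewrite -ler_sqr ?nnegrE ?enorm_ge0// real_normK ?num_real// enorm_sqr_pair.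
by rewrite (bigD1 (i, j))//= lerDl sumr_ge0// => q _; exact: sqr_ge0.
Qed.

Lemma enorm0 : enorm (0 : 'M[R]_(m, n)) = 0.
Proof.
apply/eqP; rewrite -sqrf_eq0 enorm_sqr_pair big1// => q _.
by rewrite mxE expr0n.
Qed.

Lemma enormN A : enorm (- A) = enorm A.
Proof.
congr Num.sqrt; apply: eq_bigr => i _; apply: eq_bigr => j _.
by rewrite mxE sqrrN.
Qed.

Lemma enorm_sqrZ (c : R) A : enorm (c *: A) ^+ 2 = c ^+ 2 * enorm A ^+ 2.
Proof.
rewrite !enorm_sqr_pair mulr_sumr; apply: eq_bigr => q _.
by rewrite mxE exprMn.
Qed.

(** The weight is chosen so that A keeps the factor 1 + h. The large factor 1 + 1/h falls on B,
    which will itself carry a factor h, and (1 + 1/h) h^2 = h + h^2 is again O(h). *)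
Lemma enorm_sqrD_le A B (h : R) : 0 < h ->
  enorm (A + B) ^+ 2 <= (1 + h) * enorm A ^+ 2 + (1 + h^-1) * enorm B ^+ 2.
Proof.
move=> h0; rewrite !enorm_sqr_pair !mulr_sumr -big_split /=.
apply: ler_sum => q _; rewrite mxE; set a := A _ _; set b := B _ _.
have hh : h * h^-1 = 1 by rewrite divff// gt_eqF.
have : 0 <= h^-1 * (h * a - b) ^+ 2 by rewrite mulr_ge0 ?sqr_ge0// invr_ge0 ltW.
have -> : h^-1 * (h * a - b) ^+ 2 =
  (h * h^-1) * h * a ^+ 2 - (h * h^-1) * (a * b) *+ 2 + h^-1 * b ^+ 2 by ring.
rewrite hh; lra.
Qed.

Lemma enorm_sqrD A B : enorm (A + B) ^+ 2 <= 2 * enorm A ^+ 2 + 2 * enorm B ^+ 2.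
Proof. by have := enorm_sqrD_le A B ltr01; rewrite invr1. Qed.

Lemma enorm_sqrB A B : enorm (A - B) ^+ 2 <= 2 * enorm A ^+ 2 + 2 * enorm B ^+ 2.
Proof. by have := enorm_sqrD A (- B); rewrite enormN. Qed.

End matrix.

Lemma enorm_sqr_col d (x : 'cV[R]_d) : enorm x ^+ 2 = \sum_k x k 0 ^+ 2.
Proof. by rewrite enorm_sqr; apply: eq_bigr => k _; rewrite big_ord1. Qed.

Lemma enorm_sqrM_le d l (A : 'M[R]_(d, l)) (x : 'cV[R]_l) :
  enorm (A *m x) ^+ 2 <= enorm A ^+ 2 * enorm x ^+ 2.
Proof.
rewrite enorm_sqr_col enorm_sqr mulr_suml; apply: ler_sum => k _.
rewrite mxE enorm_sqr_col; exact: (sum_cauchy_schwarz (fun j => A k j) (fun j => x j 0)).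
Qed.

Section inner.
Context (d : nat).
Implicit Types x y z : 'cV[R]_d.

Lemma inner_enorm x : inner x x = enorm x ^+ 2.
Proof. by rewrite enorm_sqr_col; apply: eq_bigr => i _; rewrite expr2. Qed.

Lemma innerDr x y z : inner x (y + z) = inner x y + inner x z.
Proof. by rewrite -big_split; apply: eq_bigr => i _; rewrite mxE mulrDr. Qed.

Lemma innerNr x y : inner x (- y) = - inner x y.
Proof. by rewrite -sumrN; apply: eq_bigr => i _; rewrite mxE mulrN. Qed.

Lemma innerZr (c : R) x y : inner x (c *: y) = c * inner x y.
Proof. by rewrite mulr_sumr; apply: eq_bigr => i _; rewrite mxE mulrCA. Qed.

Lemma innerC x y : inner x y = inner y x.
Proof. by apply: eq_bigr => i _; rewrite mulrC. Qed.

Lemma innerBr x y z : inner x (y - z) = inner x y - inner x z.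
Proof. by rewrite innerDr innerNr. Qed.

Lemma innerDl x y z : inner (x + y) z = inner x z + inner y z.
Proof. by rewrite innerC innerDr ![inner z _]innerC. Qed.

Lemma innerBl x y z : inner (x - y) z = inner x z - inner y z.
Proof. by rewrite innerC innerBr ![inner z _]innerC. Qed.

Lemma inner_sumr (I : Type) (s : seq I) (F : I -> 'cV[R]_d) x :
  inner x (\sum_(i <- s) F i) = \sum_(i <- s) inner x (F i).
Proof.
elim/big_rec2: _ => [|i a b _ <-]; last by rewrite innerDr.
by rewrite /inner big1// => i _; rewrite mxE mulr0.
Qed.

Lemma enorm_sqr_addE x y :
  enorm (x + y) ^+ 2 = enorm x ^+ 2 + inner x y *+ 2 + enorm y ^+ 2.
Proof. by rewrite -!inner_enorm innerDr !innerDl (innerC y x); ring. Qed.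

Lemma enorm_sqr_subE x y :
  enorm (x - y) ^+ 2 = enorm x ^+ 2 - inner x y *+ 2 + enorm y ^+ 2.
Proof. by rewrite enorm_sqr_addE innerNr enormN mulNrn. Qed.

Lemma inner_sqr_le x y : inner x y ^+ 2 <= enorm x ^+ 2 * enorm y ^+ 2.
Proof. rewrite !enorm_sqr_col; exact: sum_cauchy_schwarz. Qed.

Lemma inner_le x y : inner x y <= (enorm x ^+ 2 + enorm y ^+ 2) / 2.
Proof.
have := sqr_ge0 (enorm (x - y)); rewrite enorm_sqr_subE; lra.
Qed.

End inner.

End euclidean.

Section averages.
Context (R : realType) (d N : nat).
Implicit Types z g : nat -> 'cV[R]_d.

Definition msq z : R := N%:R^-1 * \sum_(k < N) enorm (z k) ^+ 2.

(* Both summands are controlled pathwise by the implicit step, and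
   |z i|^2 <= 2 lyap z i; |z i|^2 alone is not. *)
Definition lyap z (i : nat) : R :=
  N%:R^-1 * \sum_(k < N) (enorm (z i - z k) ^+ 2 + enorm (z k) ^+ 2).

(** The symmetric bilinear form that polarises the quadratic form [lyap]. *)
Definition lyap_polar z g (i : nat) : R :=
  N%:R^-1 * \sum_(k < N) (inner (z i - z k) (g i - g k) + inner (z k) (g k)).

Let N_ge0 : 0 <= N%:R^-1 :> R. Proof. by rewrite invr_ge0. Qed.

Lemma msq_ge0 z : 0 <= msq z.
Proof. by rewrite mulr_ge0// sumr_ge0// => k _; exact: sqr_ge0. Qed.

Lemma lyapE z i :
  lyap z i = N%:R^-1 * \sum_(k < N) enorm (z i - z k) ^+ 2 + msq z.
Proof. by rewrite /lyap big_split mulrDr. Qed.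

Lemma spread_ge0 z i : 0 <= N%:R^-1 * \sum_(k < N) enorm (z i - z k) ^+ 2.
Proof. by rewrite mulr_ge0// sumr_ge0// => k _; exact: sqr_ge0. Qed.

Lemma lyap_ge0 z i : 0 <= lyap z i.
Proof. by rewrite lyapE addr_ge0 ?msq_ge0 ?spread_ge0. Qed.

Lemma msq_le_lyap z i : msq z <= lyap z i.
Proof. by rewrite lyapE lerDr spread_ge0. Qed.

Lemma lyapD z g i :
  lyap (fun k => z k + g k) i = lyap z i + lyap_polar z g i *+ 2 + lyap g i.
Proof.
rewrite /lyap /lyap_polar -mulrnAr -!mulrDr -sumrMnl -!big_split/=.
congr (_ * _); apply: eq_bigr => k _.
rewrite opprD addrACA !enorm_sqr_addE; ring.
Qed.

Lemma lyap_polar_sqr_le z g i : lyap_polar z g i ^+ 2 <= lyap z i * lyap g i.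
Proof.
rewrite /lyap /lyap_polar exprMn [leRHS]mulrACA -expr2 ler_wpM2l ?sqr_ge0//.
(* The coordinates of a vector of dimension 2 N d whose squared norm is N times [lyap x i];
   Cauchy-Schwarz is applied to these vectors. *)
pose a (x : nat -> 'cV[R]_d) (q : 'I_N * 'I_d + 'I_N * 'I_d) : R := match q with
  | inl (k, j) => (x i - x (k : nat)) j 0 | inr (k, j) => x (k : nat) j 0 end.
have E (x y : nat -> 'cV[R]_d) : \sum_(k < N) (inner (x i - x k) (y i - y k) +
    inner (x k) (y k)) = \sum_q a x q * a y q.
  rewrite big_sumType big_split /=; congr (_ + _).
    by rewrite pair_bigA; apply: eq_bigr => -[k j] _.
  by rewrite pair_bigA; apply: eq_bigr => -[k j] _.
have E2 (x : nat -> 'cV[R]_d) : \sum_(k < N) (enorm (x i - x k) ^+ 2 +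
    enorm (x k) ^+ 2) = \sum_q a x q ^+ 2.
  by under eq_bigr do rewrite -!inner_enorm; rewrite E; apply: eq_bigr => q _; rewrite expr2.
by rewrite E !E2; exact: sum_cauchy_schwarz.
Qed.

Hypothesis N_gt0 : (0 < N)%N.

Lemma avg_cst (c : R) : N%:R^-1 * \sum_(k < N) c = c.
Proof.
by rewrite sumr_const card_ord -[c *+ N]mulr_natl mulrA mulVf ?mul1r// pnatr_eq0 -lt0n.
Qed.

Lemma lyap_le z i : lyap z i <= 2 * enorm (z i) ^+ 2 + 3 * msq z.
Proof.
rewrite /lyap -{1}(avg_cst (2 * enorm (z i) ^+ 2)) /msq [3 * _]mulrCA -mulrDr ler_wpM2l//.
rewrite mulr_sumr -big_split; apply: ler_sum => k _ /=.
have := enorm_sqrB (z i) (z k); lra.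
Qed.

Lemma enorm_le_lyap z i : enorm (z i) ^+ 2 <= 2 * lyap z i.
Proof.
rewrite -{1}(avg_cst (enorm (z i) ^+ 2)) /lyap mulrCA ler_wpM2l//.
rewrite mulr_sumr; apply: ler_sum => k _.
have := enorm_sqrD (z i - z k) (z k); rewrite subrK; lra.
Qed.

(** The two sides differ by twice |sum_i z_i|^2. *)
Lemma sum_pair_spread z :
  \sum_(i < N) \sum_(j < N) enorm (z i - z j) ^+ 2
    <= 2 * N%:R * \sum_(i < N) enorm (z i) ^+ 2.
Proof.
have -> : \sum_(i < N) \sum_(j < N) enorm (z i - z j) ^+ 2 =
   2 * N%:R * \sum_(i < N) enorm (z i) ^+ 2 - 2 * enorm (\sum_(i < N) z i) ^+ 2.
  have -> : enorm (\sum_(i < N) z i) ^+ 2 = \sum_(i < N) \sum_(j < N) inner (z i) (z j).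
    rewrite -inner_enorm inner_sumr; under eq_bigr do rewrite innerC inner_sumr.
    by [].
  have C (c : R) : N%:R * c = \sum_(j < N) c.
    by rewrite sumr_const card_ord mulr_natl.
  have -> : 2 * N%:R * \sum_(i < N) enorm (z i) ^+ 2 =
     \sum_(i < N) \sum_(j < N) enorm (z i) ^+ 2 + \sum_(i < N) \sum_(j < N) enorm (z j) ^+ 2.
    rewrite -C -mulrA mulr_sumr; under [in X in _ = X + _]eq_bigr do rewrite -C.
    by rewrite -mulr_sumr; ring.
  rewrite mulr_sumr -big_split -sumrB /=; apply: eq_bigr => i _.
  rewrite mulr_sumr -big_split -sumrB /=; apply: eq_bigr => j _.
  by rewrite enorm_sqr_subE; ring.
by rewrite lerBlDr lerDl mulr_ge0// sqr_ge0.
Qed.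

End averages.

Section wasserstein_empirical.
Variables (R : realType) (d N : nat) (N_gt0 : (0 < N)%N).
Variables y y' : nat -> 'cV[R]_d.

Let prodT := (borel R d * borel R d)%type.

(** The coupling that matches the atoms of equal index. It need not be optimal: any coupling bounds
    the Wasserstein distance from above. *)
Definition empirical_coupling (_ : (0 < N)%N) : set prodT -> \bar R :=
  mscale (N%:R^-1)%:nng (msum (fun j => @dirac _ prodT (y j, y' j) R) N).

HB.instance Definition _ := Measure.on (empirical_coupling N_gt0).

Let empirical_coupling_setT : empirical_coupling N_gt0 setT = 1%E.
Proof.
rewrite /empirical_coupling /mscale /= /msum.
rewrite (eq_bigr (fun=> 1%:E)); last by move=> j _; exact: diracT.
by rewrite sumEFin sumr_const card_ord -EFinM mulVf// pnatr_eq0 -lt0n.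
Qed.

HB.instance Definition _ :=
  Measure_isProbability.Build _ _ _ (empirical_coupling N_gt0) empirical_coupling_setT.

(** The second measure is given by its values so that the Dirac measure at 0 is covered too: N atoms
    at 0 and a single atom at 0 agree on every measurable set but are built differently. *)
Lemma W2_empirical_le (nu : P2 R d) :
  (forall A : set (borel R d), measurable A -> empirical N_gt0 y' A = nu A) ->
  W2 (empirical N_gt0 y) nu ^+ 2
    <= N%:R^-1 * \sum_(j < N) enorm (y j - y' j) ^+ 2.
Proof.
move=> nuE; rewrite /W2; set S := [set _ | _ in _].
set c := N%:R^-1 * _; have c0 : 0 <= c.
  by rewrite mulr_ge0 ?invr_ge0// sumr_ge0// => j _; exact: sqr_ge0.
have mf : measurable_fun setT (fun z : prodT =>
    (enorm ((z.1 : 'cV[R]_d) - z.2) ^+ 2)%:E).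
  apply/measurable_EFinP; under eq_fun do rewrite enorm_sqr_col.
  apply: measurable_sum => k; apply: measurable_funX; under eq_fun do rewrite !mxE.
  by apply: measurable_funB; apply: (measurableT_comp (@measurable_entry R d 1 k 0)).
have Sc : S c%:E.
  exists (empirical_coupling N_gt0).
    split=> A mA; last rewrite -nuE//;
      rewrite /empirical_coupling/= /empirical_measure /mscale /= /msum;
      congr (_ * _)%E; by apply: eq_bigr => j _; rewrite !diracE.
  rewrite /empirical_coupling ge0_integral_mscale//; last first.
    by move=> z _; rewrite lee_fin sqr_ge0.
  rewrite ge0_integral_measure_sum//; last by move=> z _; rewrite lee_fin sqr_ge0.
  under eq_bigr do rewrite integral_dirac// diracT mul1e.
  by rewrite sumEFin -EFinM.
have lb : (0 <= ereal_inf S)%E.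
  apply: le_ereal_inf_tmp => _ [pi _ <-]; apply: integral_ge0 => z _.
  by rewrite lee_fin sqr_ge0.
have ub : (ereal_inf S <= c%:E)%E by exact: ereal_inf_lbound.
rewrite sqr_sqrtr ?fine_ge0//.
rewrite -lee_fin fineK// ge0_fin_numE//; exact: le_lt_trans ub (ltry _).
Qed.

End wasserstein_empirical.

Lemma W2_empirical (R : realType) d N (hN : (0 < N)%N) (y y' : nat -> 'cV[R]_d) :
  W2 (empirical hN y) (empirical hN y') ^+ 2 <= msq N (fun j => y j - y' j).
Proof. exact: W2_empirical_le. Qed.

Lemma W2_empirical0 (R : realType) d N (hN : (0 < N)%N) (y : nat -> 'cV[R]_d) :
  W2 (empirical hN y) (empirical (ltn0Sn 0) (fun=> 0)) ^+ 2 <= msq N y.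
Proof.
apply: le_trans (@W2_empirical_le R d N hN y (fun=> 0) _ _) _.
  move=> A mA; rewrite /empirical/= /empirical_measure /mscale /= /msum.
  rewrite big_ord1 invr1 mul1e.
  rewrite (eq_bigr (fun=> (\1_A (0 : borel R d))%:E)); last by move=> j _; exact: diracE.
  transitivity ((\1_A (0 : borel R d))%:E : \bar R); last exact/esym/diracE.
  rewrite sumEFin sumr_const card_ord -EFinM; congr (_%:E).
  set c := \1_A _.
  by rewrite -[c *+ N]mulr_natl mulrA mulVf ?mul1r// pnatr_eq0 -lt0n.
by rewrite /msq; under eq_bigr do rewrite subr0.
Qed.

Section empirical_integral.
Variables (R : realType) (d N : nat) (hN : (0 < N)%N) (y : nat -> 'cV[R]_d).

Lemma ge0_integral_empirical (g : borel R d -> R) :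
  measurable_fun setT g -> (forall x, 0 <= g x) ->
  (\int[empirical hN y]_x (g x)%:E = (N%:R^-1 * \sum_(j < N) g (y j))%:E)%E.
Proof.
move=> mg g0; have meg := (measurable_EFinP _ g).2 mg.
change (\int[empirical_measure y hN]_x (g x)%:E = (N%:R^-1 * \sum_(j < N) g (y j))%:E)%E.
rewrite /empirical_measure ge0_integral_mscale//; last by move=> x _; rewrite lee_fin.
rewrite ge0_integral_measure_sum//; last by move=> x _; rewrite lee_fin.
under eq_bigr do rewrite integral_dirac// diracT mul1e.
by rewrite sumEFin -EFinM.
Qed.

Lemma Rintegral_empirical (g : borel R d -> R) : measurable_fun setT g ->
  \int[empirical hN y]_x g x = N%:R^-1 * \sum_(j < N) g (y j).
Proof.
move=> mg; rewrite /Rintegral integralE funerpos funerneg.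
have mp : measurable_fun setT (g^\+) by exact: measurable_funrpos.
have mn : measurable_fun setT (g^\-) by exact: measurable_funrneg.
rewrite (ge0_integral_empirical mp (funrpos_ge0 g)).
rewrite (ge0_integral_empirical mn (funrneg_ge0 g)).
rewrite -EFinB /= -mulrBr -sumrB; congr (_ * _); apply: eq_bigr => j _.
by rewrite -[in RHS](funrposBneg g).
Qed.

End empirical_integral.

Lemma v_coef_empirical (R : realType) d N (hN : (0 < N)%N) (f : 'cV[R]_d -> 'cV[R]_d)
  (u : 'cV[R]_d -> P2 R d -> 'cV[R]_d) (y : nat -> 'cV[R]_d) (x : 'cV[R]_d) :
  measurable_fun setT (f : borel R d -> borel R d) ->
  v_coef f u x (empirical hN y) =
    N%:R^-1 *: (\sum_(j < N) f (x - y j)) + u x (empirical hN y).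
Proof.
move=> mf; rewrite /v_coef; congr (_ + _); apply/matrixP => k j.
rewrite (ord1 j) !mxE (@Rintegral_empirical _ _ _ _ _ (fun z : borel R d => f (x - z) k 0)).
  by rewrite summxE.
apply: (measurableT_comp (@measurable_entry R d 1 k 0)).
apply: (measurableT_comp mf).
apply: (measurability _ (erefl : @measurable _ (borel R d) = <<s @open 'cV[R]_d >>)).
move=> _ [U oU <-]; rewrite setTI; apply: sub_sigma_algebra.
apply: open_comp => // z _.
have cx : (fun=> x) @ nbhs z --> x by exact: cvg_cst.
have cz : id @ nbhs z --> z by exact: cvg_id.
exact: (cvgB cx cz).
Qed.

(** * The implicit step *)

Section implicit_step.
Variables (R : realType) (d : nat).
Variables (f : 'cV[R]_d -> 'cV[R]_d) (u : 'cV[R]_d -> P2 R d -> 'cV[R]_d).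
Variables (Lu Luhat Lutilde q1 Lf Lfhat q2 : R).
Hypotheses (hu : u_cond Lu Luhat Lutilde q1 u) (hf : f_cond Lf Lfhat q2 f).
Variables (N : nat) (hN : (0 < N)%N) (h : R).
Let z := zeta Lf Lu Lutilde.
Hypotheses (h0 : 0 < h) (h1 : h <= 1) (hz : h * z <= 1).

Definition implicit_sol (x y : nat -> 'cV[R]_d) := forall i, (i < N)%N ->
  y i = x i + h *: v_coef f u (y i) (empirical hN y).

Let N0 : 0 <= N%:R^-1 :> R. Proof. by rewrite invr_ge0. Qed.

Let VE y x := v_coef_empirical hN u y x (f_measurable hf).

Let z0 : 0 <= z. Proof. by rewrite /z /zeta le_max lexx orbT. Qed.

Let z_pair : 2 * (Lf + Lu) <= z.
Proof. by rewrite /z /zeta !le_max lexx. Qed.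

(** The parenthesis is the one-sided constant of the full system. [Num.max 0 Lf] comes from the
    interaction, Lu from u in its first argument; the measure argument of u contributes 1/2 and
    Lutilde/2 through Young's inequality. *)
Let z_total : 2 * (Num.max 0 Lf + Lu + (Lutilde + 1) / 2) <= z.
Proof.
have : 4 * Num.max 0 Lf + 2 * Lu + 2 * Lutilde + 1 <= z.
  by rewrite /z /zeta !le_max lexx orbT.
have : 0 <= Num.max 0 Lf by rewrite le_max lexx.
have := u_Lutilde hu; lra.
Qed.

(* 1 <= (1 + 6 x) (1 - x)^2 for 0 <= x <= 1/2, with x = h z / 2. *)
Lemma contraction_le (a b c al : R) : 2 * al <= z -> 0 <= a -> 0 <= b ->
  c ^+ 2 <= a * b -> a <= c + h * (al * a) -> a <= b + h * (3 * z) * b.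
Proof.
move=> alz a0 b0 cab ac.
have [x [x0 x1 xE]] : exists x, [/\ 0 <= x, x <= 2^-1 & h * z = 2 * x].
  exists (h * z / 2); split; [by rewrite divr_ge0// mulr_ge0// ltW| |by field].
  by move: hz; lra.
have xa : h * (al * a) <= x * a.
  by rewrite mulrA ler_wpM2r//; have := ler_wpM2l (ltW h0) alz; lra.
have ca : (1 - x) * a <= c by lra.
have ca0 : 0 <= (1 - x) * a by rewrite mulr_ge0//; lra.
(* The energy inequality (1 - x) a <= c is squared, Cauchy-Schwarz replaces c^2 by a b, and one
   factor a is then divided out. *)
have sq : ((1 - x) * a) ^+ 2 <= a * b.
  apply: le_trans cab; rewrite ler_sqr ?nnegrE//; exact: le_trans ca.
have {}sq : (1 - x) ^+ 2 * a <= b.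
  have [->|a_neq0] := eqVneq a 0; first by rewrite mulr0.
  have a_gt0 : 0 < a by rewrite lt_neqAle eq_sym a_neq0.
  by rewrite -(ler_pM2l a_gt0); apply: le_trans sq; rewrite exprMn expr2; lra.
have -> : b + h * (3 * z) * b = (1 + 6 * x) * b.
  have -> : h * (3 * z) = 3 * (h * z) by ring.
  by rewrite xE; ring.
apply: le_trans (ler_wpM2l _ sq); last by lra.
(* (1 + 6x)(1 - x)^2 - 1 = 6 x (1/2 - x)(4/3 - x), and all factors are nonnegative on [0, 1/2]. *)
have : 0 <= x * (2^-1 - x) * (4 / 3 - x) * a by rewrite !mulr_ge0//; lra.
move=> ha.
have : (1 + 6 * x) * ((1 - x) ^+ 2 * a) - a = 6 * (x * (2^-1 - x) * (4 / 3 - x) * a).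
  by field.
lra.
Qed.

(* The measure argument of u is the same for both particles, so the one-sided
   Lipschitz conditions apply term by term. *)
Lemma implicit_pair x y i k : implicit_sol x y -> (i < N)%N -> (k < N)%N ->
  enorm (y i - y k) ^+ 2 <= enorm (x i - x k) ^+ 2 + h * (3 * z) * enorm (x i - x k) ^+ 2.
Proof.
move=> xy iN kN; apply: (contraction_le z_pair (sqr_ge0 _) (sqr_ge0 _) (inner_sqr_le _ _)).
set dl := y i - y k.
have dlE : dl = (x i - x k) +
    h *: (v_coef f u (y i) (empirical hN y) - v_coef f u (y k) (empirical hN y)).
  by rewrite /dl {1}(xy i iN) {1}(xy k kN) scalerBr opprD addrACA.
rewrite -{1}inner_enorm {2}dlE innerDr lerD2l innerZr ler_wpM2l ?(ltW h0)//.
rewrite !VE opprD addrACA innerDr mulrDl lerD//; last exact: (u_onesided hu).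
rewrite -scalerBr -sumrB innerZr inner_sumr.
rewrite -{1}(avg_cst hN (Lf * enorm dl ^+ 2)) ler_wpM2l//; apply: ler_sum => j _.
have := f_onesided hf (y i - y j) (y k - y j).
by rewrite opprB addrA subrK.
Qed.

(* Oddness of f antisymmetrises phi i j below, which turns the double sum
   of <dy i, phi i j> into half the sum of <dy i - dy j, phi i j>. *)
Lemma implicit_total x y x' y' : implicit_sol x y -> implicit_sol x' y' ->
  msq N (fun j => y j - y' j)
    <= msq N (fun j => x j - x' j) + h * (3 * z) * msq N (fun j => x j - x' j).
Proof.
move=> xy xy'; set a := msq _ _; set b := msq _ _.
pose dy j := y j - y' j; pose dx j := x j - x' j.
pose c := N%:R^-1 * \sum_(j < N) inner (dy j) (dx j).
have cab : c ^+ 2 <= a * b.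
  rewrite /c /a /b /msq exprMn [leRHS]mulrACA -expr2 ler_wpM2l ?sqr_ge0//.
  under eq_bigr do rewrite /inner.
  under [X in _ <= X * _]eq_bigr do rewrite enorm_sqr_col.
  under [X in _ <= _ * X]eq_bigr do rewrite enorm_sqr_col.
  by rewrite !pair_bigA; exact: sum_cauchy_schwarz.
apply: (contraction_le z_total _ _ cab); rewrite ?msq_ge0//.
pose mu := empirical hN y; pose mu' := empirical hN y'.
pose phi i j := f (y i - y j) - f (y' i - y' j).
have dyE i : (i < N)%N -> enorm (dy i) ^+ 2 = inner (dy i) (dx i) +
    h * (N%:R^-1 * (\sum_(j < N) inner (dy i) (phi i j)) +
         inner (dy i) (u (y i) mu - u (y' i) mu')).
  move=> iN; rewrite -inner_enorm {2}/dy {1}(xy i iN) {1}(xy' i iN) opprD addrACA -scalerBr.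
  rewrite [LHS]innerDr [X in _ + X = _]innerZr !VE.
  congr (_ + _ * _); rewrite opprD addrACA -scalerBr -sumrB.
  by rewrite [LHS]innerDr [X in X + _ = _]innerZr inner_sumr.
have aE : a = c + h * (N%:R^-1 * (\sum_(i < N) N%:R^-1 * (\sum_(j < N) inner (dy i) (phi i j)))
   + N%:R^-1 * \sum_(i < N) inner (dy i) (u (y i) mu - u (y' i) mu')).
  rewrite -mulrDr mulrCA /c -mulrDr /a /msq; congr (_ * _).
  rewrite -big_split mulr_sumr -big_split; apply: eq_bigr => i _ /=.
  exact: dyE.
rewrite {1}aE lerD2l ler_wpM2l ?(ltW h0)// -addrA mulrDl lerD//.
  rewrite -mulr_sumr.
  have phiN i j : phi j i = - phi i j.
    by rewrite /phi (f_odd hf (y j - y i)) (f_odd hf (y' j - y' i)) !opprB opprK addrC.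
  have symE : (\sum_(i < N) \sum_(j < N) inner (dy i) (phi i j)) *+ 2 =
      \sum_(i < N) \sum_(j < N) inner (dy i - dy j) (phi i j).
    rewrite mulr2n {2}exchange_big -big_split; apply: eq_bigr => i _ /=.
    rewrite -big_split; apply: eq_bigr => j _ /=.
    by rewrite (phiN i j) innerNr innerBl.
  (* The positive part of Lf is needed because the pairwise spread is replaced by the larger 2 N sum
     |dy i|^2, which preserves the inequality only for a nonnegative factor. *)
  have sum_le : (\sum_(i < N) \sum_(j < N) inner (dy i) (phi i j)) *+ 2 <=
      Num.max 0 Lf * (2 * N%:R * \sum_(i < N) enorm (dy i) ^+ 2).
    rewrite symE; apply: (@le_trans _ _ (Num.max 0 Lf *
        \sum_(i < N) \sum_(j < N) enorm (dy i - dy j) ^+ 2)); last first.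
      by rewrite ler_wpM2l ?le_max ?lexx// sum_pair_spread.
    rewrite mulr_sumr; apply: ler_sum => i _; rewrite mulr_sumr; apply: ler_sum => j _.
    have -> : dy i - dy j = (y i - y j) - (y' i - y' j).
      by apply/matrixP => k l; rewrite !mxE; ring.
    apply: le_trans (f_onesided hf _ _) _; rewrite ler_wpM2r ?sqr_ge0//.
    by rewrite le_max lexx orbT.
  rewrite mulrA -(ler_pM2l (ltr0n R 2)) mulrCA.
  have -> : Num.max 0 Lf * a = N%:R^-1 * (Num.max 0 Lf * \sum_(i < N) enorm (dy i) ^+ 2).
    by rewrite /a /msq mulrCA.
  have NN : N%:R^-1 * N%:R = 1 :> R by rewrite mulVf// pnatr_eq0 -lt0n.
  rewrite [2 * \sum__ _]mulr_natl.
  apply: le_trans (ler_wpM2l _ sum_le) _; first by rewrite mulr_ge0.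
  rewrite le_eqVlt; apply/orP; left; apply/eqP.
  set S := \sum_(_ < _) _; set L := Num.max _ _.
  have -> : N%:R^-1 * N%:R^-1 * (L * (2 * N%:R * S)) =
    (N%:R^-1 * N%:R) * (2 * (N%:R^-1 * (L * S))) by ring.
  by rewrite NN mul1r.
have W := W2_empirical hN y y'; rewrite -/a -/mu -/mu' in W.
have Lt0 := u_Lutilde hu.
(* The difference of u is split into a change of position, where the one-sided condition applies,
   and a change of measure, whose W2 distance squared is at most a. The unknown a thus reappears on
   the right and is absorbed through [z_total]. *)
apply: (@le_trans _ _ (N%:R^-1 *
    \sum_(i < N) ((Lu + 2^-1) * enorm (dy i) ^+ 2 + Lutilde / 2 * a))).
  rewrite ler_wpM2l//; apply: ler_sum => i _.
  have -> : u (y i) mu - u (y' i) mu' =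
      (u (y i) mu - u (y' i) mu) + (u (y' i) mu - u (y' i) mu').
    by rewrite addrA subrK.
  rewrite innerDr.
  have e1 := u_onesided hu (y i) (y' i) mu.
  have e2 := inner_le (dy i) (u (y' i) mu - u (y' i) mu').
  have e3 := le_trans (u_measure hu (y' i) mu mu') (ler_wpM2l Lt0 W).
  rewrite -/(dy i) in e1; lra.
rewrite big_split mulrDr /= avg_cst// -mulr_sumr mulrCA -/(msq N dy) -/a; lra.
Qed.

End implicit_step.

(** * Growth of the coefficients and of the deterministic part of a step *)

Lemma growth_trans (R : realFieldType) (c1 c2 h a a' a'' : R) :
  0 <= h <= 1 -> 0 <= c1 -> 0 <= c2 -> 0 <= a ->
  a' <= a + h * (c1 * (1 + a)) -> a'' <= a' + h * (c2 * (1 + a')) ->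
  a'' <= a + h * ((c1 + c2 + c1 * c2) * (1 + a)).
Proof.
move=> /andP[h0 h1] c10 c20 a0 aa' aa''; apply: le_trans aa'' _.
have hc2 : 0 <= h * c2 by rewrite mulr_ge0.
have e1 := ler_wpM2l hc2 aa'.
have e2 : h * c2 * (h * (c1 * (1 + a))) <= h * c2 * (c1 * (1 + a)).
  by rewrite ler_wpM2l// ler_piMl// mulr_ge0// addr_ge0.
move: aa' e1 e2; lra.
Qed.

Section time_coefficient.
Variables (R : realType) (d m n : nat) (T L : R).
Variable g : R -> 'cV[R]_d -> P2 R d -> 'M[R]_(m, n).
Hypotheses (T0 : 0 < T) (hg : time_coef_cond T L g).

Lemma time_coef_lip t x x' N (hN : (0 < N)%N) (y y' : nat -> 'cV[R]_d) :
  t \in `[0, T] ->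
  enorm (g t x (empirical hN y) - g t x' (empirical hN y')) ^+ 2
    <= L * (enorm (x - x') ^+ 2 + msq N (fun j => y j - y' j)).
Proof.
have [_ _ L0 lip] := hg => tT; apply: le_trans (lip _ _ _ _ _ tT) _.
by rewrite ler_wpM2l// lerD2l W2_empirical.
Qed.

(** Comparison with the value at time 0, at the point 0 and at the Dirac measure at 0: the Lipschitz
    condition moves x and the measure, the Hölder condition moves t at the cost K^2 T. *)
Lemma time_coef_growth : exists2 C : R, 0 <= C &
  forall t x N (hN : (0 < N)%N) (y : nat -> 'cV[R]_d), t \in `[0, T] ->
    enorm (g t x (empirical hN y)) ^+ 2 <= C * (1 + enorm x ^+ 2 + msq N y).
Proof.
have [_ [K hK] L0 lip] := hg.
pose mu0 : P2 R d := empirical (ltn0Sn 0) (fun=> 0).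
pose G := enorm (g 0 0 mu0) ^+ 2.
have G0 : 0 <= G by exact: sqr_ge0.
have KT : 0 <= K ^+ 2 * T by rewrite mulr_ge0 ?sqr_ge0// ltW.
exists (2 * L + 4 * (K ^+ 2 * T) + 4 * G); first by lra.
move=> t x N hN y tT; set mu := empirical hN y.
have T00 : (0 : R) \in `[0, T] by rewrite in_itv/= lexx ltW.
have e1 : enorm (g t x mu - g t 0 mu0) ^+ 2 <= L * (enorm x ^+ 2 + msq N y).
  apply: le_trans (lip _ _ _ _ _ tT) _.
  by rewrite subr0 ler_wpM2l// lerD2l W2_empirical0.
have e2 : enorm (g t 0 mu0 - g 0 0 mu0) ^+ 2 <= K ^+ 2 * T.
  have h := hK 0 t 0 mu0 T00 tT.
  have {}h : enorm (g t 0 mu0 - g 0 0 mu0) ^+ 2 <= (K * `|t - 0| `^ 2^-1) ^+ 2.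
    by rewrite ler_sqr ?nnegrE ?enorm_ge0// (le_trans _ h) ?enorm_ge0.
  apply: le_trans h _; rewrite exprMn powR12_sqrt ?normr_ge0// sqr_sqrtr ?normr_ge0//.
  rewrite ler_wpM2l ?sqr_ge0// subr0.
  by move: tT; rewrite in_itv/= => /andP[t0 tT]; rewrite ger0_norm.
have -> : g t x mu = (g t x mu - g t 0 mu0) + ((g t 0 mu0 - g 0 0 mu0) + g 0 0 mu0).
  by rewrite !subrK.
apply: le_trans (enorm_sqrD _ _) _.
have e3 := enorm_sqrD (g t 0 mu0 - g 0 0 mu0) (g 0 0 mu0).
have m0 := msq_ge0 N y; have x0 := sqr_ge0 (enorm x).
rewrite -/G in e3; set a := enorm x ^+ 2 in e1 x0 *; set b := msq N y in e1 m0 *.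
have e4 : 0 <= (2 * L + 4 * (K ^+ 2 * T) + 4 * G) * (a + b).
  by apply: mulr_ge0; [lra|exact: addr_ge0].
have e5 : 0 <= (4 * (K ^+ 2 * T) + 4 * G) * (a + b).
  by apply: mulr_ge0; [lra|exact: addr_ge0].
move: e1 e2 e3 e4 e5; lra.
Qed.

End time_coefficient.

Lemma msqD_le (R : realType) d N (x y : nat -> 'cV[R]_d) (h : R) : 0 < h <= 1 ->
  msq N (fun k => x k + h *: y k) <= (1 + h) * msq N x + 2 * h * msq N y.
Proof.
move=> /andP[h0 h1]; rewrite /msq ![_ * (N%:R^-1 * _)]mulrCA -mulrDr.
rewrite ler_wpM2l ?invr_ge0// !mulr_sumr -big_split; apply: ler_sum => k _ /=.
apply: le_trans (enorm_sqrD_le _ _ h0) _; rewrite lerD2l enorm_sqrZ mulrA.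
rewrite ler_wpM2r ?sqr_ge0//.
have -> : (1 + h^-1) * h ^+ 2 = h ^+ 2 + h by field; rewrite gt_eqF.
by have := ler_wpM2l (ltW h0) h1; rewrite expr2; lra.
Qed.

Lemma msq_cst (R : realType) d N (x : 'cV[R]_d) : (0 < N)%N ->
  msq N (fun=> x) = enorm x ^+ 2.
Proof. by move=> hN; rewrite /msq avg_cst. Qed.

Lemma spread_msq (R : realType) d N (x : nat -> 'cV[R]_d) i :
  N%:R^-1 * \sum_(k < N) enorm (x i - x k) ^+ 2 = msq N (fun k => x i - x k).
Proof. by []. Qed.

Lemma msq_le (R : realType) d e N (x : nat -> 'cV[R]_d) (y : nat -> 'cV[R]_e) (c : R) :
  (forall k, (k < N)%N -> enorm (x k) ^+ 2 <= c * enorm (y k) ^+ 2) ->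
  msq N x <= c * msq N y.
Proof.
move=> xy; rewrite /msq mulrCA ler_wpM2l ?invr_ge0// mulr_sumr.
by apply: ler_sum => k _; exact: xy.
Qed.

Section one_step.
Variables (R : realType) (d : nat) (T : R).
Variables (f : 'cV[R]_d -> 'cV[R]_d) (u : 'cV[R]_d -> P2 R d -> 'cV[R]_d).
Variables (Lu Luhat Lutilde q1 Lf Lfhat q2 : R).
Hypotheses (hu : u_cond Lu Luhat Lutilde q1 u) (hf : f_cond Lf Lfhat q2 f).
Hypothesis T0 : 0 < T.
Let z := zeta Lf Lu Lutilde.

Let z0 : 0 <= z. Proof. by rewrite /z /zeta le_max lexx orbT. Qed.

(** The spread obeys a purely multiplicative bound by [implicit_pair]. The mean square needs a
    reference solution in [implicit_total], and the value of u at the origin is the source of the 1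
    in 1 + [lyap]. *)
Lemma implicit_lyap : exists2 c : R, 0 <= c &
  forall N (hN : (0 < N)%N) h, 0 < h <= 1 -> h * z <= 1 ->
  forall x y, implicit_sol f u hN h x y -> forall i, (i < N)%N ->
  lyap N y i <= lyap N x i + h * (c * (1 + lyap N x i)).
Proof.
pose mu0 : P2 R d := empirical (ltn0Sn 0) (fun=> 0).
pose U := enorm (u 0 mu0) ^+ 2; have U0 : 0 <= U by exact: sqr_ge0.
pose c1 := 1 + 2 * U; have c10 : 0 <= c1 by rewrite /c1; lra.
have c20 : 0 <= 3 * z by rewrite mulr_ge0.
have cc0 : 0 <= c1 * (3 * z) by rewrite mulr_ge0.
exists (c1 + 3 * z + c1 * (3 * z)); first by lra.
move=> N hN h /andP[h0 h1] hz x y xy i iN.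
have hh : 0 < h <= 1 by rewrite h0.
have hh' : 0 <= h <= 1 by rewrite ltW.
have e1 : msq N (fun k => y i - y k) <= (1 + h * (3 * z)) * msq N (fun k => x i - x k).
  apply: msq_le => k kN; rewrite mulrDl mul1r.
  exact: (implicit_pair hu hf (hN := hN)).
pose u0 := u 0 (empirical hN (fun=> 0)).
(* This makes the constant independent of N: N atoms at 0 are at W2 distance 0 from the Dirac
   measure, so the Lipschitz condition of u in the measure forces equal values. *)
have u0E : enorm u0 ^+ 2 = U.
  suff : u0 - u 0 mu0 = 0 by move/eqP; rewrite subr_eq0 => /eqP ->.
  have e : enorm (u0 - u 0 mu0) ^+ 2 <= 0.
    apply: le_trans (u_measure hu _ _ _) _.
    rewrite -(mulr0 Lutilde) ler_wpM2l ?(u_Lutilde hu)//.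
    apply: le_trans (W2_empirical0 hN _) _.
    by rewrite msq_cst// enorm0 expr0n.
  apply/matrixP => k j; rewrite [RHS]mxE.
  have := enorm_entry (u0 - u 0 mu0) k j.
  have -> : enorm (u0 - u 0 mu0) = 0.
    by apply/eqP; rewrite -sqrf_eq0 eq_le e sqr_ge0.
  by rewrite normr_le0 => /eqP.
(* Comparing with this solution, whose values are all 0, gives the growth of y. *)
have sol0 : implicit_sol f u hN h (fun=> - (h *: u0)) (fun=> 0).
  move=> k _; rewrite v_coef_empirical ?(f_measurable hf)//; last exact: (f_measurable hf).
  by rewrite subrr (f_zero hf) big1// scaler0 add0r addrC subrr.
have e2 : msq N y <= msq N (fun k => x k + h *: u0) +
    h * (3 * z) * msq N (fun k => x k + h *: u0).
  have := implicit_total hu hf h0 hz xy sol0.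
  have -> : (fun j => y j - 0) = y by apply/funext => j; rewrite subr0.
  by have -> : (fun j => x j - - (h *: u0)) = (fun j => x j + h *: u0)
    by apply/funext => j; rewrite opprK.
have e3 : msq N (fun k => x k + h *: u0) <= msq N x + h * (c1 * (1 + msq N x)).
  apply: le_trans (msqD_le _ _ _ hh) _; rewrite msq_cst// u0E.
  have m0 := msq_ge0 N x.
  have : 0 <= h * (2 * U * msq N x).
    by apply: (mulr_ge0 (ltW h0)); apply: (mulr_ge0 _ m0); exact: mulr_ge0.
  rewrite /c1; lra.
have e4 : msq N y <= msq N x + h * ((c1 + 3 * z + c1 * (3 * z)) * (1 + msq N x)).
  apply: growth_trans hh' c10 c20 (msq_ge0 N x) e3 _.
  apply: le_trans e2 _; rewrite lerD2l -mulrA ler_wpM2l ?(ltW h0)//.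
  by rewrite ler_wpM2l ?lerDr ?mulr_ge0.
rewrite !lyapE !spread_msq.
have s0 := msq_ge0 N (fun k => x i - x k).
have : 0 <= h * ((c1 + c1 * (3 * z)) * msq N (fun k => x i - x k)).
  by apply: (mulr_ge0 (ltW h0)); apply: (mulr_ge0 _ s0); exact: addr_ge0.
move: e1 e4; lra.
Qed.

Variables (Lb : R) (b : R -> 'cV[R]_d -> P2 R d -> 'cV[R]_d).
Hypothesis hb : time_coef_cond T Lb b.

(** An explicit step is enough for b, which is globally Lipschitz. In the spread all particles see
    the same measure, so its bound has neither a measure term nor an additive constant. *)
Lemma drift_lyap : exists2 c : R, 0 <= c &
  forall N (hN : (0 < N)%N) h t (y : nat -> 'cV[R]_d) i, 0 < h <= 1 -> t \in `[0, T] ->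
  lyap N (fun k => y k + h *: b t (y k) (empirical hN y)) i
    <= lyap N y i + h * (c * (1 + lyap N y i)).
Proof.
have [C C0 bC] := time_coef_growth T0 hb; have [_ _ L0 _] := hb.
exists (1 + 2 * Lb + 4 * C); first by rewrite !addr_ge0 ?mulr_ge0.
move=> N hN h t y i hh tT; set mu := empirical hN y.
have /andP[h0 h1] := hh.
have e1 : msq N (fun k => (y i + h *: b t (y i) mu) - (y k + h *: b t (y k) mu)) <=
    msq N (fun k => y i - y k) + h * ((1 + 2 * Lb) * msq N (fun k => y i - y k)).
  have -> : (fun k => (y i + h *: b t (y i) mu) - (y k + h *: b t (y k) mu)) =
      (fun k => (y i - y k) + h *: (b t (y i) mu - b t (y k) mu)).
    by apply/funext => k; rewrite opprD addrACA -scalerBr.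
  apply: le_trans (msqD_le _ _ _ hh) _.
  have : msq N (fun k => b t (y i) mu - b t (y k) mu) <= Lb * msq N (fun k => y i - y k).
    apply: msq_le => k kN; apply: le_trans (time_coef_lip hb _ _ hN _ _ tT) _.
    rewrite ler_wpM2l// (_ : (fun j => y j - y j) = fun=> 0); last first.
      by apply/funext => j; rewrite subrr.
    by rewrite msq_cst// enorm0 expr0n addr0.
  move/(ler_wpM2l (ltW h0)); lra.
have e2 : msq N (fun k => y k + h *: b t (y k) mu) <=
    msq N y + h * ((1 + 4 * C) * (1 + msq N y)).
  apply: le_trans (msqD_le _ _ _ hh) _.
  have : msq N (fun k => b t (y k) mu) <= C * (1 + 2 * msq N y).
    apply: (@le_trans _ _ (N%:R^-1 * \sum_(k < N) (C * (1 + msq N y) + C * enorm (y k) ^+ 2))).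
      rewrite ler_wpM2l ?invr_ge0//; apply: ler_sum => k _.
      by have := bC t (y k) N hN y tT; rewrite -/mu; lra.
    rewrite big_split mulrDr /= avg_cst// -mulr_sumr mulrCA -/(msq N y); lra.
  move/(ler_wpM2l (ltW h0)).
  have := mulr_ge0 (ltW h0) C0; lra.
rewrite !lyapE !spread_msq.
have s0 := msq_ge0 N (fun k => y i - y k); have m0 := msq_ge0 N y.
have g1 : 0 <= h * (4 * C * msq N (fun k => y i - y k)) 
  by apply: (mulr_ge0 (ltW h0)); apply: (mulr_ge0 _ s0); apply: mulr_ge0.
have g2 : 0 <= h * (2 * Lb * (1 + msq N y)).
  by apply: (mulr_ge0 (ltW h0)); apply: mulr_ge0; [exact: mulr_ge0|exact: addr_ge0].
by apply: le_trans (lerD e1 e2) _; move: g1 g2; lra.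
Qed.

End one_step.

(** * One step of the scheme in mean *)

Section mean_le.
Context (disp : measure_display) (Omega : measurableType disp) (R : realType).
Variable P : probability Omega R.
Implicit Types (xi eta : Omega -> R) (K : R).

(** Measurability and sign are bundled with the bound, so that every moment estimate carries its own
    integrability and products or sums can be formed without further checks. *)
Definition mean_le xi K := [/\ measurable_fun setT xi, forall w, 0 <= xi w
  & (\int[P]_w (xi w)%:E <= K%:E)%E].

Lemma mean_le_bound_ge0 xi K : mean_le xi K -> 0 <= K.
Proof.
case=> _ xi0 xiK; rewrite -lee_fin; apply: le_trans xiK.
by apply: integral_ge0 => w _; rewrite lee_fin.
Qed.

Lemma mean_le_integrable xi K : mean_le xi K -> P.-integrable setT (EFin \o xi).
Proof.
case=> mxi xi0 xiK; apply/integrableP; split; first exact/measurable_EFinP.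
rewrite (eq_integral (fun w => (xi w)%:E)) => [|w _ /=]; last by rewrite ger0_norm.
exact: le_lt_trans xiK (ltry _).
Qed.

Lemma mean_leW xi K K' : K <= K' -> mean_le xi K -> mean_le xi K'.
Proof. by move=> KK' [m x0 xK]; split=> //; apply: le_trans xK _; rewrite lee_fin. Qed.

Lemma mean_le_dom xi eta K : measurable_fun setT xi -> (forall w, 0 <= xi w <= eta w) ->
  mean_le eta K -> mean_le xi K.
Proof.
move=> mxi xie [meta eta0 etaK]; have xi0 w : 0 <= xi w by have /andP[] := xie w.
split=> //; apply: le_trans etaK; apply: ge0_le_integral => //.
- by move=> w _; rewrite lee_fin.
- exact/measurable_EFinP.
- exact/measurable_EFinP.
- by move=> w _; rewrite lee_fin; have /andP[] := xie w.
Qed.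

Lemma mean_le_cst (c : R) : 0 <= c -> mean_le (fun=> c) c.
Proof. by move=> c0; split=> //; have := expectation_cst P c; rewrite unlock => ->. Qed.

Lemma mean_leD xi eta K K' : mean_le xi K -> mean_le eta K' ->
  mean_le (fun w => xi w + eta w) (K + K').
Proof.
move=> [m1 p1 b1] [m2 p2 b2]; split; first exact: measurable_funD.
- by move=> w; rewrite addr_ge0.
have me1 := (measurable_EFinP _ _).2 m1; have me2 := (measurable_EFinP _ _).2 m2.
under eq_integral do rewrite EFinD.
rewrite ge0_integralD//; first by rewrite EFinD leeD.
- by move=> w _; rewrite lee_fin.
- by move=> w _; rewrite lee_fin.
Qed.

Lemma mean_leZ (c : R) xi K : 0 <= c -> mean_le xi K ->
  mean_le (fun w => c * xi w) (c * K).
Proof.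
move=> c0 [m1 p1 b1]; split; first exact: measurable_funM.
- by move=> w; rewrite mulr_ge0.
have me1 := (measurable_EFinP _ _).2 m1.
under eq_integral do rewrite EFinM.
rewrite ge0_integralZl//; first by rewrite EFinM lee_wpmul2l ?lee_fin.
by move=> w _; rewrite lee_fin.
Qed.

Lemma mean_le_sum n (xi : 'I_n -> Omega -> R) (K : 'I_n -> R) :
  (forall i, mean_le (xi i) (K i)) ->
  mean_le (fun w => \sum_i xi i w) (\sum_i K i).
Proof.
move=> H; split.
- by apply: measurable_sum => i; have [] := H i.
- by move=> w; apply: sumr_ge0 => i _; have [] := H i.
have me i : measurable_fun setT (fun w => (xi i w)%:E).
  by apply/measurable_EFinP; have [] := H i.
under eq_integral do rewrite -sumEFin.
rewrite ge0_integral_sum//; last by move=> i w _; rewrite lee_fin; have [] := H i.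
by rewrite -sumEFin; apply: lee_sum => i _; have [] := H i.
Qed.

Lemma mean_le_avg n (xi : 'I_n -> Omega -> R) K : (0 < n)%N ->
  (forall i, mean_le (xi i) K) ->
  mean_le (fun w => n%:R^-1 * \sum_i xi i w) K.
Proof.
move=> n0 H; rewrite -(avg_cst n0 K); apply: mean_leZ; first by rewrite invr_ge0.
exact: mean_le_sum.
Qed.

Lemma mean_leM_indep xi eta K K' : indep_rv P xi eta ->
  mean_le xi K -> mean_le eta K' -> mean_le (fun w => xi w * eta w) (K * K').
Proof.
move=> ind h1 h2; have [m1 p1 b1] := h1; have [m2 p2 b2] := h2.
split; first exact: measurable_funM.
- by move=> w; rewrite mulr_ge0.
rewrite ge0_expectation_indep// EFinM; apply: lee_pmul => //.
- by apply: integral_ge0 => w _; rewrite lee_fin.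
- by apply: integral_ge0 => w _; rewrite lee_fin.
Qed.

(** The form in which the pathwise Taylor bound is integrated: [lin] is the term linear in the
    noise, which has no sign and disappears only in the mean. *)
Lemma mean_le_add_centered xi eta lin K : measurable_fun setT xi ->
  (forall w, 0 <= xi w) -> (forall w, xi w <= eta w + lin w) -> mean_le eta K ->
  P.-integrable setT (EFin \o lin) -> (\int[P]_w (lin w)%:E = 0)%E ->
  mean_le xi K.
Proof.
move=> mxi xi0 xile etaK ilin lin0; split=> //.
have ieta := mean_le_integrable etaK; have [meta eta0 bK] := etaK.
have mlin : measurable_fun setT lin by apply/measurable_EFinP; exact: measurable_int ilin.
apply: (@le_trans _ _ (\int[P]_w ((EFin \o eta) w + (EFin \o lin) w))%E).
  apply: ge0_le_integral => //.
  - by move=> w _; rewrite lee_fin.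
  - exact/measurable_EFinP.
  - by apply/measurable_EFinP/measurable_funD.
  - by move=> w _ /=; rewrite -EFinD lee_fin.
by rewrite integralD//= lin0 adde0.
Qed.

End mean_le.

Section noise.
Context (disp : measure_display) (Omega : measurableType disp) (R : realType).
Variables (P : probability Omega R) (F : R -> set (set Omega)).
Hypothesis hF : complete_filtration P F.
Variables (d l : nat) (W : R -> Omega -> 'cV[R]_l).
Hypothesis hW : brownian_motion P F W.
Variables (s t : R).
Hypotheses (s0 : 0 <= s) (st : s < t).

(** The product is a sum over k of an F_s-measurable factor c_k times the k-th coordinate of the
    increment. Integrability of c_k follows from |v_j S_jk| <= v_j^2 + S_jk^2, whence the form of
    the hypothesis. *)
Lemma noise_centered (xi : Omega -> R) (v : Omega -> 'cV[R]_d) (S : Omega -> 'M[R]_(d, l)) :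
  (forall w, 0 <= xi w) -> measurable_wrt (F s) xi ->
  (forall j, measurable_wrt (F s) (fun w => v w j 0)) ->
  (forall j k, measurable_wrt (F s) (fun w => S w j k)) ->
  P.-integrable setT (fun w => (xi w * (enorm (v w) ^+ 2 + enorm (S w) ^+ 2))%:E) ->
  P.-integrable setT (fun w => (xi w * inner (v w) (S w *m (W t w - W s w)))%:E) /\
  (\int[P]_w (xi w * inner (v w) (S w *m (W t w - W s w)))%:E = 0)%E.
Proof.
move=> xi0 mxi mv mS ig.
pose c k w := xi w * \sum_j v w j 0 * S w j k.
have cE w : xi w * inner (v w) (S w *m (W t w - W s w)) =
    \sum_k c k w * (W t w - W s w) k 0.
  rewrite /inner /c; under eq_bigr do rewrite mxE mulr_sumr.
  rewrite exchange_big mulr_sumr; apply: eq_bigr => k _ /=.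
  by rewrite -mulrA; congr (_ * _); rewrite mulr_suml; apply: eq_bigr => j _; rewrite mulrA.
have mc k : measurable_wrt (F s) (c k).
  apply: measurable_funM => //; apply: measurable_sum => j.
  by apply: measurable_funM; [exact: mv|exact: mS].
have ic k : P.-integrable setT (EFin \o c k).
  apply: (le_integrable _ _ _ ig) => //.
    by apply/measurable_EFinP; exact: (measurable_wrt_fun (cf_sub hF s0)).
  move=> w _ /=; rewrite lee_fin [leRHS]ger0_norm; last first.
    by rewrite mulr_ge0// addr_ge0 ?sqr_ge0.
  rewrite /c normrM ger0_norm// ler_wpM2l//.
  apply: le_trans (ler_norm_sum _ _ _) _.
  rewrite enorm_sqr_col enorm_sqr -big_split; apply: ler_sum => j _ /=.
  apply: (@le_trans _ _ (v w j 0 ^+ 2 + S w j k ^+ 2)).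
    rewrite normrM -(real_normK (num_real (v w j 0))) -(real_normK (num_real (S w j k))).
    have := sqr_ge0 (`|v w j 0| - `|S w j k|).
    have := normr_ge0 (v w j 0); have := normr_ge0 (S w j k); nra.
  rewrite lerD2l (bigD1 k)//= lerDl; apply: sumr_ge0 => m _; exact: sqr_ge0.
have H k := brownian_incr_centered hF hW k s0 st (mc k) (ic k).
have -> : (fun w => (xi w * inner (v w) (S w *m (W t w - W s w)))%:E) =
    (fun w => \sum_k (c k w * (W t w - W s w) k 0)%:E)%E.
  by apply/funext => w; rewrite cE sumEFin.
split; first by apply: integrable_sum => // k _; exact: (H k).1.
rewrite integral_sum//; last by move=> k; exact: (H k).1.
by rewrite big1// => k _; exact: (H k).2.
Qed.

End noise.

(** The source type is arbitrary, so that this serves both the full sigma-algebra and that of a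
    fixed time. *)
Lemma measurable_lyap (R : realType) (disp : measure_display)
    (Om : measurableType disp) d N (z : nat -> Om -> 'cV[R]_d) i :
  (forall k, (k < N)%N -> forall j, measurable_fun setT (fun w => z k w j 0)) ->
  (i < N)%N -> measurable_fun setT (fun w => lyap N (z^~ w) i).
Proof.
move=> mz iN; apply: measurable_funM => //; apply: measurable_sum => k.
apply: measurable_funD; under eq_fun do rewrite enorm_sqr_col;
  apply: measurable_sum => j; apply: measurable_funX; last exact: mz.
by under eq_fun do rewrite !mxE; apply: measurable_funB; apply: mz.
Qed.

Lemma measurable_mulmx_entry (R : realType) (disp : measure_display)
    (Om : measurableType disp) d l (A : Om -> 'M[R]_(d, l)) (x : Om -> 'cV[R]_l) j :
  (forall k, measurable_fun setT (fun w => A w j k)) ->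
  (forall k, measurable_fun setT (fun w => x w k 0)) ->
  measurable_fun setT (fun w => (A w *m x w) j 0).
Proof.
move=> mA mx; under eq_fun do rewrite mxE.
by apply: measurable_sum => k; exact: measurable_funM.
Qed.

Section noise_bound.
Variables (R : realType) (p : R).
Hypothesis p1 : 1 <= p.

(** The right-hand side separates Q, a, a', known at the beginning of the step, from the increments
    b, b', so that its mean factorises. The coefficients 2 and 3 are those of [lyap_le]. *)
Lemma noise_term_le (Q a b a' b' : R) : 0 <= Q -> 0 <= a -> 0 <= b -> 0 <= a' -> 0 <= b' ->
  Q `^ (p - 1) * (2 * (a * b) + 3 * (a' * b')) + (2 * (a * b) + 3 * (a' * b')) `^ p
  <= (3 + 2 `^ p * 3 `^ p) * ((Q `^ p + a `^ p) * (b + b `^ p)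
       + (Q `^ p + a' `^ p) * (b' + b' `^ p)).
Proof.
move=> Q0 a0 b0 a'0 b'0.
have half x y : 0 <= x -> 0 <= y ->
    Q `^ (p - 1) * (x * y) <= (Q `^ p + x `^ p) * (y + y `^ p) /\
    (x * y) `^ p <= (Q `^ p + x `^ p) * (y + y `^ p).
  move=> x0 y0; have Qp := powR_ge0 Q p; have xp := powR_ge0 x p; have yp := powR_ge0 y p.
  have h1 := mulr_ge0 Qp yp; have h2 := mulr_ge0 xp yp.
  have h3 := mulr_ge0 Qp y0; have h4 := mulr_ge0 xp y0.
  split; last by rewrite powRM//; lra.
  have := ler_wpM2r y0 (powR_young p1 Q0 x0); lra.
have [h1 h2] := half a b a0 b0; have [h3 h4] := half a' b' a'0 b'0.
set X := (_ + _) * (_ + _) in h1 h2 *; set Y := (_ + _) * (_ + _) in h3 h4 *.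
have X0 : 0 <= X by apply: le_trans h2; exact: powR_ge0.
have Y0 : 0 <= Y by apply: le_trans h4; exact: powR_ge0.
have e2 : 0 <= 2 `^ p :> R := powR_ge0 _ _.
have e23 : 2 `^ p <= 3 `^ p :> R.
  by apply: ge0_ler_powR; rewrite ?nnegrE ?(le_trans ler01 p1)//; lra.
have e3 : (2 * (a * b) + 3 * (a' * b')) `^ p <= 2 `^ p * (3 `^ p * X + 3 `^ p * Y).
  apply: le_trans (powRD_le p1 _ _) _; rewrite ?mulr_ge0//.
  rewrite ler_wpM2l// lerD// powRM ?mulr_ge0//.
    by apply: ler_pM; rewrite ?powR_ge0.
  by rewrite ler_wpM2l// powR_ge0.
move: e3; lra.
Qed.

End noise_bound.

Section one_step_moment.
Context (disp : measure_display) (Omega : measurableType disp) (R : realType).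
Variables (P : probability Omega R) (F : R -> set (set Omega)).
Hypothesis hF : complete_filtration P F.
Variables (d l : nat) (p c : R).
Hypotheses (p1 : 1 <= p) (c0 : 0 <= c).

(** Here z is the state after the implicit and the drift step, S the diffusion matrix, and a the
    value of [lyap] before the step. A single K for all particles is required because the noise in
    [lyap] at i averages the diffusions of all of them. *)
Lemma one_step_moment : exists2 C : R, 0 <= C &
  forall N (hN : (0 < N)%N) (W : nat -> R -> Omega -> 'cV[R]_l),
  (forall i, brownian_motion P F (W i)) ->
  forall s t, 0 <= s -> s < t -> t <= s + 1 ->
  forall (z : nat -> Omega -> 'cV[R]_d) (S : nat -> Omega -> 'M[R]_(d, l))
    (a : nat -> Omega -> R) (K : R),
  (forall i, (i < N)%N -> forall j, measurable_wrt (F s) (fun w => z i w j 0)) ->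
  (forall i, (i < N)%N -> forall j k, measurable_wrt (F s) (fun w => S i w j k)) ->
  (forall i, (i < N)%N -> measurable_wrt (F s) (a i)) ->
  (forall i w, 0 <= a i w) ->
  (forall i w, (i < N)%N -> lyap N (z^~ w) i <= a i w + (t - s) * (c * (1 + a i w))) ->
  (forall i w, (i < N)%N -> enorm (S i w) ^+ 2 <= c * (1 + a i w)) ->
  (forall i, (i < N)%N -> mean_le P (fun w => a i w `^ p) K) ->
  forall i, (i < N)%N ->
  mean_le P (fun w => lyap N (fun k => z k w + S k w *m (W k t w - W k s w)) i `^ p)
    (K + (t - s) * (C * (1 + K))).
Proof.
have [C1 C10 taylor] := powR_taylor2 p1.
have [C2 C20 perturb] := powR_perturb p1 c0.
have [C3 C30 incr] := brownian_incr_moment hF l p1.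
have p0 : 0 <= p by exact: le_trans p1.
have q0 : 0 <= p - 1 by rewrite subr_ge0.
pose D : R := 3 + 2 `^ p * 3 `^ p.
have D0 : 0 <= D by rewrite addr_ge0// mulr_ge0// powR_ge0.
pose E := 1 + C2 + c `^ p * 2 `^ p.
have E0 : 0 <= E by rewrite !addr_ge0// mulr_ge0// powR_ge0.
have CDE : 0 <= C1 * D * E by rewrite !mulr_ge0// ltW.
exists (C2 + C1 * D * E * (4 * C3)); first by rewrite addr_ge0// !mulr_ge0// ltW.
move=> N hN W hW s t s0 st ts1 z S a K mz mS ma a0 Qa Sa aK i iN.
set h := t - s; have h0 : 0 < h by rewrite subr_gt0.
have h1 : h <= 1 by rewrite lerBlDl.
have hh : 0 <= h <= 1 by rewrite ltW.
have t0 : 0 <= t by exact: ltW (le_lt_trans s0 st).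
have Fm := cf_sub hF s0.
have K0 : 0 <= K := mean_le_bound_ge0 (aK i iN).
pose dW k w := W k t w - W k s w.
pose g w k := S k w *m dW k w.
pose Q w := lyap N (z^~ w) i.
pose G w := lyap N (g w) i.
pose B w := lyap_polar N (z^~ w) (g w) i.
pose beta k w := enorm (dW k w) ^+ 2.
pose eta k w := beta k w + beta k w `^ p.
pose al k w := enorm (S k w) ^+ 2.
(* [rho] is known at time s and [eta] depends on the increment only. The remainder of the Taylor
   bound will be dominated by averages of products of the two, and [eta] supplies the factor h. *)
pose rho k w := 1 + a i w `^ p + a k w `^ p.
have Q0 w : 0 <= Q w by exact: lyap_ge0.
have G0 w : 0 <= G w by exact: lyap_ge0.
have beta0 k w : 0 <= beta k w by exact: sqr_ge0.
have eta0 k w : 0 <= eta k w by rewrite addr_ge0// powR_ge0.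
have al0 k w : 0 <= al k w by exact: sqr_ge0.
have ap0 k w : 0 <= a k w `^ p by exact: powR_ge0.
have F1 w : Q w `^ p <= a i w `^ p + h * (C2 * (1 + a i w `^ p)).
  apply: le_trans (perturb _ _ (a0 i w) hh).
  by apply: ge0_ler_powR; rewrite ?nnegrE ?Qa// (le_trans (Q0 w))// Qa.
have F23 k w : (k < N)%N -> Q w `^ p + al k w `^ p <= E * rho k w.
  move=> kN.
  have e1 : Q w `^ p <= (1 + C2) * (1 + a i w `^ p).
    apply: le_trans (F1 w) _.
    have : h * (C2 * (1 + a i w `^ p)) <= C2 * (1 + a i w `^ p).
      by rewrite ler_piMl// mulr_ge0// addr_ge0.
    lra.
  have e2 : al k w `^ p <= c `^ p * 2 `^ p * (1 + a k w `^ p).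
    apply: (@le_trans _ _ ((c * (1 + a k w)) `^ p)).
      apply: ge0_ler_powR; rewrite ?nnegrE ?Sa//.
      by rewrite mulr_ge0// addr_ge0.
    rewrite powRM ?addr_ge0// -mulrA ler_wpM2l ?powR_ge0//.
    by apply: le_trans (powRD_le p1 _ _) _ => //; rewrite powR1.
  have e3 : 0 <= c `^ p * 2 `^ p :> R by rewrite mulr_ge0// powR_ge0.
  have := mulr_ge0 e3 (ap0 i w); have := mulr_ge0 C20 (ap0 k w); have := ap0 k w.
  rewrite /E /rho; lra.
have mbeta k : measurable_fun setT (beta k).
  rewrite /beta; under eq_fun do rewrite enorm_sqr_col.
  apply: measurable_sum => j; apply: measurable_funX; under eq_fun do rewrite !mxE.
  by apply: measurable_funB; apply: (measurable_brownian_entry hF (hW k)).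
have eta_mean k : mean_le P (eta k) (C3 * h).
  split=> //; last by apply: incr => //; rewrite ltW.
  by apply: measurable_funD => //; exact: (measurableT_comp (measurable_powR p)).
have mrho k : (k < N)%N -> measurable_wrt (F s) (rho k).
  move=> kN; apply: measurable_funD; last first.
    exact: (measurableT_comp (measurable_powR p) (ma k kN)).
  by apply: measurable_funD => //; exact: (measurableT_comp (measurable_powR p) (ma i iN)).
have rho_mean k : (k < N)%N -> mean_le P (rho k) (1 + K + K).
  move=> kN; apply: mean_leD; last exact: aK.
  by apply: mean_leD; [exact: mean_le_cst|exact: aK].
have rho_eta k : (k < N)%N -> mean_le P (fun w => rho k w * eta k w) ((1 + K + K) * (C3 * h)).
  move=> kN; apply: mean_leM_indep; [|exact: rho_mean|exact: eta_mean].
  apply: (brownian_indep_rv hF (hW k) s0 st (g := fun x : borel R l =>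
    enorm (x : 'cV[R]_l) ^+ 2 + (enorm (x : 'cV[R]_l) ^+ 2) `^ p)); first exact: mrho.
  have me : measurable_fun setT (fun x : borel R l => enorm (x : 'cV[R]_l) ^+ 2).
    by apply: measurable_funX; exact: measurable_enorm.
  by apply: measurable_funD => //; exact: (measurableT_comp (measurable_powR p) me).
have mz' k : (k < N)%N -> forall j, measurable_fun setT (fun w => z k w j 0).
  by move=> kN j; apply: (measurable_wrt_fun Fm); exact: mz.
have mS' k : (k < N)%N -> forall j j', measurable_fun setT (fun w => S k w j j').
  by move=> kN j j'; apply: (measurable_wrt_fun Fm); exact: mS.
have mQ : measurable_wrt (F s) Q by apply: measurable_lyap => // k kN j; exact: mz.
have mQp : measurable_wrt (F s) (fun w => Q w `^ (p - 1)).
  exact: (measurableT_comp (measurable_powR _) mQ).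
have F5 w : Q w `^ (p - 1) * G w + G w `^ p <=
    N%:R^-1 * \sum_(k < N) D * E * (rho i w * eta i w + rho k w * eta k w).
  pose m k := 2 * (al i w * beta i w) + 3 * (al k w * beta k w).
  have gb k : enorm (g w k) ^+ 2 <= al k w * beta k w by exact: enorm_sqrM_le.
  have Gm : G w <= N%:R^-1 * \sum_(k < N) m k.
    apply: le_trans (lyap_le hN (g w) i) _.
    rewrite big_split mulrDr /= avg_cst// -mulr_sumr [N%:R^-1 * (3 * _)]mulrCA.
    apply: lerD; first by rewrite ler_wpM2l.
    rewrite ler_wpM2l// ler_wpM2l ?invr_ge0//; apply: ler_sum => k _; exact: gb.
  have m0 k : 0 <= m k.
    by apply: addr_ge0; apply: mulr_ge0 => //; apply: mulr_ge0.
  have Gp : G w `^ p <= N%:R^-1 * \sum_(k < N) m k `^ p.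
    apply: le_trans (powR_avg p1 hN (fun k => m0 k)).
    apply: ge0_ler_powR; rewrite ?nnegrE//.
    exact: le_trans Gm.
  apply: le_trans (lerD (ler_wpM2l (powR_ge0 _ _) Gm) Gp) _.
  rewrite mulrCA -mulrDr ler_wpM2l ?invr_ge0// mulr_sumr -big_split.
  apply: ler_sum => k _ /=.
  apply: le_trans (noise_term_le p1 (Q0 w) (al0 i w) (beta0 i w) (al0 k w) (beta0 k w)) _.
  rewrite -/D -mulrA ler_wpM2l// [leRHS]mulrDr.
  apply: lerD; rewrite [leRHS]mulrA; apply: ler_wpM2r.
  - exact: (eta0 i w).
  - exact: (F23 i w iN).
  - exact: (eta0 k w).
  - exact: (F23 k w (ltn_ord k)).
pose A w := a i w `^ p + h * (C2 * (1 + a i w `^ p)) +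
   C1 * (N%:R^-1 * \sum_(k < N) D * E * (rho i w * eta i w + rho k w * eta k w)).
(* The factor 4 comes from 2 (1 + 2 K) <= 4 (1 + K). *)
have A_mean : mean_le P A (K + h * ((C2 + C1 * D * E * (4 * C3)) * (1 + K))).
  apply: (@mean_leW _ _ _ _ _ (K + h * (C2 * (1 + K)) +
     C1 * (D * E * ((1 + K + K) * (C3 * h) + (1 + K + K) * (C3 * h))))).
    have : 0 <= h * (C1 * D * E * C3) by rewrite mulr_ge0 ?(ltW h0)// mulr_ge0.
    lra.
  apply: mean_leD.
    apply: mean_leD; first exact: aK.
    apply: mean_leZ; first exact: ltW.
    apply: mean_leZ => //; apply: mean_leD; [exact: mean_le_cst|exact: aK].
  apply: mean_leZ; first exact: ltW.
  apply: mean_le_avg => // k; apply: mean_leZ; first exact: mulr_ge0.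
  by apply: mean_leD; exact: rho_eta.
(* The factor N in the hypothesis on v is harmless: it serves integrability only, and the mean is
   exactly 0. *)
have T_centered (v : Omega -> 'cV[R]_d) k : (k < N)%N ->
    (forall j, measurable_wrt (F s) (fun w => v w j 0)) ->
    (forall w, enorm (v w) ^+ 2 <= N%:R * Q w) ->
    P.-integrable setT (EFin \o (fun w => Q w `^ (p - 1) * inner (v w) (g w k))) /\
    (\int[P]_w (Q w `^ (p - 1) * inner (v w) (g w k))%:E = 0)%E.
  move=> kN mv vQ; apply: (noise_centered hF (hW k) s0 st) => //.
  - by move=> w; exact: powR_ge0.
  - by move=> j j'; exact: mS.
  have dom : mean_le P (fun w => (N%:R + 1) * E * rho k w) ((N%:R + 1) * E * (1 + K + K)).
    by apply: mean_leZ; [rewrite mulr_ge0// addr_ge0|exact: rho_mean].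
  apply: (mean_le_integrable (mean_le_dom _ _ dom)).
    apply: measurable_funM; first exact: (measurable_wrt_fun Fm mQp).
    apply: measurable_funD.
      under eq_fun do rewrite enorm_sqr_col; apply: measurable_sum => j.
      by apply: measurable_funX; exact: (measurable_wrt_fun Fm (mv j)).
    under eq_fun do rewrite enorm_sqr; apply: measurable_sum => j; apply: measurable_sum => j'.
    by apply: measurable_funX; exact: mS'.
  move=> w; rewrite mulr_ge0 ?powR_ge0 ?addr_ge0 ?sqr_ge0//=.
  have e1 : Q w `^ (p - 1) * enorm (v w) ^+ 2 <= N%:R * Q w `^ p.
    rewrite -(mulr_powRB1 (Q0 w) (lt_le_trans ltr01 p1)) mulrA mulrC ler_wpM2r ?powR_ge0//.
  have e2 := powR_young p1 (Q0 w) (al0 k w).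
  have e3 := F23 k w kN; have e4 := ler_wpM2l (ler0n R N) e3.
  have e5 := powR_ge0 (al k w) p; have e6 := mulr_ge0 (ler0n R N) e5.
  rewrite -/(al k w) mulrDr; lra.
have spread_le w k : (k < N)%N ->
    enorm (z i w - z k w) ^+ 2 + enorm (z k w) ^+ 2 <= N%:R * Q w.
  move=> kN; rewrite /Q /lyap mulrA divff ?mul1r; last by rewrite pnatr_eq0 -lt0n.
  rewrite (bigD1 (Ordinal kN))//= lerDl; apply: sumr_ge0 => j _.
  by rewrite addr_ge0// sqr_ge0.
pose lin w := 2 * p * (Q w `^ (p - 1) * B w).
have linE w : Q w `^ (p - 1) * B w = N%:R^-1 * \sum_(k < N)
    (Q w `^ (p - 1) * inner (z i w - z k w) (g w i)
     - Q w `^ (p - 1) * inner (z i w - z k w) (g w k)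
     + Q w `^ (p - 1) * inner (z k w) (g w k)).
  rewrite /B /lyap_polar mulrCA; congr (_ * _); rewrite mulr_sumr; apply: eq_bigr => k _.
  by rewrite innerBr -mulrBr -mulrDr.
have mzi k j : (k < N)%N -> measurable_wrt (F s) (fun w => (z i w - z k w) j 0).
  move=> kN; rewrite /measurable_wrt; under eq_fun do rewrite !mxE.
  by apply: measurable_funB; [exact: mz|exact: mz].
have term k : (k < N)%N ->
    P.-integrable setT (EFin \o (fun w => Q w `^ (p - 1) * inner (z i w - z k w) (g w i)
     - Q w `^ (p - 1) * inner (z i w - z k w) (g w k)
     + Q w `^ (p - 1) * inner (z k w) (g w k))) /\
    (\int[P]_w (Q w `^ (p - 1) * inner (z i w - z k w) (g w i)
     - Q w `^ (p - 1) * inner (z i w - z k w) (g w k)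
     + Q w `^ (p - 1) * inner (z k w) (g w k))%:E = 0)%E.
  move=> kN.
  have v1 w : enorm (z i w - z k w) ^+ 2 <= N%:R * Q w.
    by apply: le_trans (spread_le w k kN); rewrite lerDl sqr_ge0.
  have v2 w : enorm (z k w) ^+ 2 <= N%:R * Q w.
    by apply: le_trans (spread_le w k kN); rewrite lerDr sqr_ge0.
  have [i1 z1] := T_centered _ i iN (fun j => mzi k j kN) v1.
  have [i2 z2] := T_centered _ k kN (fun j => mzi k j kN) v1.
  have [i3 z3] := T_centered _ k kN (mz k kN) v2.
  have i12 := integrableB measurableT i1 i2.
  split; first exact: (integrableD measurableT i12 i3).
  under eq_integral do rewrite EFinD EFinB.
  by rewrite integralD// integralB// z1 z2 z3 sube0 adde0.
have [ilin lin0] : P.-integrable setT (EFin \o lin) /\ (\int[P]_w (lin w)%:E = 0)%E.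
  pose tm (k : 'I_N) w := Q w `^ (p - 1) * inner (z i w - z k w) (g w i)
     - Q w `^ (p - 1) * inner (z i w - z k w) (g w k)
     + Q w `^ (p - 1) * inner (z k w) (g w k).
  have linE' : (fun w => (lin w)%:E) =
      (fun w => (2 * p * N%:R^-1)%:E * (\sum_(k < N) (EFin \o tm k) w))%E.
    by apply/funext => w; rewrite /lin linE mulrA sumEFin -EFinM.
  have itm (k : 'I_N) : P.-integrable setT (EFin \o tm k) by exact: (term k (ltn_ord k)).1.
  have isum : P.-integrable setT (fun w => \sum_(k < N) (EFin \o tm k) w)%E.
    by apply: integrable_sum => // k _; exact: itm.
  rewrite [EFin \o lin]linE' linE'; split; first exact: integrableZl.
  rewrite integralZl// integral_sum// big1 ?mule0// => k _.
  exact: (term k (ltn_ord k)).2.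
apply: (@mean_le_add_centered _ _ _ _ _ A lin) => //.
  apply: (measurableT_comp (measurable_powR p)); apply: measurable_lyap => // k kN j.
  under eq_fun do rewrite mxE; apply: measurable_funD; first exact: mz'.
  apply: measurable_mulmx_entry => j'; first exact: mS'.
  under eq_fun do rewrite !mxE.
  by apply: measurable_funB; apply: (measurable_brownian_entry hF (hW k)).
  by move=> w; exact: powR_ge0.
move=> w; have -> : lyap N (fun k => z k w + S k w *m (W k t w - W k s w)) i =
    Q w + B w *+ 2 + G w by exact: lyapD.
have tl := taylor _ _ _ (Q0 w) (G0 w) (lyap_polar_sqr_le N (z^~ w) (g w) i).
apply: le_trans tl _.
have := ler_wpM2l (ltW C10) (F5 w); have := F1 w.
rewrite /A /lin -/(B w); lra.
Qed.

End one_step_moment.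

(** * The continuous extension *)

Section grid.
Variables (R : realType) (T : R) (M : nat).
Hypotheses (T0 : 0 < T) (M0 : (0 < M)%N).
Let g := grid T M.
Let h := step T M.

Let h0 : 0 < h. Proof. by rewrite /h /step divr_gt0// ltr0n. Qed.

Lemma grid0 : g 0 = 0. Proof. by rewrite /g /grid mul0r. Qed.

Lemma gridS n : g n.+1 = g n + h.
Proof. by rewrite /g /grid -natr1 mulrDl mul1r. Qed.

Lemma ler_grid m n : (g m <= g n) = (m <= n)%N.
Proof. by rewrite /g /grid ler_pM2r// ler_nat. Qed.

Lemma ltr_grid m n : (g m < g n) = (m < n)%N.
Proof. by rewrite /g /grid ltr_pM2r// ltr_nat. Qed.

Lemma gridM : g M = T.
Proof. by rewrite /g /grid /step mulrC divfK// pnatr_eq0 -lt0n. Qed.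

Lemma grid_ge0 n : 0 <= g n. Proof. by rewrite -grid0 ler_grid. Qed.

Lemma grid_in n : (n <= M)%N -> g n \in `[0, T].
Proof. by move=> nM; rewrite in_itv/= grid_ge0 -gridM ler_grid. Qed.

Lemma kappa_idxE n s : (n < M)%N -> g n <= s < g n.+1 -> kappa_idx T M s = n.
Proof.
move=> nM /andP[gs sg]; apply/eqP; rewrite /kappa_idx eqn_leq; apply/andP; split.
  apply/bigmax_leqP => k ks; rewrite -ltnS -ltr_grid.
  exact: le_lt_trans ks sg.
exact: (@leq_bigmax_cond _ (fun k : 'I_M => grid T M k <= s) (fun k => k : nat)
  (Ordinal nM) gs).
Qed.

Lemma grid_bracket_lt s : 0 <= s < T -> exists2 n, (n < M)%N & g n <= s < g n.+1.
Proof.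
move=> /andP[s0 sT].
suff : forall k, (k <= M)%N -> s < g k -> exists2 n, (n < M)%N & g n <= s < g n.+1.
  by move/(_ M); apply => //; rewrite gridM.
elim=> [_|k IH kM sk]; first by rewrite grid0 ltNge s0.
have [ks|sk'] := lerP (g k) s; last exact: (IH (ltnW kM)).
by exists k => //; rewrite ks.
Qed.

Lemma grid_bracket t : t \in `[0, T] -> exists2 n, (n < M)%N & g n <= t <= g n.+1.
Proof.
rewrite in_itv/= => /andP[t0]; rewrite le_eqVlt => /predU1P[->|tT].
  (* At t = T the last cell is used with its right endpoint, in accordance with [kappa_idx], which
     stops at M - 1. *)
  exists M.-1; first by rewrite prednK.
  by rewrite prednK// -gridM ler_grid leq_pred lexx.
have [|n nM /andP[gt tg]] := @grid_bracket_lt t; first by rewrite t0.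
by exists n => //; rewrite gt ltW.
Qed.

Lemma kappa_step_fun (phi : nat -> R) s : 0 <= s < T ->
  phi (kappa_idx T M s) = \sum_(k < M) phi k * \1_(`[g k, g k.+1[%classic : set R) s.
Proof.
move=> sT; have [n nM gs] := grid_bracket_lt sT.
rewrite (kappa_idxE nM gs) (bigD1 (Ordinal nM))//= indicE mem_set/=; last by rewrite in_itv.
rewrite mulr1 big1 ?addr0// => k kn; rewrite indicE memNset ?mulr0//=.
rewrite in_itv/= => /andP[h1 h2]; move/eqP: kn; apply; apply: val_inj => /=.
move/andP: gs => [h3 h4]; apply/eqP; rewrite eqn_leq; apply/andP.
by split; rewrite -ltnS -ltr_grid; [exact: le_lt_trans h1 h4|exact: le_lt_trans h3 h2].
Qed.

Lemma Rintegral_kappa (phi : nat -> R) t : t \in `[0, T] ->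
  \int[lebesgue_measure]_(s in `[0, t]) phi (kappa_idx T M s) =
  \sum_(k < M) (Num.min (g k.+1) t - Num.min (g k) t) * phi k.
Proof.
rewrite in_itv/= => /andP[t0 tT].
pose mu := @lebesgue_measure R.
pose A k : set R := `[g k, g k.+1[%classic.
(* At s = T no half-open cell contains s, although [kappa_idx] is M - 1 there. The right endpoint of
   the integral is therefore dropped as a null set. *)
pose D : set R := `[0, t[%classic.
have mD : measurable (D : set (measurableTypeR R)) by exact: measurable_itv.
have eqD : {in D, (fun s => (phi (kappa_idx T M s))%:E) =1
    (fun s => \sum_(k < M) (phi k)%:E * (\1_(A k) s)%:E)%E}.
  move=> s; rewrite inE /D /= in_itv/= => /andP[s0 st].
  rewrite kappa_step_fun; last by rewrite s0 (lt_le_trans st).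
  by rewrite -sumEFin; apply: eq_bigr => k _; rewrite EFinM.
have iA k : mu.-integrable D (fun s => (\1_(A k) s)%:E).
  apply: (integrableS measurableT mD (@subsetT _ _)).
  exact: (@integrable_indic_itv R (g k) (g k.+1) true true).
have iphi : mu.-integrable D (EFin \o (fun s => phi (kappa_idx T M s))).
  apply: (@eq_integrable _ _ _ mu D mD (fun s => \sum_(k < M) (phi k)%:E * (\1_(A k) s)%:E)%E).
    by move=> s sD /=; rewrite eqD.
  by apply: integrable_sum => // k _; exact: integrableZl.
rewrite -Rintegral_itv_bndo_bndc// /Rintegral.
transitivity (fine (\int[mu]_(s in D) (\sum_(k < M) (phi k)%:E * (\1_(A k) s)%:E))%E).
  by congr fine; apply: eq_integral => s sD; exact: eqD.
rewrite (integral_sum mD); last by move=> k; exact: integrableZl.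
have E k : (\int[mu]_(s in D) ((phi k)%:E * (\1_(A k) s)%:E))%E =
    ((Num.min (g k.+1) t - Num.min (g k) t) * phi k)%:E.
  rewrite integralZl// integral_indic//; last exact: measurable_itv.
  have -> : A k `&` D = `[g k, Num.min (g k.+1) t[%classic.
    apply/seteqP; split => x; rewrite /A /D /= !in_itv/= lt_min.
      by move=> [/andP[-> ->] /andP[_ ->]].
    move=> /and3P[gx -> ->]; rewrite gx; split=> //.
    by rewrite andbT (le_trans (grid_ge0 k)).
  have gk : g k < g k.+1 by rewrite ltr_grid.
  rewrite muleC EFinM; congr (_ * _)%E.
  transitivity (lebesgue_measure (`[g k, Num.min (g k.+1) t[%classic : set R)); first by [].
  rewrite lebesgue_measure_itv/= lte_fin lt_min gk/=.
  have [kt|tk] := ltrP (g k) t; first by rewrite EFinB.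
  by rewrite (min_r (le_trans tk (ltW gk))) subrr.
rewrite (eq_bigr (fun k : 'I_M => ((Num.min (g k.+1) t - Num.min (g k) t) * phi k)%:E)).
  by rewrite sumEFin.
by move=> k _; exact: E.
Qed.

End grid.

Section extension.
Context (disp : measure_display) (Omega : measurableType disp) (R : realType).
Variables (d l : nat) (T : R) (M N : nat) (hN : (0 < N)%N).
Hypotheses (T0 : 0 < T) (M0 : (0 < M)%N).
Variables (f : 'cV[R]_d -> 'cV[R]_d) (u : 'cV[R]_d -> P2 R d -> 'cV[R]_d).
Variables (b : R -> 'cV[R]_d -> P2 R d -> 'cV[R]_d).
Variables (sigma : R -> 'cV[R]_d -> P2 R d -> 'M[R]_(d, l)).
Variables (W : nat -> R -> Omega -> 'cV[R]_l) (X0 : nat -> Omega -> 'cV[R]_d).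
Variables (X Y : nat -> nat -> Omega -> 'cV[R]_d).
Hypothesis ssm : is_SSM T f u b sigma W X0 hN M X Y.
Let g := grid T M.
Let h := step T M.
Let mu n w := empirical hN (fun j => Y j n w).

(** Earlier cells telescope to X_n and later ones vanish. On the current cell the implicit equation
    turns v into (Y_n - X_n) / h, so the superlinear term leaves the formula. *)
Lemma SSM_extensionE i n t w : (i < N)%N -> (n < M)%N -> t \in `[0, T] ->
  g n <= t <= g n.+1 ->
  SSM_extension T f u b sigma W X0 hN M Y i t w =
  X i n w + ((t - g n) / h) *: (Y i n w - X i n w)
  + (t - g n) *: b (g n) (Y i n w) (mu n w)
  + sigma (g n) (Y i n w) (mu n w) *m (W i t w - W i (g n) w).
Proof.
move=> iN nM tT /andP[gt tg].
have h0 : 0 < h by rewrite /h /step divr_gt0// ltr0n.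
pose dr k := v_coef f u (Y i k w) (mu k w) + b (g k) (Y i k w) (mu k w).
pose inc k := (Num.min (g k.+1) t - Num.min (g k) t) *: dr k +
   sigma (g k) (Y i k w) (mu k w) *m (W i (Num.min (g k.+1) t) w - W i (Num.min (g k) t) w).
have -> : SSM_extension T f u b sigma W X0 hN M Y i t w = X0 i w + \sum_(k < M) inc k.
  rewrite /SSM_extension -addrA; congr (_ + _); rewrite /inc big_split; congr (_ + _).
  apply/matrixP => k j; rewrite (ord1 j) mxE summxE.
  rewrite (Rintegral_kappa T0 M0 (fun m => dr m k 0) tT).
  by apply: eq_bigr => m _; rewrite [RHS]mxE.
have hv k : (k < M)%N -> h *: v_coef f u (Y i k w) (mu k w) = Y i k w - X i k w.
  by move=> kM; rewrite {2}(ssm_implicit ssm w kM iN) addrAC subrr add0r.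
have stepE k : (k < M)%N -> X i k.+1 w = X i k w + (h *: dr k +
    sigma (g k) (Y i k w) (mu k w) *m (W i (g k.+1) w - W i (g k) w)).
  move=> kM; rewrite (ssm_explicit ssm w kM iN) /dr scalerDr hv//.
  by rewrite [RHS]addrA; congr (_ + _); rewrite addrA subrKC.
have part k : (k <= n)%N -> X0 i w + \sum_(0 <= j < k) inc j = X i k w.
  elim: k => [_|k IH kn]; first by rewrite big_geq// addr0 (ssm_init ssm).
  have kM : (k < M)%N by exact: leq_ltn_trans (ltnW kn) nM.
  rewrite big_nat_recr//= addrA IH ?(ltnW kn)// stepE//; congr (_ + _); rewrite /inc.
  have gk : g k.+1 <= t by apply: le_trans gt; rewrite ler_grid.
  have gk' : g k <= t by apply: le_trans gk; rewrite ler_grid.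
  by rewrite !min_l// [g k.+1]gridS addrAC subrr add0r.
rewrite -(big_mkord predT inc) (big_cat_nat (n := n))//=; last exact: ltnW.
(* For k > n both minima equal t, so these cells contribute neither drift nor noise. *)
rewrite addrA part// big_ltn// big_nat_cond big1 => [|k /andP[/andP[nk kM] _]]; last first.
  have tk : t <= g k by apply: le_trans tg _; rewrite ler_grid.
  have tk' : t <= g k.+1 by apply: le_trans tk _; rewrite ler_grid.
  by rewrite /inc !min_r// subrr subrr scale0r mulmx0 addr0.
rewrite addr0 /inc min_r// min_l// -addrA -addrA; congr (_ + _).
rewrite addrA; congr (_ + _); rewrite /dr scalerDr; congr (_ + _).
by rewrite -hv// scalerA divfK// gt_eqF.
Qed.

End extension.

(** * Moments of the scheme *)

(** The link from mean-square estimates to [lipschitz_measurable], with Lipschitz constant sqrt (C /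
    N) for the sum of the absolute differences of coordinates. *)
Lemma msq_lipschitz_measurable (R : realType) (disp : measure_display)
    (Om : measurableType disp) d N (X : nat -> Om -> 'cV[R]_d) (xi : Om -> R) (C : R) :
  0 <= C ->
  (forall j, (j < N)%N -> forall k, measurable_fun setT (fun w => X j w k 0)) ->
  (forall w w', (xi w - xi w') ^+ 2 <= C * msq N (fun j => X j w - X j w')) ->
  measurable_fun setT xi.
Proof.
move=> C0 mX lip.
apply: (@lipschitz_measurable _ _ _ ('I_N * 'I_d)%type
  (fun q w => X q.1 w q.2 0) xi (Num.sqrt (C * N%:R^-1))) => [q|w w'].
  exact: mX.
have CN : 0 <= C * N%:R^-1 by rewrite mulr_ge0// invr_ge0.
set S := \sum_q _; have S0 : 0 <= S by rewrite sumr_ge0.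
rewrite -ler_sqr ?nnegrE ?mulr_ge0 ?sqrtr_ge0// real_normK ?num_real//.
rewrite exprMn sqr_sqrtr//; apply: le_trans (lip w w') _.
rewrite /msq mulrA ler_wpM2l//.
under eq_bigr do rewrite enorm_sqr_col; rewrite pair_bigA /=.
under eq_bigr do rewrite !mxE.
exact: (sum_sqr_le (fun q : 'I_N * 'I_d => X q.1 w q.2 0 - X q.1 w' q.2 0)).
Qed.

Lemma enorm_le_msq (R : realType) d N (y : nat -> 'cV[R]_d) i : (i < N)%N ->
  enorm (y i) ^+ 2 <= N%:R * msq N y.
Proof.
move=> iN; rewrite /msq mulrA divff ?mul1r; last by rewrite pnatr_eq0 -lt0n (leq_trans _ iN).
by rewrite (bigD1 (Ordinal iN))//= lerDl sumr_ge0// => j _; exact: sqr_ge0.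
Qed.

Section ssm.
Context (disp : measure_display) (Omega : measurableType disp) (R : realType).
Variables (P : probability Omega R) (F : R -> set (set Omega)).
Hypothesis hF : complete_filtration P F.
Variables (d l : nat) (T : R).
Hypothesis T0 : 0 < T.
Variables (f : 'cV[R]_d -> 'cV[R]_d) (u : 'cV[R]_d -> P2 R d -> 'cV[R]_d).
Variables (b : R -> 'cV[R]_d -> P2 R d -> 'cV[R]_d).
Variables (sigma : R -> 'cV[R]_d -> P2 R d -> 'M[R]_(d, l)).
Variables (Lb Lsigma Lu Luhat Lutilde q1 Lf Lfhat q2 : R).
Hypotheses (hb : time_coef_cond T Lb b) (hsigma : time_coef_cond T Lsigma sigma).
Hypotheses (hu : u_cond Lu Luhat Lutilde q1 u) (hf : f_cond Lf Lfhat q2 f).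
Variables (W : nat -> R -> Omega -> 'cV[R]_l) (X0 : nat -> Omega -> 'cV[R]_d).
Hypothesis hW : forall i, brownian_motion P F (W i).
Hypothesis mX0 : forall i k, measurable_wrt (F 0) (fun w => X0 i w k 0).
Let z := zeta Lf Lu Lutilde.

Let z0 : 0 <= z. Proof. by rewrite /z /zeta le_max lexx orbT. Qed.

Section measurability.
Variables (N : nat) (hN : (0 < N)%N) (M : nat) (hM : (0 < M)%N).
Let h := step T M.
Hypothesis hz : h * z <= 1.
Variables X Y : nat -> nat -> Omega -> 'cV[R]_d.
Hypothesis ssm : is_SSM T f u b sigma W X0 hN M X Y.
Let g := grid T M.

Let h0 : 0 < h. Proof. by rewrite /h /step divr_gt0// ltr0n. Qed.

Lemma SSM_implicit_sol n w : (n < M)%N ->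
  implicit_sol f u hN h (fun i => X i n w) (fun i => Y i n w).
Proof. by move=> nM i iN; exact: (ssm_implicit ssm w nM iN). Qed.

Lemma SSM_lipschitz n w w' : (n < M)%N ->
  msq N (fun j => Y j n w - Y j n w')
    <= (1 + h * (3 * z)) * msq N (fun j => X j n w - X j n w').
Proof.
move=> nM; rewrite mulrDl mul1r.
exact: (implicit_total hu hf h0 hz (SSM_implicit_sol w nM) (SSM_implicit_sol w' nM)).
Qed.

(** [is_SSM] imposes equations at each sample point and says nothing of measurability. Comparing the
    solutions at two sample points shows that Y_n varies in a Lipschitz way with X_n. *)
Lemma SSM_Y_measurable n i k : (n < M)%N -> (i < N)%N ->
  (forall j, (j < N)%N -> forall k, measurable_wrt (F (g n)) (fun w => X j n w k 0)) ->
  measurable_wrt (F (g n)) (fun w => Y i n w k 0).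
Proof.
move=> nM iN mX; apply: (msq_lipschitz_measurable
  (C := N%:R * (1 + h * (3 * z))) _ mX) => [|w w'].
  by rewrite mulr_ge0// addr_ge0// !mulr_ge0// ltW.
apply: (@le_trans _ _ (enorm (Y i n w - Y i n w') ^+ 2)).
  have := enorm_entry (Y i n w - Y i n w') k 0.
  rewrite !mxE => e; rewrite -(real_normK (num_real (Y i n w k 0 - Y i n w' k 0))).
  by rewrite ler_sqr ?nnegrE ?enorm_ge0.
apply: le_trans (enorm_le_msq (fun i => Y i n w - Y i n w') iN) _.
by rewrite -mulrA ler_wpM2l// SSM_lipschitz.
Qed.

(** The whole composition is Lipschitz in X_n, which bypasses the measurability of the map from w to
    the empirical measure. *)
Lemma SSM_coef_measurable m m' L (c : R -> 'cV[R]_d -> P2 R d -> 'M[R]_(m, m')) n i k k' :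
  time_coef_cond T L c -> (n < M)%N -> (i < N)%N ->
  (forall j, (j < N)%N -> forall k, measurable_wrt (F (g n)) (fun w => X j n w k 0)) ->
  measurable_wrt (F (g n))
    (fun w => c (g n) (Y i n w) (empirical hN (fun j => Y j n w)) k k').
Proof.
move=> hc nM iN mX; have [_ _ L0 _] := hc.
apply: (msq_lipschitz_measurable
  (C := L * ((N%:R + 1) * (1 + h * (3 * z)))) _ mX) => [|w w'].
  by rewrite mulr_ge0// mulr_ge0 ?addr_ge0// !mulr_ge0// ltW.
set A := c _ _ _; set A' := c _ _ _.
apply: (@le_trans _ _ (enorm (A - A') ^+ 2)).
  have := enorm_entry (A - A') k k'.
  rewrite !mxE => e; rewrite -(real_normK (num_real (A k k' - A' k k'))).
  by rewrite ler_sqr ?nnegrE ?enorm_ge0.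
apply: le_trans (time_coef_lip hc _ _ _ _ _ (grid_in T0 hM (ltnW nM))) _.
rewrite -[leRHS]mulrA ler_wpM2l// -mulrA.
apply: (@le_trans _ _ ((N%:R + 1) * msq N (fun j => Y j n w - Y j n w'))).
  by rewrite mulrDl mul1r lerD2r; exact: (enorm_le_msq (fun i => Y i n w - Y i n w') iN).
by rewrite ler_wpM2l ?addr_ge0// SSM_lipschitz.
Qed.

Lemma SSM_X_measurable n i k : (n <= M)%N -> (i < N)%N ->
  measurable_wrt (F (g n)) (fun w => X i n w k 0).
Proof.
elim: n i k => [i k _ iN|n IH i k nM iN].
  rewrite /g grid0; under eq_fun do rewrite (ssm_init ssm)//; exact: mX0.
have mX j : (j < N)%N -> forall k, measurable_wrt (F (g n)) (fun w => X j n w k 0).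
  by move=> jN k'; apply: IH => //; exact: ltnW.
have gn0 : 0 <= g n by exact: grid_ge0.
have gnn : g n <= g n.+1 by rewrite ler_grid.
have FF := cf_mono hF gn0 gnn.
rewrite /measurable_wrt; under eq_fun do rewrite (ssm_explicit ssm _ nM iN) !mxE.
apply: measurable_funD; first apply: measurable_funD.
- exact: (measurable_wrtS FF (SSM_Y_measurable k nM iN mX)).
- apply: measurable_funM => //.
  exact: (measurable_wrtS FF (SSM_coef_measurable k 0 hb nM iN mX)).
apply: measurable_sum => j; apply: measurable_funM.
  exact: (measurable_wrtS FF (SSM_coef_measurable k j hsigma nM iN mX)).
under eq_fun do rewrite !mxE; apply: measurable_funB.
  exact: (brownian_entry_measurable_wrt hF (hW i)) (le_trans gn0 gnn) (lexx _).
exact: (brownian_entry_measurable_wrt hF (hW i)).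
Qed.

End measurability.

Variable p : R.
Hypothesis p1 : 1 <= p.

Lemma SSM_moment : exists2 C : R, 0 <= C &
  forall N (hN : (0 < N)%N) M (hM : (0 < M)%N), step T M <= 1 -> step T M * z <= 1 ->
  forall X Y, is_SSM T f u b sigma W X0 hN M X Y ->
  forall K0, (forall i, (i < N)%N -> mean_le P (fun w => lyap N (X0^~ w) i `^ p) K0) ->
  forall n i, (n <= M)%N -> (i < N)%N ->
  mean_le P (fun w => lyap N (fun k => X k n w) i `^ p) (C * (1 + K0)).
Proof.
have [c1 c10 imp] := implicit_lyap hu hf.
have [c2 c20 dri] := drift_lyap T0 hb.
have [Cs Cs0 gro] := time_coef_growth T0 hsigma.
(* [cz] is the constant of [growth_trans] for the implicit step followed by the drift. [cs] comes
   from 1 + |Y|^2 + msq Y <= 1 + 3 lyap Y, where lyap Y is at most a + c1 (1 + a). *)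
pose cz := c1 + c2 + c1 * c2; have cz0 : 0 <= cz by rewrite !addr_ge0// mulr_ge0.
pose cs := Cs * (3 + 3 * c1).
have cs0 : 0 <= cs by rewrite mulr_ge0// addr_ge0// mulr_ge0.
have [C C0 onestep] := one_step_moment hF d l p1 (addr_ge0 cz0 cs0).
exists (expR (C * T)); first exact: expR_ge0.
move=> N hN M hM h1 hz X Y ssm K0 init n i nM iN.
set h := step T M in h1 hz *; have h0 : 0 < h by rewrite /h /step divr_gt0// ltr0n.
have hh : 0 < h <= 1 by rewrite h0.
have hh' : 0 <= h <= 1 by rewrite ltW.
have K00 : 0 <= K0 := mean_le_bound_ge0 (init i iN).
(* The recursion K to K + h C (1 + K) multiplies 1 + K by 1 + h C, hence this closed form; n h <= T
   then bounds the power by exp (C T). *)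
suff {i iN} key i : (i < N)%N -> mean_le P (fun w => lyap N (fun k => X k n w) i `^ p)
    ((1 + h * C) ^+ n * (1 + K0) - 1).
  apply: mean_leW (key i iN).
  apply: (@le_trans _ _ ((1 + h * C) ^+ n * (1 + K0))); first by rewrite gerBl.
  rewrite ler_wpM2r ?addr_ge0//.
  apply: (@le_trans _ _ (expR (h * C) ^+ n)).
    by apply: lerXn2r; rewrite ?nnegrE ?expR_ge0 ?expR_ge1Dx// addr_ge0// mulr_ge0// ltW.
  rewrite -expRM_natl ler_expR mulrA [leRHS]mulrC ler_wpM2r//.
  by have := grid_in T0 hM nM; rewrite in_itv/= => /andP[].
elim: n nM i => [_ i iN|n IH nM i iN].
  rewrite expr0 mul1r addrAC subrr add0r.
  rewrite (_ : (fun w => _) = (fun w => lyap N (X0^~ w) i `^ p)); first exact: init.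
  apply/funext => w; congr (_ `^ _); rewrite /lyap; congr (_ * _).
  by apply: eq_bigr => k _; rewrite !(ssm_init ssm).
have {}IH := IH (ltnW nM).
have mX j : (j < N)%N -> forall k, measurable_wrt (F (grid T M n)) (fun w => X j n w k 0).
  by move=> jN k; apply: (SSM_X_measurable hM hz ssm) => //; exact: ltnW.
pose mu w := empirical hN (fun j => Y j n w).
pose zz k w := Y k n w + h *: b (grid T M n) (Y k n w) (mu w).
pose S k w := sigma (grid T M n) (Y k n w) (mu w).
pose a k w := lyap N (fun k => X k n w) k.
have gT : grid T M n \in `[0, T] by apply: grid_in => //; exact: ltnW.
have g0 : 0 <= grid T M n by exact: grid_ge0.
have glt : grid T M n < grid T M n.+1 by rewrite ltr_grid.
have gE : grid T M n.+1 - grid T M n = h by rewrite gridS addrAC subrr add0r.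
have a0 k w : 0 <= a k w by exact: lyap_ge0.
have ya k w : (k < N)%N -> lyap N (fun k => Y k n w) k <= a k w + h * (c1 * (1 + a k w)).
  by move=> kN; exact: (imp N hN h hh hz _ _ (SSM_implicit_sol ssm w nM)).
have := onestep N hN W hW _ _ g0 glt _ zz S a _ _ _ _ a0 _ _ IH i iN.
rewrite gE; set K := (1 + h * C) ^+ n * (1 + K0) - 1.
have -> : K + h * (C * (1 + K)) = (1 + h * C) ^+ n.+1 * (1 + K0) - 1.
  by rewrite /K exprS; ring.
have -> : (fun w => lyap N (fun k => zz k w +
      S k w *m (W k (grid T M n.+1) w - W k (grid T M n) w)) i `^ p)
   = (fun w => lyap N (fun k => X k n.+1 w) i `^ p).
  apply/funext => w; congr (_ `^ _); rewrite /lyap; congr (_ * _).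
  by apply: eq_bigr => k _; rewrite !(ssm_explicit ssm w nM).
apply.
- by rewrite -lerBlDl gE.
- move=> k kN j; rewrite /measurable_wrt /zz; under eq_fun do rewrite !mxE.
  apply: measurable_funD; first exact: (SSM_Y_measurable hM hz ssm).
  apply: measurable_funM => //.
  exact: (SSM_coef_measurable hM hz ssm j 0 hb nM kN mX).
- move=> k kN j j'; exact: (SSM_coef_measurable hM hz ssm j j' hsigma nM kN mX).
- by move=> k kN; apply: measurable_lyap => // k' k'N j; exact: mX.
- move=> k w kN.
  have := growth_trans hh' c10 c20 (a0 k w) (ya k w kN)
    (dri N hN h (grid T M n) (fun k => Y k n w) k hh gT).
  rewrite -/cz => e; apply: le_trans e _; rewrite lerD2l ler_wpM2l ?(ltW h0)//.
  by rewrite ler_wpM2r ?addr_ge0// lerDl.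
- move=> k w kN; apply: le_trans (gro _ _ _ hN (fun j => Y j n w) gT) _.
  have e1 := enorm_le_lyap hN (fun j => Y j n w) k.
  have e2 := msq_le_lyap N (fun j => Y j n w) k.
  have e3 := ya k w kN.
  have e4 : h * (c1 * (1 + a k w)) <= c1 * (1 + a k w).
    by rewrite ler_piMl// mulr_ge0// addr_ge0.
  apply: (@le_trans _ _ (cs * (1 + a k w))).
    by rewrite /cs -mulrA ler_wpM2l//; have := a0 k w; lra.
  by rewrite ler_wpM2r ?addr_ge0// lerDr.
Qed.

(** The squared norm is at most c (1 + a)(1 + beta), with a known at the grid point before t and
    beta the squared increment since then. Independence factorises the p-th moment. *)
Lemma SSM_extension_moment : exists2 C : R, 0 <= C &
  forall N (hN : (0 < N)%N) M (hM : (0 < M)%N), step T M <= 1 -> step T M * z <= 1 ->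
  forall X Y, is_SSM T f u b sigma W X0 hN M X Y ->
  forall K, (forall n i, (n <= M)%N -> (i < N)%N ->
    mean_le P (fun w => lyap N (fun k => X k n w) i `^ p) K) ->
  forall i t, (i < N)%N -> t \in `[0, T] ->
  mean_le P (fun w => (enorm (SSM_extension T f u b sigma W X0 hN M Y i t w) ^+ 2) `^ p)
    (C * (1 + K)).
Proof.
have [c1 c10 imp] := implicit_lyap hu hf.
have [Cb Cb0 grob] := time_coef_growth T0 hb.
have [Cs Cs0 gros] := time_coef_growth T0 hsigma.
have [C3 C30 incr] := brownian_incr_moment hF l p1.
have p0 : 0 <= p by exact: le_trans p1.
(* Each splitting of a squared norm costs a factor 2. The factor 4 + 3 c1 bounds 1 + |Y|^2 + msq Y
   <= 1 + 3 (1 + c1)(1 + a) by a multiple of 1 + a. *)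
pose c := 16 + 16 * (1 + c1) + 4 * (Cb * (4 + 3 * c1)) + 2 * (Cs * (4 + 3 * c1)).
have cc : 0 <= 1 + c1 by rewrite addr_ge0.
have c30 : 0 <= 4 + 3 * c1 by rewrite addr_ge0// mulr_ge0.
have Cbc := mulr_ge0 Cb0 c30; have Csc := mulr_ge0 Cs0 c30.
have c0 : 0 <= c by rewrite /c; lra.
pose k2 : R := 2 `^ p; have k20 : 0 <= k2 by exact: powR_ge0.
have k0 : 0 <= c `^ p * (k2 * k2) by rewrite mulr_ge0 ?powR_ge0// mulr_ge0.
exists (c `^ p * (k2 * k2) * (1 + C3)); first by rewrite mulr_ge0// addr_ge0.
move=> N hN M hM h1 hz X Y ssm K XK i t iN tT.
set h := step T M in h1 hz *; have h0 : 0 < h by rewrite /h /step divr_gt0// ltr0n.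
have hh : 0 < h <= 1 by rewrite h0.
have [n nM gtg] := grid_bracket T0 hM tT; have /andP[gt tg] := gtg.
have extE w := SSM_extensionE T0 hM ssm w iN nM tT gtg.
set gn := grid T M n in gt tg gtg extE *.
have gT : gn \in `[0, T] by apply: grid_in => //; exact: ltnW.
have gn0 : 0 <= gn by exact: grid_ge0.
have tgh : t - gn <= h by move: tg; rewrite gridS -/gn lerBlDl.
have tg0 : 0 <= t - gn by rewrite subr_ge0.
pose th := (t - gn) / h.
have th0 : 0 <= th by rewrite divr_ge0// ltW.
have th1 : th <= 1 by rewrite ler_pdivrMr// mul1r.
have sq1 (x : R) : 0 <= x -> x <= 1 -> x ^+ 2 <= 1.
  by move=> x0 x1; rewrite expr2 mulr_ile1.
pose a w := lyap N (fun k => X k n w) i.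
pose mu w := empirical hN (fun j => Y j n w).
pose beta w := enorm (W i t w - W i gn w) ^+ 2.
have a0 w : 0 <= a w by exact: lyap_ge0.
have beta0 w : 0 <= beta w by exact: sqr_ge0.
have bound w : enorm (SSM_extension T f u b sigma W X0 hN M Y i t w) ^+ 2
    <= c * ((1 + a w) * (1 + beta w)).
  have e1 : enorm (X i n w) ^+ 2 <= 2 * a w by exact: (enorm_le_lyap hN (fun j => X j n w) i).
  have ly : lyap N (fun j => Y j n w) i <= (1 + c1) * (1 + a w).
    apply: le_trans (imp N hN h hh hz _ _ (SSM_implicit_sol ssm w nM) i iN) _.
    rewrite -/(a w) mulrDl mul1r lerD ?lerDr// ler_piMl ?mulr_ge0 ?addr_ge0//.
  have e2 := enorm_le_lyap hN (fun j => Y j n w) i; rewrite /= in e2.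
  have e3 := msq_le_lyap N (fun j => Y j n w) i.
  have e4 := grob gn (Y i n w) N hN (fun j => Y j n w) gT.
  have e5 := gros gn (Y i n w) N hN (fun j => Y j n w) gT.
  pose B := (4 + 3 * c1) * (1 + a w).
  have B0 : 0 <= B by rewrite mulr_ge0// addr_ge0.
  have e6 : 1 + enorm (Y i n w) ^+ 2 + msq N (fun j => Y j n w) <= B.
    rewrite /B; have := a0 w; lra.
  have {}e4 := le_trans e4 (ler_wpM2l Cb0 e6).
  have {}e5 := le_trans e5 (ler_wpM2l Cs0 e6).
  rewrite extE -/(mu w); set x := X i n w in e1 *; set y := Y i n w in e2 e4 e5 *.
  have {}e2 : enorm y ^+ 2 <= 2 * ((1 + c1) * (1 + a w)).
    by apply: le_trans e2 _; rewrite ler_wpM2l.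
  have e7 : enorm (x + th *: (y - x)) ^+ 2 <= 2 * enorm x ^+ 2 + 2 * enorm y ^+ 2.
    have -> : x + th *: (y - x) = (1 - th) *: x + th *: y.
      by rewrite scalerBr scalerBl scale1r addrA addrAC.
    apply: le_trans (enorm_sqrD _ _) _; rewrite !enorm_sqrZ.
    by apply: lerD; rewrite ler_wpM2l// ler_piMl ?sqr_ge0// sq1 ?subr_ge0// gerBl.
  have e8 : enorm ((t - gn) *: b gn y (mu w)) ^+ 2 <= Cb * B.
    rewrite enorm_sqrZ; apply: le_trans e4; rewrite ler_piMl ?sqr_ge0// sq1//.
    exact: le_trans tgh h1.
  have e9 : enorm (sigma gn y (mu w) *m (W i t w - W i gn w)) ^+ 2 <= Cs * B * beta w.
    by apply: le_trans (enorm_sqrM_le _ _) _; rewrite ler_wpM2r ?sqr_ge0.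
  have e10 := enorm_sqrD (x + th *: (y - x) + (t - gn) *: b gn y (mu w))
    (sigma gn y (mu w) *m (W i t w - W i gn w)).
  have e11 := enorm_sqrD (x + th *: (y - x)) ((t - gn) *: b gn y (mu w)).
  apply: le_trans e10 _.
  apply: (@le_trans _ _
      ((16 + 16 * (1 + c1)) * (1 + a w) + 4 * (Cb * B) + 2 * (Cs * B * beta w))).
    have := a0 w; lra.
  have P1 : 0 <= (16 + 16 * (1 + c1) + 4 * (Cb * (4 + 3 * c1))) * (1 + a w) * beta w.
    apply: mulr_ge0 => //; apply: mulr_ge0; [lra|exact: addr_ge0].
  have P2 : 0 <= Cs * B by exact: mulr_ge0.
  move: P1 P2; rewrite /c /B; lra.
have a_mean : mean_le P (fun w => a w `^ p) K by apply: XK => //; exact: ltnW.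
have K0 := mean_le_bound_ge0 a_mean.
pose eta w := beta w + beta w `^ p.
have eta0 w : 0 <= eta w by rewrite addr_ge0// powR_ge0.
have mX j : (j < N)%N -> forall k, measurable_wrt (F gn) (fun w => X j n w k 0).
  by move=> jN k; apply: (SSM_X_measurable hM hz ssm) => //; exact: ltnW.
have t0 : 0 <= t by move: tT; rewrite in_itv/= => /andP[].
have mW s k : 0 <= s -> measurable_fun setT (fun w => W i s w k 0).
  by move=> s0; exact: (measurable_brownian_entry hF (hW i)).
have mbeta : measurable_fun setT beta.
  rewrite /beta; under eq_fun do rewrite enorm_sqr_col.
  apply: measurable_sum => j; apply: measurable_funX; under eq_fun do rewrite !mxE.
  by apply: measurable_funB; exact: mW.
have meta : measurable_fun setT eta.
  by apply: measurable_funD => //; exact: (measurableT_comp (measurable_powR p)).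
have eta_mean : mean_le P eta C3.
  apply: (@mean_leW _ _ _ _ _ (C3 * (t - gn))).
    by rewrite ler_piMr//; exact: le_trans tgh h1.
  split=> //; apply: incr => //; rewrite -subr_ge0 tg0/= -lerBlDl.
  exact: le_trans tgh h1.
have rho_mean : mean_le P (fun w => 1 + a w `^ p) (1 + K).
  by apply: mean_leD => //; exact: mean_le_cst.
have prod_mean : mean_le P (fun w => (1 + a w `^ p) * (1 + eta w)) ((1 + K) * (1 + C3)).
  (* Independence of the increment is available for positive time only; at a grid point the
     increment is 0 and so is [eta]. *)
  move: gt; rewrite le_eqVlt => /predU1P[gt|gt].
    have -> : (fun w => (1 + a w `^ p) * (1 + eta w)) = (fun w => 1 + a w `^ p).
      apply/funext => w; rewrite /eta /beta gt subrr enorm0 expr0n/=.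
      rewrite powR0 ?gt_eqF ?(lt_le_trans ltr01)//.
      by rewrite !addr0 mulr1.
    apply: mean_leW rho_mean; rewrite ler_peMr ?addr_ge0//.
    by rewrite lerDl.
  apply: mean_leM_indep => //; last by apply: mean_leD => //; exact: mean_le_cst.
  apply: (brownian_indep_rv hF (hW i) gn0 gt (g := fun x : borel R l =>
    1 + (enorm (x : 'cV[R]_l) ^+ 2 + (enorm (x : 'cV[R]_l) ^+ 2) `^ p))).
    apply: measurable_funD => //; apply: (measurableT_comp (measurable_powR p)).
    by apply: measurable_lyap => // j jN k; exact: mX.
  have me : measurable_fun setT (fun x : borel R l => enorm (x : 'cV[R]_l) ^+ 2).
    by apply: measurable_funX; exact: measurable_enorm.
  apply: measurable_funD => //; apply: measurable_funD => //.
  exact: (measurableT_comp (measurable_powR p) me).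
have dom := mean_leZ k0 prod_mean.
apply: (@mean_leW _ _ _ _ _ (c `^ p * (k2 * k2) * ((1 + K) * (1 + C3)))).
  by rewrite -[leRHS]mulrA [(1 + C3) * _]mulrC.
apply: mean_le_dom dom.
  have Fm := cf_sub hF gn0.
  apply: (measurableT_comp (measurable_powR p)).
  under eq_fun do rewrite enorm_sqr_col; apply: measurable_sum => k; apply: measurable_funX.
  under eq_fun do rewrite extE !mxE.
  have mX' : measurable_fun setT (fun w => X i n w k 0).
    by apply: (measurable_wrt_fun Fm); exact: mX.
  have mY : measurable_fun setT (fun w => Y i n w k 0).
    by apply: (measurable_wrt_fun Fm); exact: (SSM_Y_measurable hM hz ssm k nM iN mX).
  apply: measurable_funD; first apply: measurable_funD.
  - apply: measurable_funD => //; apply: measurable_funM => //; exact: measurable_funB.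
  - apply: measurable_funM => //; apply: (measurable_wrt_fun Fm).
    exact: (SSM_coef_measurable hM hz ssm k 0 hb nM iN mX).
  apply: measurable_sum => j; apply: measurable_funM.
    apply: (measurable_wrt_fun Fm).
    exact: (SSM_coef_measurable hM hz ssm k j hsigma nM iN mX).
  by under eq_fun do rewrite !mxE; apply: measurable_funB; exact: mW.
move=> w; rewrite powR_ge0/=.
apply: (@le_trans _ _ ((c * ((1 + a w) * (1 + beta w))) `^ p)).
  apply: ge0_ler_powR; rewrite ?nnegrE ?sqr_ge0// mulr_ge0// mulr_ge0 ?addr_ge0//.
have A1 : 0 <= 1 + a w by rewrite addr_ge0.
have B1 : 0 <= 1 + beta w by rewrite addr_ge0.
rewrite (powRM p c0 (mulr_ge0 A1 B1)) (powRM p A1 B1) -mulrA ler_wpM2l ?powR_ge0// mulrACA.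
have pD1 x : 0 <= x -> (1 + x) `^ p <= k2 * (1 + x `^ p).
  by move=> x0; apply: le_trans (powRD_le p1 _ _) _ => //; rewrite powR1.
apply: ler_pM; rewrite ?powR_ge0 ?pD1//.
apply: le_trans (pD1 _ (beta0 w)) _; rewrite ler_wpM2l// lerD2l /eta lerDr//.
Qed.

Lemma lyap_initial_moment N (x : nat -> Omega -> 'cV[R]_d) K : (0 < N)%N ->
  (forall i k, measurable_fun setT (fun w => x i w k 0)) ->
  (forall i, mean_le P (fun w => (enorm (x i w) ^+ 2) `^ p) K) ->
  forall i, (i < N)%N ->
  mean_le P (fun w => lyap N (x^~ w) i `^ p) (2 `^ p * (2 `^ p + 3 `^ p) * K).
Proof.
move=> hN mx xK i iN; have p0 : 0 <= p by exact: le_trans p1.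
have dom : mean_le P (fun w => 2 `^ p * (2 `^ p * (enorm (x i w) ^+ 2) `^ p +
    3 `^ p * (N%:R^-1 * \sum_(k < N) (enorm (x k w) ^+ 2) `^ p)))
    (2 `^ p * (2 `^ p * K + 3 `^ p * K)).
  apply: mean_leZ; first exact: powR_ge0.
  apply: mean_leD; apply: mean_leZ; rewrite ?powR_ge0//.
  by apply: mean_le_avg.
rewrite -mulrA mulrDl; apply: mean_le_dom dom.
  apply: (measurableT_comp (measurable_powR p)).
  by apply: measurable_lyap.
move=> w; rewrite powR_ge0/=.
apply: (@le_trans _ _ ((2 * enorm (x i w) ^+ 2 + 3 * msq N (x^~ w)) `^ p)).
  apply: ge0_ler_powR; rewrite ?nnegrE ?lyap_ge0//; last exact: lyap_le.
  by apply: addr_ge0; apply: mulr_ge0; rewrite ?sqr_ge0 ?msq_ge0.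
have E0 : 0 <= enorm (x i w) ^+ 2 by exact: sqr_ge0.
have M0 := msq_ge0 N (x^~ w).
apply: le_trans (powRD_le p1 (mulr_ge0 (ler0n _ 2) E0) (mulr_ge0 (ler0n _ 3) M0)) _.
rewrite ler_wpM2l ?powR_ge0// (powRM p (ler0n R 2) E0) (powRM p (ler0n R 3) M0).
rewrite lerD2l ler_wpM2l ?powR_ge0//.
by apply: (powR_avg p1 hN (t := fun k : 'I_N => enorm (x k w) ^+ 2)) => k; exact: sqr_ge0.
Qed.

End ssm.

(** * Step-size condition, initial condition and conclusion *)

Lemma enorm_powR2 (R : realType) d (x : 'cV[R]_d) (p : R) :
  enorm x `^ (2 * p) = (enorm x ^+ 2) `^ p.
Proof. by rewrite powRrM powR_mulrn// enorm_ge0. Qed.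

(** The inverse of 0 in the extended reals is +oo, so the convention 1 / zeta = oo is built in and
    zeta = 0 is a case of its own. *)
Lemma step_zeta_le (R : realType) (Lf Lu Lutilde h : R) :
  (0 < h%:E < Order.min 1 (zeta Lf Lu Lutilde)%:E^-1)%E ->
  h <= 1 /\ h * zeta Lf Lu Lutilde <= 1.
Proof.
set z := zeta _ _ _; have z0 : 0 <= z by rewrite /z /zeta le_max lexx orbT.
move=> /andP[h0]; rewrite lt_min => /andP[h1 hz]; split.
  by rewrite -lee_fin ltW.
have [->|zn0] := eqVneq z 0; first by rewrite mulr0.
have z_gt0 : 0 < z by rewrite lt_neqAle eq_sym zn0.
move: hz; rewrite inver (negbTE zn0) lte_fin => /ltW hz.
by rewrite -ler_pdivlMr// mul1r.
Qed.

Section initial_condition.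
Context (disp : measure_display) (Omega : measurableType disp) (R : realType).
Variables (P : probability Omega R) (F : R -> set (set Omega)).
Hypothesis hF : complete_filtration P F.
Variables (d : nat) (X0 : nat -> Omega -> 'cV[R]_d) (m : R).
Hypotheses (hX0 : iid P X0) (hX0m : forall i, in_L0 P F m (X0 i)).

Lemma initial_measurable_wrt i k : measurable_wrt (F 0) (fun w => X0 i w k 0).
Proof.
apply/measurable_wrtP; first exact: (cf_sigma hF).
move=> B mB; have [sub _] := hX0m i; apply: sub.
exists ((fun x : borel R d => (x : 'cV[R]_d) k 0) @^-1` B) => //.
by rewrite -[_ @^-1` _]setTI; exact: measurable_entry.
Qed.

Lemma measurable_initial i : measurable_fun setT (X0 i : Omega -> borel R d).
Proof.
move=> _ B mB; rewrite setTI; apply: (cf_sub hF (lexx 0)).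
by have [sub _] := hX0m i; apply: sub; exists B.
Qed.

Lemma initial_moment_eq (phi : borel R d -> R) i j : measurable_fun setT phi ->
  (forall x, 0 <= phi x) ->
  (\int[P]_w (phi (X0 i w))%:E = \int[P]_w (phi (X0 j w))%:E)%E.
Proof.
move=> mphi phi0.
pose Z k : {RV P >-> borel R d} := HB.pack (X0 k : Omega -> borel R d)
  (isMeasurableFun.Build _ _ _ _ _ (measurable_initial k)).
have mephi := (measurable_EFinP _ phi).2 mphi.
have E k : (\int[P]_w (phi (X0 k w))%:E = \int[distribution P (Z k)]_x (phi x)%:E)%E.
  by rewrite ge0_integral_distribution// => y; rewrite lee_fin.
rewrite !E; apply: eq_measure_integral => A mA _; exact: hX0.2.
Qed.

(** |x|^(2p) <= 1 + |x|^m for one particle, and equality of laws for the others: K serves all i at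
    once and hence every N. *)
Lemma initial_moment (p : R) : 1 <= p -> 2 * p <= m -> exists K, forall i,
  mean_le P (fun w => (enorm (X0 i w) ^+ 2) `^ p) K.
Proof.
move=> p1 pm.
pose phi (x : borel R d) := (enorm (x : 'cV[R]_d) ^+ 2) `^ p.
have mn : measurable_fun setT (fun x : borel R d => enorm (x : 'cV[R]_d)).
  exact: measurable_enorm.
have mphi : measurable_fun setT phi.
  by apply: (measurableT_comp (measurable_powR p)); exact: measurable_funX.
have phi0 x : 0 <= phi x by exact: powR_ge0.
have mX i : measurable_fun setT (phi \o X0 i).
  by apply: (measurableT_comp mphi); exact: measurable_initial.
have [_ fin0] := hX0m 0%N; rewrite unlock in fin0.
have m0 : mean_le P (fun w => enorm (X0 0%N w) `^ m)
    (fine (\int[P]_w (enorm (X0 0%N w) `^ m)%:E)).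
  split.
  - apply: (measurableT_comp (measurable_powR m)).
    exact: (measurableT_comp mn (measurable_initial 0%N)).
  - by move=> w; exact: powR_ge0.
  rewrite fineK// ge0_fin_numE//.
  by apply: integral_ge0 => w _; rewrite lee_fin powR_ge0.
have m1 := mean_leD (mean_le_cst P ler01) m0.
exists (1 + fine (\int[P]_w (enorm (X0 0%N w) `^ m)%:E)) => i.
have [_ _ b0] : mean_le P (phi \o X0 0%N) (1 + fine (\int[P]_w (enorm (X0 0%N w) `^ m)%:E)).
  apply: mean_le_dom (mX 0%N) _ m1 => w; rewrite phi0/= /phi -enorm_powR2.
  have [e1|e1] := lerP (enorm (X0 0%N w)) 1.
    apply: (@le_trans _ _ 1); last by rewrite lerDl powR_ge0.
    apply: (@le_trans _ _ (1 `^ (2 * p))); last by rewrite powR1.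
    by apply: ge0_ler_powR; rewrite ?nnegrE ?enorm_ge0//; lra.
  by apply: ler_wpDl => //; apply: ler_powR => //; exact: ltW.
split; [exact: mX|by move=> w; exact: phi0|].
by rewrite (initial_moment_eq i 0%N mphi phi0).
Qed.

End initial_condition.

Theorem theorem2p10
  (R : realType) (d l : nat) (hd : (0 < d)%N) (hl : (0 < l)%N)
  (T : R) (hT : 0 < T)
  (disp : measure_display) (Omega : measurableType disp)
  (P : probability Omega R) (F : R -> set (set Omega))
  (hF : complete_filtration P F)
  (W : nat -> R -> Omega -> 'cV[R]_l)
  (hW : independent_brownian_motions P F W)
  (f : 'cV[R]_d -> 'cV[R]_d)
  (u : 'cV[R]_d -> P2 R d -> 'cV[R]_d)
  (b : R -> 'cV[R]_d -> P2 R d -> 'cV[R]_d)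
  (sigma : R -> 'cV[R]_d -> P2 R d -> 'M[R]_(d, l))
  (Lb Lsigma Lu Luhat Lutilde q1 Lf Lfhat q2 : R)
  (hb : time_coef_cond T Lb b)
  (hsigma : time_coef_cond T Lsigma sigma)
  (hu : u_cond Lu Luhat Lutilde q1 u)
  (hf : f_cond Lf Lfhat q2 f)
  (m p : R) (hm : 2 <= m) (hp : 2 <= 2 * p <= m)
  (X0 : nat -> Omega -> 'cV[R]_d)
  (hX0 : iid P X0) (hX0m : forall i, in_L0 P F m (X0 i)) :
  exists2 C : R, 0 < C &
    forall (N : nat) (hN : (0 < N)%N) (M : nat) (hM : (0 < M)%N),
      (0 < (step T M)%:E < Order.min 1 (zeta Lf Lu Lutilde)%:E^-1)%E ->
      forall X Y : nat -> nat -> Omega -> 'cV[R]_d,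
        is_SSM T f u b sigma W X0 hN M X Y ->
        (ereal_sup [set ereal_sup
            [set 'E_P[(fun w =>
                enorm (SSM_extension T f u b sigma W X0 hN M Y i t w)
                  `^ (2 * p))%R]
            | t in `[0%R, T]] | i in `I_N]
          <= C%:E * (1 + 'E_P[(fun w => enorm (X0 0%N w) `^ (2 * p))%R])
          < +oo)%E.
Proof.
have p1 : 1 <= p by move: hp => /andP[+ _]; lra.
have pm : 2 * p <= m by move: hp => /andP[].
have hWi := hW.1.
have mX0 := initial_measurable_wrt hF hX0m.
have mX0' i k : measurable_fun setT (fun w => X0 i w k 0).
  by apply: (measurable_wrt_fun (cf_sub hF (lexx 0))); exact: mX0.
have [K0 init] := initial_moment hF hX0 hX0m p1 pm.
have [C1 C10 mom] := SSM_moment hF hT hb hsigma hu hf hWi mX0 p1.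
have [C2 C20 ext] := SSM_extension_moment hF hT hb hsigma hu hf hWi mX0 p1.
pose K1 := 2 `^ p * (2 `^ p + 3 `^ p) * K0.
pose C := C2 * (1 + C1 * (1 + K1)).
have K00 : 0 <= K0 := mean_le_bound_ge0 (init 0%N).
have K10 : 0 <= K1 by rewrite !mulr_ge0 ?addr_ge0 ?powR_ge0.
have C0 : 0 <= C by rewrite mulr_ge0// addr_ge0// mulr_ge0// addr_ge0.
(* C contains the bound [K0] on the initial moment, so it dominates the left-hand side by itself; on
   the right it remains to use that 1 + E is at least 1. The added 1 makes the constant positive. *)
exists (1 + C); first by rewrite ltr_wpDr.
move=> N hN M hM /step_zeta_le[h1 hz] X Y ssm.
have E0 : (0 <= 'E_P[(fun w => enorm (X0 0%N w) `^ (2 * p))%R])%E.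
  by apply: expectation_ge0 => w; exact: powR_ge0.
have Efin : ('E_P[(fun w => enorm (X0 0%N w) `^ (2 * p))%R] <= K0%:E)%E.
  rewrite unlock; under eq_integral do rewrite enorm_powR2.
  by have [] := init 0%N.
apply/andP; split; last first.
  apply: (@le_lt_trans _ _ ((1 + C)%:E * (1 + K0%:E))%E).
    by rewrite lee_wpmul2l ?lee_fin ?addr_ge0// leeD2l.
  by rewrite -EFinD -EFinM ltry.
apply: (@le_trans _ _ C%:E).
  apply: ge_ereal_sup => _ [i iN <-]; apply: ge_ereal_sup => _ [t tT <-].
  have lyapK : forall j, (j < N)%N -> mean_le P (fun w => lyap N (X0^~ w) j `^ p) K1.
    exact: (lyap_initial_moment p1 hN mX0' init).
  have bnd := mom N hN M hM h1 hz X Y ssm K1 lyapK.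
  have [_ _] := ext N hN M hM h1 hz X Y ssm _ bnd i t iN tT.
  by rewrite unlock; under eq_integral do rewrite -enorm_powR2.
rewrite -[leLHS]mule1; apply: lee_pmul => //.
- by rewrite lee_fin lerDr.
- by rewrite leeDl.
Qed.
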